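(* Suppose there is a countable family of pairs $(S_j,T_j)$, $j\in\mathbb{N}$, of $\mathbb{G}$-stopping times such that (1) each $T_j$ is an $\mathbb{F}$-stopping time; (2) $(\tau,\infty)\subset\bigcup_{j\in\mathbb{N}}(S_j,T_j)$ (as subsets of $\mathbb{R}_+\times\Omega$); and for each $j$ there exists an $s\mathcal{H}$-measure $\mathbb{Q}_j$ over $(S_j,T_j]$. Then $(\tau,\infty)\in\mathcal{L}^o$. If condition (2) is replaced by (2') $[\tau,\infty)\cap((0,\infty)\times\Omega)\subset\bigcup_{j\in\mathbb{N}}(S_j,T_j)$, then the global optional splitting formula holds at $\tau$ with respect to $\mathbb{F}$.
   Context: Let $(\Omega,\mathcal{A},\mathbb{Q})$ be a probability space with a right-continuous filtration $\mathbb{F}=(\mathcal{F}_t)_{t\ge0}$ such that $\mathcal{F}_0$ contains $\mathcal{N}^{\mathcal{F}_\infty}$, where for a $\sigma$-algebra $\mathcal{T}\subset\mathcal{A}$, $\mathcal{N}^{\mathcal{T}}$ denotes the $\sigma$-algebra generated by all subsets of $\mathcal{T}$-measurable $\mathbb{Q}$-null sets. Let $\tau$ be a random variable with values in $[0,\infty]$, let $\mathcal{N}=\mathcal{N}^{\sigma(\tau)\vee\mathcal{F}_\infty}$, and let $\mathbb{G}=(\mathcal{G}_t)_{t\ge0}$ with $\mathcal{G}_t=\mathcal{N}\vee\bigcap_{s>t}(\mathcal{F}_s\vee\sigma(\tau\wedge s))$. Identities are understood up to indistinguishability outside an $\mathcal{N}$-measurable $\mathbb{Q}$-null set. A $\mathbb{G}$-optional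 process $Y$ satisfies the optional splitting formula on a $\mathbb{G}$-optional set $A$ if there exist $Y'\in\mathcal{O}(\mathbb{F})$ and a $\mathcal{B}[0,\infty]\otimes\mathcal{O}(\mathbb{F})$-measurable $Y''$ on $[0,\infty]\times(\mathbb{R}_+\times\Omega)$ with $Y\mathbf{1}_A=(Y'\mathbf{1}_{[0,\tau)}+Y''(\tau)\mathbf{1}_{[\tau,\infty)})\mathbf{1}_A$, where $Y''(\tau)(t,\omega)=Y''(\tau(\omega),t,\omega)$; $\mathcal{L}^o$ is the family of $\mathbb{G}$-optional sets on which every $\mathbb{G}$-optional process satisfies it, and the global optional splitting formula means $\mathbb{R}_+\times\Omega\in\mathcal{L}^o$. For $\mathbb{G}$-stopping times $S,T$, a probability measure $\mathbb{Q}'$ on $\mathcal{G}_\infty$ is an $s\mathcal{H}$-measure over $(S,T]$ if $\mathbb{Q}'$ is equivalent to $\mathbb{Q}$ on $\mathcal{G}_\infty$ and, for every $(\mathbb{Q},\mathbb{F})$-local martingale $X$, the process $X^{(S,T]}_t=X_{(S\vee T)\wedge t}-X_{S\wedge t}$, $t\ge0$, is a $(\mathbb{Q}',\mathbb{G})$-local martingale. *)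

(* Defs.v *)
From HB Require Import structures.
From mathcomp Require Import all_boot all_order all_algebra.
From mathcomp Require Import all_classical all_reals all_analysis.
From mathcomp Require Import measurable_realfun.
Set Implicit Arguments. Unset Strict Implicit. Unset Printing Implicit Defensive.
Import Order.TTheory GRing.Theory Num.Theory.
Import numFieldNormedType.Exports.
Local Open Scope classical_set_scope.
Local Open Scope ring_scope.

Section Defs.
Context {R : realType}.

(* processes are maps R -> Omega -> R, only times t >= 0 matter;
   subsets of R_+ x Omega are subsets of [set p | 0 <= p.1] *)
Definition timedom {Om : Type} : set (R * Om) := [set p | 0 <= p.1].

Definition sa_join (Om : Type) (A B : set (set Om)) : set (set Om) :=
  <<s A `|` B >>.

Definition sigma_of (Om : Type) (f : Om -> \bar R) : set (set Om) :=
  <<s [set A | exists B : set (\bar R), measurable B /\ A = f @^-1` B] >>.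

Definition sa_inf (Om : Type) (F : R -> set (set Om)) : set (set Om) :=
  <<s \bigcup_(t in [set t : R | 0 <= t]) F t >>.

Definition nullsa (Om : Type) (Q : set Om -> \bar R) (T : set (set Om))
  : set (set Om) :=
  <<s [set N | exists M, T M /\ Q M = 0%E /\ N `<=` M] >>.

Definition cadlag (Om : Type) (X : R -> Om -> R) : Prop :=
  forall w : Om,
    (forall t : R, 0 <= t -> (fun s => X s w) @ at_right t --> X t w) /\
    (forall t : R, 0 < t -> exists l : R, (fun s => X s w) @ at_left t --> l).

Definition adapted (Om : Type) (F : R -> set (set Om)) (X : R -> Om -> R)
  : Prop :=
  forall t : R, 0 <= t -> forall B : set R, measurable B -> F t (X t @^-1` B).

Definition optional_sa (Om : Type) (F : R -> set (set Om))
  : set (set (R * Om)) :=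
  <<s (timedom : set (R * Om)),
    [set A | exists (X : R -> Om -> R) (B : set R),
       [/\ cadlag X, adapted F X, measurable B &
           A = timedom `&` [set p | B (X p.1 p.2)]]] >>.

Definition optional_proc (Om : Type) (F : R -> set (set Om))
  (Y : R -> Om -> R) : Prop :=
  forall B : set R, measurable B ->
    optional_sa F (timedom `&` [set p | B (Y p.1 p.2)]).

Definition stopping_time (Om : Type) (F : R -> set (set Om))
  (T : Om -> \bar R) : Prop :=
  (forall w, (0 <= T w)%E) /\
  forall t : R, 0 <= t -> F t [set w | (T w <= t%:E)%E].

Definition stop_at (Om : Type) (X : R -> Om -> R) (U : Om -> \bar R)
  : R -> Om -> R :=
  fun t w => X (if (U w < t%:E)%E then fine (U w) else t) w.

(** martingales and local martingales (conditional expectations written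
    through their defining property) *)
Definition martingale d (T : measurableType d) (P : probability T R)
  (F : R -> set (set T)) (X : R -> T -> R) : Prop :=
  [/\ adapted F X,
      (forall t : R, 0 <= t -> P.-integrable setT (EFin \o X t)) &
      (forall s t : R, 0 <= s -> s <= t -> forall A, F s A ->
         (\int[P]_(w in A) (X t w)%:E = \int[P]_(w in A) (X s w)%:E)%E)].

Definition local_martingale d (T : measurableType d) (P : probability T R)
  (F : R -> set (set T)) (X : R -> T -> R) : Prop :=
  [/\ cadlag X, adapted F X &
    exists Tn : nat -> T -> \bar R,
      [/\ (forall n, stopping_time F (Tn n)),
          (forall n w, (Tn n w <= Tn n.+1 w)%E),
          (exists M : set T, [/\ measurable M, P M = 0%E &
              forall w, ~ M w -> forall r : R, exists n, (r%:E <= Tn n w)%E]) &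
          (forall n, martingale P F (stop_at X (Tn n)))]].

Section Enlargement.
Context {d : measure_display} {Om : measurableType d}.
Variables (Q : probability Om R) (F : R -> set (set Om)) (tau : Om -> \bar R).

Definition Ncal : set (set Om) :=
  nullsa Q (sa_join (sigma_of tau) (sa_inf F)).

Definition Gfilt (t : R) : set (set Om) :=
  sa_join Ncal
    (\bigcap_(s in [set s : R | t < s])
        sa_join (F s) (sigma_of (fun w => Order.min (tau w) s%:E))).

Definition Ginf : set (set Om) := sa_inf Gfilt.

Definition ext_dom : set (\bar R * (R * Om)) :=
  [set q | (0 <= q.1)%E /\ 0 <= q.2.1].

Definition split_sa : set (set (\bar R * (R * Om))) :=
  <<s ext_dom,
    [set C | exists (B : set (\bar R)) (O : set (R * Om)),
       [/\ measurable B, B `<=` [set x | (0 <= x)%E], optional_sa F O &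
           C = B `*` O]] >>.

Definition splitting (Y : R -> Om -> R) (A : set (R * Om)) : Prop :=
  exists Y' : R -> Om -> R, optional_proc F Y' /\
  exists Y'' : \bar R -> R -> Om -> R,
    (forall B : set R, measurable B ->
       split_sa (ext_dom `&` [set q | B (Y'' q.1 q.2.1 q.2.2)])) /\
    exists M : set Om, [/\ Ncal M, Q M = 0%E &
      forall w, ~ M w -> forall t : R, 0 <= t ->
        (Y t w * (\1_A (t, w) : R)) =
        ((Y' t w * (\1_[set p | (p.1%:E < tau p.2)%E] (t, w) : R) +
          Y'' (tau w) t w * (\1_[set p | (tau p.2 <= p.1%:E)%E] (t, w) : R))
         * (\1_A (t, w) : R))].

Definition Lo (A : set (R * Om)) : Prop :=
  optional_sa Gfilt A /\
  forall Y : R -> Om -> R, optional_proc Gfilt Y -> splitting Y A.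

Definition sH_measure (Q' : probability (g_sigma_algebraType Ginf) R)
  (S T : Om -> \bar R) : Prop :=
  (forall A : set Om, Ginf A -> (Q A = 0%E <-> Q' A = 0%E)) /\
  forall X : R -> Om -> R, local_martingale Q F X ->
    local_martingale Q' Gfilt
      (fun t w => stop_at X (fun w => Order.max (S w) (T w)) t w
                  - stop_at X S t w).

End Enlargement.

Definition sint_oo (Om : Type) (S T : Om -> \bar R) : set (R * Om) :=
  [set p | 0 <= p.1 /\ (S p.2 < p.1%:E)%E /\ (p.1%:E < T p.2)%E].

Definition after (Om : Type) (tau : Om -> \bar R) : set (R * Om) :=
  [set p | 0 <= p.1 /\ (tau p.2 < p.1%:E)%E].

Definition from_pos (Om : Type) (tau : Om -> \bar R) : set (R * Om) :=
  [set p | 0 < p.1 /\ (tau p.2 <= p.1%:E)%E].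

End Defs.

(* Main.v *)
Require Import Defs.
From HB Require Import structures.
From mathcomp Require Import all_boot all_order all_algebra.
From mathcomp Require Import all_classical all_reals all_analysis.
From mathcomp Require Import measurable_realfun.
From mathcomp Require Import ring lra zify.
Set Implicit Arguments. Unset Strict Implicit. Unset Printing Implicit Defensive.
Import Order.TTheory GRing.Theory Num.Theory.
Import numFieldNormedType.Exports.
Local Open Scope classical_set_scope.
Local Open Scope ring_scope.

(** Every [G]-optional set must be shown to agree, up to indistinguishability, with
    an [F]-optional set before [tau] and, from [tau] on, with the section at [tau]
    of a set in B[0,oo] (x) O(F); it suffices to treat the sets [{c < X}] with [X]
    cadlag and [G]-adapted.  Before [tau] the fields [G_t] and [F_t] coincide, and
    [{c < X}] is recovered from the up- and downcrossings of [X] along the dyadics.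

    On [(S, T)] with [tau <= t], let [Q'] be the sH-measure.  For [B] in [F_r] inside
    [{r < T}], the cadlag martingale [Q(B | F_t)] is an [F]-martingale, hence its part
    on [(S, T]] is a bounded ([Q'], [G])-martingale: there it is also the
    ([Q'], [G])-projection of the indicator of [B].  Multiplying by functions of [tau]
    and approximating in L^1([Q']), every bounded [G_q]-measurable variable supported
    by [{q < T}] is approximated by variables whose projections before [q] are given
    by processes [m(tau, t)].  If [Y] is cadlag, approximate [Y] at the next dyadic of
    level [n] and call [M_n] the resulting projections; they have the form [m(tau, t)].
    They converge to [Y] up to a null set.  Otherwise [Y] would have to jump by a fixed
    amount in every interval between the restarts defined by successive times where
    [M_n - Y] is large, which contradicts the existence of left limits of [Y]. *)

(** Information is available only at fixed times, each with its own null set, so every random time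
    is approached through countably many dyadics. Convergence of [M_n] at all times simultaneously
    is a statement of the kind usually drawn from a section theorem; the restarts take its place.
    The quantitative link is the following: on an event of [G_t] where [M_n - Y] exceeds [e], the
    projection property forces [Y] at the next dyadic to differ from [Y_t] by more than [e/3] on a
    fixed fraction of the event, up to an error of order [2^-n]; the fraction is governed by the
    bound [2L] on increments of [Y]. The restriction to [{r < T}] makes the sH-measure usable: it
    controls martingales on [(S, T]] only, and an event inside [{r < T}] has a martingale that
    vanishes between [T] and [r], so stopping at [T] loses nothing. Since [T] is an F-stopping time,
    intersecting with [{r < T}] does not leave [F_r]. Projections are never passed to a limit: only
    terminal variables are approximated, and the errors enter the estimates as a small additive set
    function. *)

Lemma exists_bigcup (T : Type) (I : countType) (A : I -> set T) :
  [set x | exists i, A i x] = \bigcup_n (if unpickle n is Some i then A i else set0).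
Proof.
apply/seteqP; split => [x [i Aix]|x [n _]]; last by case: unpickle => // i Aix; exists i.
by exists (pickle i) => //; rewrite pickleK.
Qed.

(** * Sigma-algebras as families of sets, and measurability with respect to them *)

Section SigmaAlgebras.
Variables (T : Type) (H : set (set T)).
Hypothesis hH : sigma_algebra setT H.

Lemma sa0 : H set0. Proof. by case: hH. Qed.

Lemma saC A : H A -> H (~` A).
Proof. by move=> HA; rewrite -setTD; case: hH => _ + _; exact. Qed.

Lemma saT : H setT. Proof. by rewrite -setC0; exact/saC/sa0. Qed.

Lemma sa_bigcup (A : nat -> set T) : (forall n, H (A n)) -> H (\bigcup_n A n).
Proof. by case: hH => _ _; exact. Qed.

Lemma saU A B : H A -> H B -> H (A `|` B).
Proof.
move=> HA HB; rewrite -bigcup2E; apply: sa_bigcup => -[|[|n]] //=.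
exact: sa0.
Qed.

Lemma saI A B : H A -> H B -> H (A `&` B).
Proof.
move=> HA HB; rewrite -(setCK (A `&` B)) setCI.
by apply/saC/saU; exact: saC.
Qed.

Lemma saD A B : H A -> H B -> H (A `\` B).
Proof. by move=> HA HB; rewrite setDE; apply: saI => //; exact: saC. Qed.

Lemma sa_ex (I : countType) (A : I -> set T) : (forall i, H (A i)) ->
  H [set x | exists i, A i x].
Proof.
move=> HA; rewrite exists_bigcup; apply: sa_bigcup => n.
by case: unpickle => [i|]; [exact: HA|exact: sa0].
Qed.

Lemma sa_all (I : countType) (A : I -> set T) : (forall i, H (A i)) ->
  H [set x | forall i, A i x].
Proof.
move=> HA; have -> : [set x | forall i, A i x] = ~` [set x | exists i, (~` A i) x].
  apply/seteqP; split => [x Ax [i]|x Ax i]; first by apply; exact: Ax.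
  by apply: contrapT => nA; apply: Ax; exists i.
by apply/saC/sa_ex => i; exact: saC.
Qed.

Lemma sa_cst (P : Prop) : H [set _ | P].
Proof.
have [p|p] := pselect P.
  by rewrite (_ : [set _ | P] = setT); [exact: saT|apply/seteqP; split].
by rewrite (_ : [set _ | P] = set0); [exact: sa0|apply/seteqP; split].
Qed.

Lemma sa_imply (P : Prop) A : (P -> H A) -> H [set x | P -> A x].
Proof.
move=> HA; have [p|p] := pselect P.
  rewrite (_ : [set x | P -> A x] = A); first exact: HA.
  by apply/seteqP; split => x //=; apply.
by rewrite (_ : [set x | P -> A x] = setT); [exact: saT|apply/seteqP; split=> x // _ /p].
Qed.

Lemma sa_and (P : Prop) A : (P -> H A) -> H [set x | P /\ A x].
Proof.
move=> HA; have [p|p] := pselect P.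
  rewrite (_ : [set x | P /\ A x] = A); first exact: HA.
  by apply/seteqP; split => x //=; tauto.
by rewrite (_ : [set x | P /\ A x] = set0); [exact: sa0|apply/seteqP; split=> x // [/p]].
Qed.

Lemma sa_gen (G : set (set T)) : G `<=` H -> <<s G >> `<=` H.
Proof. by move=> GH; exact: smallest_sub. Qed.

End SigmaAlgebras.

Lemma sa_g (T : Type) (G : set (set T)) : sigma_algebra setT <<s G >>.
Proof. exact: smallest_sigma_algebra. Qed.

(** Many sub-sigma-algebras live on the same type, so measurability is stated for a bare family of
    sets; [mfP] passes to the library notion on the generated type. *)
Definition mf (T : Type) (R : realType) (H : set (set T)) (f : T -> R) :=
  forall B : set R, measurable B -> H (f @^-1` B).

Section MeasurableWrtSigmaAlgebra.
Variables (T : pointedType) (R : realType) (H : set (set T)).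
Hypothesis hH : sigma_algebra setT H.

Implicit Types f g : T -> R.

Lemma mfP f :
  mf H f <-> measurable_fun (setT : set (g_sigma_algebraType H)) f.
Proof.
split=> [fH _ B mB|fH B mB].
  by rewrite setTI; apply: sub_sigma_algebra; exact: fH.
have := fH measurableT B mB; rewrite setTI /measurable /=.
by rewrite sigma_algebra_id.
Qed.

Lemma mf_cst c : mf H (fun _ : T => c : R).
Proof. by apply/mfP; exact: measurable_cst. Qed.

Lemma mfD f g : mf H f -> mf H g -> mf H (fun x => f x + g x).
Proof. by rewrite !mfP => ? ?; exact: measurable_funD. Qed.

Lemma mfB f g : mf H f -> mf H g -> mf H (fun x => f x - g x).
Proof. by rewrite !mfP => ? ?; exact: measurable_funB. Qed.

Lemma mfM f g : mf H f -> mf H g -> mf H (fun x => f x * g x).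
Proof. by rewrite !mfP => ? ?; exact: measurable_funM. Qed.

Lemma mf_comp (g : R -> R) f : measurable_fun setT g -> mf H f ->
  mf H (fun x => g (f x)).
Proof.
move=> mg fH B mB; apply: (fH (g @^-1` B)).
by rewrite -[_ @^-1` _]setTI; exact: mg.
Qed.

Lemma mf_indic A : H A -> mf H (\1_A : T -> R).
Proof.
move=> HA; apply/mfP; apply: measurable_indic.
exact: sub_sigma_algebra.
Qed.

Lemma mf_if A f g : H A -> mf H f -> mf H g ->
  mf H (fun x => if x \in A then f x else g x).
Proof.
move=> HA fH gH.
have -> : (fun x => if x \in A then f x else g x) =
    (fun x => f x * \1_A x + g x * (1 - \1_A x)).
  apply/funext => x; rewrite indicE; case: (x \in A) => /=.
    by rewrite subrr mulr0 addr0 mulr1.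
  by rewrite mulr0 add0r subr0 mulr1.
have iA := mf_indic HA.
by apply: mfD; apply: mfM => //; apply: mfB => //; exact: mf_cst.
Qed.

Lemma mf_lt f c : mf H f -> H [set x | c < f x].
Proof.
move=> fH; rewrite (_ : [set x | _] = f @^-1` `]c, +oo[%classic).
  exact: fH.
by apply/seteqP; split => x /=; rewrite in_itv/= andbT.
Qed.

Lemma mf_gt f c : mf H f -> H [set x | f x < c].
Proof.
move=> fH; rewrite (_ : [set x | _] = f @^-1` `]-oo, c[%classic).
  exact: fH.
by apply/seteqP; split => x /=; rewrite in_itv.
Qed.

Lemma mf_le f c : mf H f -> H [set x | c <= f x].
Proof.
move=> fH; rewrite (_ : [set x | _] = f @^-1` `[c, +oo[%classic).
  exact: fH.
by apply/seteqP; split => x /=; rewrite in_itv/= andbT.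
Qed.

Lemma mf_lim (f : nat -> T -> R) g : (forall n, mf H (f n)) ->
  (forall x, f n x @[n --> \oo] --> g x) -> mf H g.
Proof.
move=> fH fg; apply/mfP.
apply: (@measurable_fun_cvg _ (g_sigma_algebraType H) R setT f g) => [n|x _].
  exact/mfP.
exact: fg.
Qed.

End MeasurableWrtSigmaAlgebra.

Lemma mf_sub (T : Type) (R : realType) (H H' : set (set T)) (f : T -> R) :
  H `<=` H' -> mf H f -> mf H' f.
Proof. by move=> HH' fH B mB; apply/HH'/fH. Qed.

(** * Real-valued expectations of bounded measurable functions *)

Section BoundedExpectation.
Context {d : measure_display} {T : measurableType d} {R : realType}.
Variable P : probability T R.
Implicit Types f g : T -> R.

Definition bm f := measurable_fun setT f /\ exists C, forall x, `|f x| <= C.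

Definition Ex f : R := fine (\int[P]_x (f x)%:E).

Definition Pr (A : set T) : R := fine (P A).

Lemma PrE A : measurable A -> P A = (Pr A)%:E.
Proof. by move=> mA; rewrite /Pr fineK// fin_num_measure. Qed.

Lemma bm_cst c : bm (fun _ => c).
Proof. by split; [exact: measurable_cst|exists `|c|]. Qed.

Lemma bmD f g : bm f -> bm g -> bm (fun x => f x + g x).
Proof.
move=> [mf [C fC]] [mg [C' gC]]; split; first exact: measurable_funD.
by exists (C + C') => x; rewrite (le_trans (ler_normD _ _))// lerD.
Qed.

Lemma bmB f g : bm f -> bm g -> bm (fun x => f x - g x).
Proof.
move=> [mf [C fC]] [mg [C' gC]]; split; first exact: measurable_funB.
by exists (C + C') => x; rewrite (le_trans (ler_normB _ _))// lerD.
Qed.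

Lemma bmM f g : bm f -> bm g -> bm (fun x => f x * g x).
Proof.
move=> [mf [C fC]] [mg [C' gC]]; split; first exact: measurable_funM.
by exists (C * C') => x; rewrite normrM ler_pM.
Qed.

Lemma bm_norm f : bm f -> bm (fun x => `|f x|).
Proof.
move=> [mf [C fC]]; split; first exact: measurableT_comp.
by exists C => x; rewrite normr_id.
Qed.

Lemma bm_indic (A : set T) : measurable A -> bm (\1_A : T -> R).
Proof.
move=> mA; split; first exact: measurable_indic.
by exists 1 => x; rewrite indicE; case: (x \in A); rewrite ?normr1 ?normr0.
Qed.

Lemma bm_integrable f : bm f -> P.-integrable setT (EFin \o f).
Proof.
move=> [mf [C fC]]; apply: measurable_bounded_integrable => //.
  exact: fin_num_fun_lty.
exists C; split; first exact: num_real.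
by move=> M CM x _; exact: le_trans (fC x) (ltW CM).
Qed.

Lemma ExE f : bm f -> (\int[P]_x (f x)%:E)%E = (Ex f)%:E.
Proof.
move=> bf; rewrite /Ex fineK//.
exact: (integrable_fin_num _ (bm_integrable bf)).
Qed.

Lemma Ex_ext f g : f =1 g -> Ex f = Ex g.
Proof. by move=> fg; congr Ex; exact/funext. Qed.

Lemma ExD f g : bm f -> bm g -> Ex (fun x => f x + g x) = Ex f + Ex g.
Proof.
move=> bf bg; apply: EFin_inj; rewrite -ExE; last exact: bmD.
rewrite EFinD -!ExE// -integralD//; exact: bm_integrable.
Qed.

Lemma ExB f g : bm f -> bm g -> Ex (fun x => f x - g x) = Ex f - Ex g.
Proof.
move=> bf bg; apply: EFin_inj; rewrite -ExE; last exact: bmB.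
rewrite EFinB -!ExE// -integralB_EFin//; exact: bm_integrable.
Qed.

Lemma ExZ f c : bm f -> Ex (fun x => c * f x) = c * Ex f.
Proof.
move=> bf; apply: EFin_inj; rewrite -ExE; last by apply: bmM => //; exact: bm_cst.
rewrite EFinM -ExE//.
under eq_integral do rewrite EFinM.
by rewrite integralZl//; exact: bm_integrable.
Qed.

Lemma le_Ex f g : bm f -> bm g -> (forall x, f x <= g x) -> Ex f <= Ex g.
Proof.
move=> bf bg fg; rewrite -lee_fin -!ExE//; apply: le_integral => //.
- exact: bm_integrable.
- exact: bm_integrable.
- by move=> x _; rewrite lee_fin.
Qed.

Lemma Ex_cst c : Ex (fun _ => c) = c.
Proof.
apply: EFin_inj; rewrite -ExE; last exact: bm_cst.
rewrite integral_cst// -[RHS]mule1; congr *%E.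
exact: probability_setT.
Qed.

Lemma Ex_indic A : measurable A -> Ex \1_A = Pr A.
Proof. by move=> mA; rewrite /Ex integral_indic// setIT. Qed.

Lemma Ex_ge0 f : bm f -> (forall x, 0 <= f x) -> 0 <= Ex f.
Proof.
by move=> bf f0; rewrite -(Ex_cst 0); apply: le_Ex => //; exact: bm_cst.
Qed.

Lemma le_norm_Ex f : bm f -> `|Ex f| <= Ex (fun x => `|f x|).
Proof.
move=> bf; have bnf := bm_norm bf; rewrite ler_norml; apply/andP; split.
  rewrite -(mulN1r (Ex _)) -ExZ//; apply: le_Ex => //.
    by apply: bmM => //; exact: bm_cst.
  by move=> x; rewrite mulN1r lerNl ler_normr lexx orbT.
by apply: le_Ex => // x; exact: ler_norm.
Qed.

Lemma Ex_ae f g (N : set T) : bm f -> bm g -> measurable N -> P N = 0%E ->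
  (forall x, ~ N x -> f x = g x) -> Ex f = Ex g.
Proof.
move=> bf bg mN N0 fg; congr fine; apply: ae_eq_integral => //.
- exact/measurable_EFinP/bf.1.
- exact/measurable_EFinP/bg.1.
- exists N; split => // x /=; apply: contra_notP => Nx _.
  by rewrite fg.
Qed.

Lemma Ex_cvg (f : nat -> T -> R) g (C : R) (N : set T) :
  (forall n, measurable_fun setT (f n)) -> measurable_fun setT g ->
  (forall n x, `|f n x| <= C) -> measurable N -> P N = 0%E ->
  (forall x, ~ N x -> f n x @[n --> \oo] --> g x) ->
  Ex (f n) @[n --> \oo] --> Ex g.
Proof.
move=> mf mg fC mN N0 fg.
have [] := @dominated_convergence _ T R P setT measurableT
  (fun n x => (f n x)%:E) (fun x => (g x)%:E) (cst C%:E).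
- by move=> n; exact/measurable_EFinP.
- exact/measurable_EFinP.
- exists N; split => // x /=; apply: contra_notP => Nx _.
  by apply: cvg_EFin; [exact: nearW|exact: fg].
- by apply: bm_integrable; exact: bm_cst.
- by apply: aeW => x n _; rewrite lee_fin.
move=> ig _ cv; apply: fine_cvg; rewrite /Ex fineK; first exact: cv.
exact: (integrable_fin_num _ ig).
Qed.

Lemma Pr_ge0 A : 0 <= Pr A. Proof. exact: fine_ge0. Qed.

Lemma le_Pr A B : measurable A -> measurable B -> A `<=` B -> Pr A <= Pr B.
Proof.
by move=> mA mB AB; rewrite -lee_fin -!PrE// le_measure// inE.
Qed.

Lemma Pr_eq0 A : measurable A -> Pr A = 0 -> P A = 0%E.
Proof. by move=> mA; rewrite PrE// => ->. Qed.

(** Each tail union contains [A n], so its probability is at least [a - e n]; the tail unions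
    decrease to the limsup and continuity from above concludes. *)
Lemma Pr_lim_sup_set (A : nat -> set T) (a : R) (e : nat -> R) :
  (forall n, measurable (A n)) -> e n @[n --> \oo] --> 0 ->
  (forall n, a <= Pr (A n) + e n) -> a <= Pr (lim_sup_set A).
Proof.
move=> mA e0 aA.
have mB n : measurable (\bigcup_(k >= n) A k).
  by apply: bigcup_measurable => k _; exact: mA.
have mL : measurable (lim_sup_set A) by exact: bigcapT_measurable.
have cv : Pr (\bigcup_(k >= n) A k) @[n --> \oo] --> Pr (lim_sup_set A).
  apply: fine_cvg; rewrite -PrE//; apply: lim_sup_set_cvg => //.
  by apply: le_lt_trans (probability_le1 P (mB 0%N)) _; rewrite ltry.
have cv' : (Pr (\bigcup_(k >= n) A k) + e n) @[n --> \oo] --> Pr (lim_sup_set A).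
  by rewrite -[X in _ --> X]addr0; exact: cvgD.
rewrite -(cvg_lim _ cv')//; apply: limr_ge; first by apply/cvg_ex; eexists; exact: cv'.
apply: nearW => n; rewrite (le_trans (aA n))// lerD2r; apply: le_Pr => //.
by move=> x Anx; exists n => /=.
Qed.

End BoundedExpectation.

(** * Dyadic times *)

Section Dyadics.
Variable R : realType.

(** The index is a pair (numerator, exponent), so one time has many indices; since pairs form a
    [countType], quantifying over dyadic times is a countable operation. *)
Definition dy (u : nat * nat) : R := u.1%:R / 2 ^+ u.2.

Lemma dy_ge0 u : 0 <= dy u.
Proof. by rewrite divr_ge0// exprn_ge0. Qed.

Lemma dy_scale i p m : dy (i, p) = dy (i * 2 ^ m, p + m)%N.
Proof.
rewrite /dy/= exprD natrM natrX invfM mulrACA divff ?mulr1//.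
Qed.

Lemma dy_lt_nat i p K : (dy (i, p) < K%:R) = (i < K * 2 ^ p)%N.
Proof. by rewrite /dy/= ltr_pdivrMr ?exprn_gt0// -natrX -natrM ltr_nat. Qed.

Lemma half_pow_small (e : R) : 0 < e -> exists n, forall m, (n <= m)%N ->
  (2 ^+ m)^-1 < e.
Proof.
move=> e0; exists (Num.trunc e^-1).+1 => m nm.
have em : e^-1 < m%:R.
  by rewrite (lt_le_trans (truncnS_gt _))// ler_nat.
rewrite -[ltRHS]invrK ltf_pV2 ?posrE ?exprn_gt0 ?invr_gt0//.
apply: (lt_trans em); rewrite -natrX ltr_nat.
exact: ltn_expl.
Qed.

Lemma dy_dense (a b : R) : 0 <= a -> a < b -> exists u, a < dy u < b.
Proof.
move=> a0 ab.
have /half_pow_small[p hp] : 0 < b - a by rewrite subr_gt0.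
have {hp} := hp p (leqnn _); set h := (2 ^+ p)^-1 => hab.
have h0 : 0 < h by rewrite invr_gt0 exprn_gt0.
have t0 : 0 <= a / h by rewrite divr_ge0// ltW.
have /andP[t1 t2] := truncn_itv t0.
exists ((Num.trunc (a / h)).+1, p); rewrite /dy/= -/h; apply/andP; split.
  by rewrite -ltr_pdivrMr.
rewrite -natr1 mulrDl mul1r.
have : (Num.trunc (a / h))%:R * h <= a by rewrite -ler_pdivlMr.
by move: hab; lra.
Qed.

End Dyadics.

Section Events.
Context {d : measure_display} {T : measurableType d} {R : realType}.
Variable P : probability T R.

Lemma PrU A B : measurable A -> measurable B -> A `&` B = set0 ->
  Pr P (A `|` B) = Pr P A + Pr P B.
Proof.
move=> mA mB AB; apply: EFin_inj; rewrite EFinD -!PrE ?measureU//.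
exact: measurableU.
Qed.

Lemma PrD A B : measurable A -> measurable B -> B `<=` A ->
  Pr P (A `\` B) = Pr P A - Pr P B.
Proof.
move=> mA mB BA; apply/esym/eqP; rewrite subr_eq; apply/eqP.
rewrite -PrU//; last first.
  by apply/seteqP; split=> x // [[]].
  exact: measurableD.
by rewrite setUC setDUK.
Qed.

Lemma Pr_nondecreasing (A : nat -> set T) (e : R) : 0 < e ->
  (forall n, measurable (A n)) -> (forall n, A n `<=` A n.+1) ->
  exists n, Pr P (\bigcup_n A n) <= Pr P (A n) + e.
Proof.
move=> e0 mA hA.
have mU : measurable (\bigcup_n A n) by exact: bigcupT_measurable.
have cv : Pr P (A n) @[n --> \oo] --> Pr P (\bigcup_n A n).
  apply: fine_cvg; rewrite -PrE//; apply: nondecreasing_cvg_mu => //.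
  by apply/nondecreasing_seqP => n; apply/subsetPset.
have : \forall n \near \oo, Pr P (\bigcup_n A n) - e < Pr P (A n).
  by apply: (cvgr_gt _ cv); rewrite ltrBlDr ltrDl.
move=> [n _ /(_ n (leqnn _))] h; exists n.
by move: h => /=; lra.
Qed.

Lemma null_bigcup (A : nat -> set T) : (forall n, measurable (A n)) ->
  (forall n, P (A n) = 0%E) -> P (\bigcup_n A n) = 0%E.
Proof.
move=> mA A0; apply: measure_negligible; first exact: bigcupT_measurable.
by apply: negligible_bigcup => n; exists (A n); split => //; exact: A0.
Qed.

End Events.

(** * Right-continuity and left limits of paths in epsilon-delta form *)

Section OneSidedLimits.
Variable R : realType.
Implicit Types (f : R -> R) (t : R).

Definition rc_at f t := forall r : R, 0 < r ->
  exists2 de : R, 0 < de & forall s : R, t <= s < t + de -> `|f s - f t| < r.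

Definition ll_at f t := exists l : R, forall r : R, 0 < r ->
  exists2 de : R, 0 < de & forall s : R, t - de < s < t -> `|f s - l| < r.

Lemma rc_atP f t : rc_at f t <-> f @ at_right t --> f t.
Proof.
split=> [h|/cvgrPdist_lt h r r0].
  apply/cvgrPdist_lt => e /h[de de0 hd]; near=> s.
  rewrite distrC; apply: hd; apply/andP; split; first by near: s; exact: nbhs_right_ge.
  by near: s; apply: nbhs_right_lt; rewrite ltrDl.
have [de /= de0 hd] := h _ r0; exists de => // s /andP[ts sd].
move: ts; rewrite le_eqVlt => /predU1P[<-|ts]; first by rewrite subrr normr0.
by rewrite distrC; apply: (hd s) => //=; rewrite distrC gtr0_norm; lra.
Unshelve. all: by end_near. Qed.

Lemma ll_atP f t : ll_at f t <-> exists l : R, f @ at_left t --> l.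
Proof.
split=> -[l h]; exists l.
  apply/cvgrPdist_lt => e /h[de de0 hd]; near=> s.
  rewrite distrC; apply: hd; apply/andP; split.
    by near: s; apply: nbhs_left_gt; rewrite ltrBlDr ltrDl.
  by near: s; exact: nbhs_left_lt.
move=> r r0; move/cvgrPdist_lt : h => /(_ _ r0)[de /= de0 hd].
exists de => // s /andP[ts st]; rewrite distrC; apply: (hd s) => //=.
by rewrite gtr0_norm; lra.
Unshelve. all: by end_near. Qed.

Lemma ll_at_cauchy f t : (forall r : R, 0 < r -> exists2 de : R, 0 < de &
   forall s s' : R, t - de < s < t -> t - de < s' < t -> `|f s - f s'| < r) ->
  ll_at f t.
Proof.
move=> h; apply/ll_atP; suff : cvg (f @ at_left t) by move=> /cvg_ex.
apply: cauchy_cvg; apply: cauchy_exP => e e0.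
have [de de0 hd] := h _ e0; exists (f (t - de / 2)); rewrite /nbhs/=.
near=> s; apply: hd; apply/andP; split; try by lra.
- by near: s; apply: nbhs_left_gt; rewrite ltrBlDr ltrDl.
- by near: s; exact: nbhs_left_lt.
Unshelve. all: by end_near. Qed.

Lemma cadlagP (Om : Type) (X : R -> Om -> R) : cadlag X <->
  (forall w t, 0 <= t -> rc_at (X ^~ w) t) /\ (forall w t, 0 < t -> ll_at (X ^~ w) t).
Proof.
split=> [h|[h1 h2] w].
  by split=> w t t0; [apply/rc_atP; exact: (h w).1|apply/ll_atP; exact: (h w).2].
by split=> t t0; [apply/rc_atP; exact: h1|apply/ll_atP; exact: h2].
Qed.

End OneSidedLimits.

(** * Convergence of approximate projections along a filtration *)

Section ApproximateProjection.
Context {d : measure_display} {Om : measurableType d} {R : realType}.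
Variables (P : probability Om R) (G : R -> set (set Om)).
Hypothesis G_sa : forall t : R, 0 <= t -> sigma_algebra setT (G t).
Hypothesis G_mono : forall s t : R, 0 <= s -> s <= t -> G s `<=` G t.
Hypothesis G_meas : forall t : R, 0 <= t -> G t `<=` measurable.

Variables (Y : R -> Om -> R) (E : R -> set Om) (M : nat -> R -> Om -> R).
Variables (q : nat -> R -> R) (nu : nat -> set Om -> R).
Variables (e e' al be : R) (K : nat).
Hypothesis Yrc : forall w (t : R), 0 <= t -> rc_at (Y ^~ w) t.
Hypothesis Yll : forall w (t : R), 0 < t -> ll_at (Y ^~ w) t.
Hypothesis Mrc : forall m w (t : R), E t w -> rc_at (M m ^~ w) t.
Hypothesis E_open : forall w (t : R), E t w ->
  exists2 de : R, 0 < de & forall s : R, t <= s < t + de -> E s w.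
Hypothesis E_pos : forall w (t : R), E t w -> 0 <= t.
Hypothesis q_itv : forall m (t : R), 0 <= t -> t < q m t <= t + (2 ^+ m)^-1.
Hypothesis Y_meas : forall t : R, 0 <= t -> mf (G t) (Y t).
Hypothesis nu_ge0 : forall m A, 0 <= nu m A.
Hypothesis nuU : forall m A B, measurable A -> measurable B ->
  A `&` B = set0 -> nu m (A `|` B) = nu m A + nu m B.
Hypothesis nu_le : forall m A, measurable A -> nu m A <= (2 ^+ m)^-1.
Hypothesis e_gt0 : 0 < e.
Hypothesis e'_gt0 : 0 < e'.
Hypothesis al_gt0 : 0 < al.
Hypothesis be_gt0 : 0 < be.

(** [E t] is the event on which the approximations [M m] are compared with [Y] at time [t]; outside
    it nothing is claimed about them. *)
Definition bad m t : set Om := [set w | E t w /\ e < `|M m t w - Y t w|].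

Definition jumpy m t : set Om := [set w | e' < `|Y (q m t) w - Y t w|].

Hypothesis bad_meas : forall m (t : R), 0 <= t -> G t (bad m t).
(** The only probabilistic input: being wrong by [e] at time [t] must be paid for by a move of [Y]
    before the next grid time [q m t], up to the error [nu m], which is summable in [m]. The set [A]
    is arbitrary in [G t], so the estimate can be localized at first hitting times. *)
Hypothesis bad_est : forall m (t : R) A, 0 <= t -> t < m%:R -> G t A ->
  A `<=` bad m t -> al * Pr P A <= be * Pr P (A `&` jumpy m t) + nu m A.

(* [past k t] says that [t] lies beyond the [k]-th restart, where each restart
   is the limit, as the level tends to infinity, of the first bad time of that
   level after the previous restart. *)
Fixpoint past (k : nat) (t : R) (w : Om) : Prop :=
  if k is k'.+1 then exists s : nat * nat, dy R s < t /\
    forall n, exists u : nat * nat, dy R u < dy R s /\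
      (past k' (dy R u) w /\ exists m, (n <= m)%N /\ bad m (dy R u) w)
  else True.

Lemma past_meas k (t : R) : 0 <= t -> G t (past k t).
Proof.
elim: k t => [|k IH] t t0 /=; first by apply: sa_cst; exact: G_sa.
apply: sa_ex; first exact: G_sa.
move=> s; apply: sa_and; first exact: G_sa.
move=> st; apply: sa_all; first exact: G_sa.
move=> n; apply: sa_ex; first exact: G_sa.
move=> u; apply: sa_and; first exact: G_sa.
move=> us; have ut : dy R u <= t by rewrite ltW// (lt_trans us).
apply: saI; first exact: G_sa.
  by apply: (G_mono _ ut); rewrite ?dy_ge0//; apply: IH; exact: dy_ge0.
apply: sa_ex; first exact: G_sa.
move=> m; apply: sa_and; first exact: G_sa.
by move=> nm; apply: (G_mono _ ut); rewrite ?dy_ge0//; apply: bad_meas; exact: dy_ge0.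
Qed.

Lemma past_pred k t w : past k.+1 t w -> past k t w.
Proof.
elim: k t => [//|k IH] t [s [st h]]; exists s; split => // n.
have [u [us [pu bu]]] := h n.
by exists u; split => //; split => //; exact: IH.
Qed.

Lemma past_le k l t w : (k <= l)%N -> past l t w -> past k t w.
Proof.
move=> kl; rewrite -(subnK kl); elim: (l - k)%N => // n IH /past_pred.
exact: IH.
Qed.

(** The inequality in [bad] is strict and all ingredients are right-continuous, so badness persists
    for a while and is seen at dyadic times. *)
Lemma bad_right m t w : bad m t w -> exists2 de : R, 0 < de &
  forall s : R, t <= s < t + de -> bad m s w.
Proof.
move=> [Etw eM]; have t0 := E_pos Etw.
(* Half of the excess over [e]: the moves of [M m] and of [Y] may each consume one half. *)
pose r := (`|M m t w - Y t w| - e) / 2.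
have r0 : 0 < r by rewrite divr_gt0// subr_gt0.
have [d1 d10 h1] := Yrc w t0 r0; have [d2 d20 h2] := Mrc m Etw r0.
have [d3 d30 h3] := E_open Etw.
exists (Num.min d1 (Num.min d2 d3)) => [|s /andP[ts]].
  by rewrite !lt_min d10 d20.
rewrite -ltrBlDl !lt_min => /and3P[s1 s2 s3].
have y1 : `|Y s w - Y t w| < r by apply: h1; rewrite ts/= -ltrBlDl.
have y2 : `|M m s w - M m t w| < r by apply: h2; rewrite ts/= -ltrBlDl.
split; first by apply: h3; rewrite ts/= -ltrBlDl.
have : `|M m t w - Y t w| <= `|M m s w - Y s w| + `|M m s w - M m t w| +
    `|Y s w - Y t w|.
  have -> : M m t w - Y t w = (M m s w - Y s w) - (M m s w - M m t w) +
    (Y s w - Y t w) by ring.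
  by rewrite (le_trans (ler_normD _ _))// lerD2r (le_trans (ler_normB _ _)).
by rewrite /r in y1 y2; lra.
Qed.

(** At each bad level the badness spreads to dyadics arbitrarily close to [t] on the right, and by
    induction these already lie beyond restart [k]; so no restart can get past [t]. *)
Lemma bad_past k (t s : R) w : 0 <= t -> (forall n, exists2 m, (n <= m)%N & bad m t w) ->
  t < s -> past k s w.
Proof.
move=> t0 hb; elim: k s => [//|k IH] s ts.
have [v /andP[tv vs]] := dy_dense t0 ts.
exists v; split => // n; have [m nm bm] := hb n.
have [de de0 hde] := bad_right bm.
have : t < Num.min (t + de) (dy R v) by rewrite lt_min tv ltrDl de0.
move=> /(dy_dense t0)[u /andP[tu]]; rewrite lt_min => /andP[ud uv].
exists u; split => //; split; first exact: IH.
by exists m; split => //; apply: hde; rewrite (ltW tu).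
Qed.

(** * One restart: jumps of [Y] near the first bad time after it *)

Section Level.
Variable k : nat.

Definition hit n (u : nat * nat) (w : Om) : Prop :=
  past k (dy R u) w /\ exists m, (n <= m)%N /\ bad m (dy R u) w.

Definition hitp n p (u : nat * nat) (w : Om) : Prop :=
  past k (dy R u) w /\ exists m, (n <= m < n + p)%N /\ bad m (dy R u) w.

(** The infimum of the hitting times need not be attained at a dyadic, so a witness is only required
    to be within [2^-n] of it, and to start a grid cell over which [Y] moves by more than [e']. *)
Definition wit n u (w : Om) : Prop := [/\ dy R u < K%:R, hit n u w,
  (exists2 m, (n <= m)%N & jumpy m (dy R u) w) &
  forall u', dy R u' < K%:R -> hit n u' w -> dy R u < dy R u' + (2 ^+ n)^-1].

Definition witness n (w : Om) : Prop := exists u, wit n u w.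

Lemma hit_meas n u : G (dy R u) (hit n u).
Proof.
have sa := G_sa (dy_ge0 R u).
apply: saI => //; first exact/past_meas/dy_ge0.
apply: sa_ex => // m; apply: sa_and => // _; exact/bad_meas/dy_ge0.
Qed.

Lemma hitp_meas n p u : G (dy R u) (hitp n p u).
Proof.
have sa := G_sa (dy_ge0 R u).
apply: saI => //; first exact/past_meas/dy_ge0.
apply: sa_ex => // m; apply: sa_and => // _; exact/bad_meas/dy_ge0.
Qed.

Lemma jumpy_meas m (t : R) : 0 <= t -> measurable (jumpy m t).
Proof.
move=> t0; have /andP[tq _] := q_itv m t0.
have q0 : 0 <= q m t by rewrite (le_trans t0)// ltW.
have sa := G_sa q0.
apply: (G_meas q0); apply: (@mf_lt _ _ _ (fun w => `|Y (q m t) w - Y t w|)).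
apply: (@mf_comp _ _ _ (fun x => `|x|)) => //; apply: mfB => //; first exact: Y_meas.
by apply: mf_sub (Y_meas t0); apply: G_mono => //; exact: ltW.
Qed.

Lemma jumpy_some_meas n (t : R) : 0 <= t ->
  measurable [set w | exists2 m, (n <= m)%N & jumpy m t w].
Proof.
move=> t0; rewrite (_ : [set w | _] = \bigcup_(m in [set m | (n <= m)%N]) jumpy m t)//.
by apply: bigcup_measurable => m _; exact: jumpy_meas.
Qed.

Definition nus n p A : R := \sum_(n <= m < n + p) nu m A.

Lemma nusU n p A B : measurable A -> measurable B -> A `&` B = set0 ->
  nus n p (A `|` B) = nus n p A + nus n p B.
Proof.
by move=> mA mB AB; rewrite /nus -big_split/=; apply: eq_bigr => m _; exact: nuU.
Qed.

Lemma nus_le n p A : measurable A -> nus n p A <= 2 * (2 ^+ n)^-1.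
Proof.
move=> mA; suff : nus n p A <= 2 * (2 ^+ n)^-1 - 2 * (2 ^+ (n + p))^-1.
  by move=> /le_trans; apply; rewrite gerBl mulr_ge0// invr_ge0 exprn_ge0.
rewrite /nus; elim: p => [|p IH]; first by rewrite addn0 big_geq// subrr.
rewrite addnS big_nat_recr/=; last exact: leq_addr.
have := nu_le (n + p) mA; rewrite exprS invfM mulrA divff// mul1r.
by move: IH; lra.
Qed.

(** The highest level at which a point of [A] is bad is peeled off: the part bad at level [n + p]
    obeys [bad_est], the rest is handled by induction, and the two parts are disjoint. The condition
    [K <= n] guarantees [t < m] for every level [m] involved. *)
Lemma est_levels n p (t : R) A : (K <= n)%N -> 0 <= t -> t < K%:R -> G t A ->
  A `<=` [set w | exists m, (n <= m < n + p)%N /\ bad m t w] ->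
  al * Pr P A <= be * Pr P (A `&` [set w | exists2 m, (n <= m)%N & jumpy m t w])
    + nus n p A.
Proof.
move=> Kn t0 tK; have sa := G_sa t0; have mG := G_meas t0.
have mJ := jumpy_some_meas n t0.
elim: p A => [|p IH] A GA Ab.
  rewrite /nus addn0 big_geq//.
  have -> : A = set0 by apply/seteqP; split => // w /Ab [m []]; lia.
  by rewrite set0I /Pr measure0/= !mulr0 add0r.
pose B := A `&` bad (n + p)%N t; pose C := A `\` B.
have GB : G t B by apply: saI => //; exact: bad_meas.
have GC : G t C by exact: saD.
have BC : C `&` B = set0 by apply/seteqP; split=> w // [[]].
have AE : A = C `|` B by rewrite /C setUC setDUK//; exact: subIsetl.
have estC : al * Pr P C <= be *
    Pr P (C `&` [set w | exists2 m, (n <= m)%N & jumpy m t w]) + nus n p C.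
  apply: IH => // w [Aw nBw]; have [m [nm bm]] := Ab _ Aw.
  have : (m <> n + p)%N by move=> mE; apply: nBw; split => //; rewrite -mE.
  by exists m; split => //; lia.
have estB : al * Pr P B <= be *
    Pr P (B `&` [set w | exists2 m, (n <= m)%N & jumpy m t w]) + nu (n + p)%N B.
  apply: (@le_trans _ _ (be * Pr P (B `&` jumpy (n + p)%N t) + nu (n + p)%N B)).
    apply: bad_est => //; last exact: subIsetr.
    by rewrite (lt_le_trans tK)// ler_nat; lia.
  rewrite lerD2r ler_pM2l//; apply: le_Pr.
  - by apply: measurableI; [exact: mG|exact: jumpy_meas].
  - by apply: measurableI; [exact: mG|exact: mJ].
  - move=> w [Bw Jw]; split => //; exists (n + p)%N => //; exact: leq_addr.
have nuA : nus n p C + nu (n + p)%N B <= nus n p.+1 A.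
  rewrite {1}/nus /nus addnS big_nat_recr/=; last exact: leq_addr.
  apply: lerD; last first.
    by rewrite [in leRHS]AE nuU ?lerDr//; exact: mG.
  apply: ler_sum => m _; rewrite [in leRHS]AE nuU ?lerDl//; exact: mG.
rewrite {1 2}AE setIUl PrU; [|exact: mG..|exact: BC].
rewrite PrU; last first.
- by rewrite setIACA BC set0I.
- by apply: measurableI; [exact: mG|exact: mJ].
- by apply: measurableI; [exact: mG|exact: mJ].
by rewrite !mulrDr; move: estC estB nuA; lra.
Qed.

Definition grid p i : R := dy R (i, p).

Definition hits n p j : set Om := [set w | exists2 i, (i < j)%N & hitp n p (i, p) w].

(** The jump is looked for at the first hit of the grid only, so that the events for different
    indices are disjoint and their estimates add up. *)
Definition jhits n p j : set Om := [set w | exists2 i, (i < j)%N &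
  hitp n p (i, p) w /\ (~ hits n p i w /\
  exists2 m, (n <= m)%N & jumpy m (grid p i) w)].

Lemma grid_ge0 p i : 0 <= grid p i. Proof. exact: dy_ge0. Qed.

Lemma grid_mono p i j : (i <= j)%N -> grid p i <= grid p j.
Proof. by move=> ij; rewrite ler_pM2r ?ler_nat// invr_gt0 exprn_gt0. Qed.

Lemma hits_meas n p j (t : R) : 0 <= t -> (forall i, (i < j)%N -> grid p i <= t) ->
  G t (hits n p j).
Proof.
move=> t0 jt; have sa := G_sa t0.
rewrite (_ : hits n p j = [set w | exists i, (i < j)%N /\ hitp n p (i, p) w]).
  apply: sa_ex => // i; apply: sa_and => // ij.
  by apply: (G_mono _ (jt _ ij)); [exact: grid_ge0|exact: hitp_meas].
by apply/seteqP; split => w [i]; [move=> ? ?; exists i|move=> [? ?]; exists i].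
Qed.

Lemma hitsS n p j : hits n p j.+1 = hits n p j `|` (hitp n p (j, p) `\` hits n p j).
Proof.
apply/seteqP; split => w.
  have [hw _|nhw [i ij hi]] := pselect (hits n p j w); first by left.
  move: ij; rewrite ltnS leq_eqVlt => /orP[/eqP ijE|ij]; last by left; exists i.
  by right; split => //; rewrite -ijE.
by move=> [[i ij hi]|[hj _]]; [exists i => //; exact: ltnW|exists j].
Qed.

Lemma jhitsS n p j : jhits n p j.+1 = jhits n p j `|`
  ((hitp n p (j, p) `\` hits n p j) `&` [set w | exists2 m, (n <= m)%N &
    jumpy m (grid p j) w]).
Proof.
apply/seteqP; split => w.
  move=> [i ij [hi [nhi Ji]]].
  move: ij; rewrite ltnS leq_eqVlt => /orP[/eqP ijE|ij]; last by left; exists i.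
  by right; split => //; [split|]; rewrite -ijE.
move=> [[i ij hi]|[[hj nhj] Jj]]; first by exists i => //; exact: ltnW.
by exists j.
Qed.

Lemma hits_measurable n p j : measurable (hits n p j).
Proof.
apply: (G_meas (grid_ge0 p j)); apply: hits_meas; first exact: grid_ge0.
by move=> i ij; apply: grid_mono; exact: ltnW.
Qed.

Lemma hitp_measurable n p u : measurable (hitp n p u).
Proof. by apply: (G_meas (dy_ge0 R u)); exact: hitp_meas. Qed.

Lemma jhits_measurable n p j : measurable (jhits n p j).
Proof.
elim: j => [|j IH].
  by rewrite (_ : jhits n p 0 = set0)//; apply/seteqP; split => // w [].
rewrite jhitsS; apply: measurableU => //; apply: measurableI.
  by apply: measurableD; [exact: hitp_measurable|exact: hits_measurable].
exact/jumpy_some_meas/grid_ge0.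
Qed.

(** The event that [j] is the first hit belongs to [G] at the time of index [j], so [est_levels]
    applies to it; disjointness over [j] sums the estimates. *)
Lemma est_grid n p j : (K <= n)%N -> (j <= K * 2 ^ p)%N ->
  al * Pr P (hits n p j) <= be * Pr P (jhits n p j) + nus n p (hits n p j).
Proof.
move=> Kn; elim: j => [|j IH] jK.
  have -> : hits n p 0 = set0 by apply/seteqP; split => // w [].
  rewrite /Pr measure0/= mulr0 addr_ge0 ?mulr_ge0 ?fine_ge0//; first exact: ltW.
  exact: sumr_ge0.
have {}IH := IH (ltnW jK).
pose A := hitp n p (j, p) `\` hits n p j.
have GA : G (grid p j) A.
  apply: saD; [exact/G_sa/grid_ge0|exact: hitp_meas|].
  apply: hits_meas; first exact: grid_ge0.
  by move=> i ij; apply: grid_mono; exact: ltnW.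
have mA : measurable A by exact: (G_meas (grid_ge0 p j)).
have mH := hits_measurable n p j.
have HA : hits n p j `&` A = set0 by apply/seteqP; split => // w [? []].
have eA : al * Pr P A <= be * Pr P (A `&` [set w | exists2 m, (n <= m)%N &
    jumpy m (grid p j) w]) + nus n p A.
  apply: est_levels => //; first exact: grid_ge0.
    by rewrite /grid dy_lt_nat.
  by move=> w [[_ hw] _].
rewrite hitsS jhitsS -/A PrU// PrU; last first.
- apply/seteqP; split => // w [[i ij [hi _]] [[_ +] _]]; apply.
  by exists i.
- by apply: measurableI => //; exact/jumpy_some_meas/grid_ge0.
- exact: jhits_measurable.
by rewrite nusU//; move: IH eA; rewrite !mulrDr; lra.
Qed.

Definition Hit n : set Om := [set w | exists u, dy R u < K%:R /\ hit n u w].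

Definition close n p : set Om := [set w | exists i, (i < K * 2 ^ p)%N /\
  (hitp n p (i, p) w /\ forall u', dy R u' < K%:R -> hit n u' w ->
    dy R (i, p) < dy R u' + (2 ^+ n)^-1)].

Lemma hit_measurable n u : measurable (hit n u).
Proof. by apply: (G_meas (dy_ge0 R u)); exact: hit_meas. Qed.

Lemma measurable_sa : sigma_algebra setT (@measurable _ Om).
Proof.
by split => [|A mA|A mA]; [|rewrite setTD; exact: measurableC|exact: bigcupT_measurable].
Qed.

Lemma Hit_measurable n : measurable (Hit n).
Proof.
apply: (sa_ex measurable_sa) => u; apply: (sa_and measurable_sa) => _.
exact: hit_measurable.
Qed.

Lemma close_measurable n p : measurable (close n p).
Proof.
have sa := measurable_sa.
apply: (sa_ex sa) => i; apply: (sa_and sa) => _; apply: measurableI.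
  exact: hitp_measurable.
apply: (sa_all sa) => u; apply: (sa_imply sa) => _.
have [lt|nlt] := boolP (dy R (i, p) < dy R u + (2 ^+ n)^-1).
  rewrite (_ : (fun w => _) = setT)//; exact/seteqP.
rewrite (_ : (fun w => _) = ~` hit n u); first exact/measurableC/hit_measurable.
by apply/seteqP; split => w // h hu; have := h hu.
Qed.

Lemma close_mono n p : close n p `<=` close n p.+1.
Proof.
move=> w [i [iK [[pw [m [mn bm]]] cl]]].
have dE : dy R (i, p) = dy R (i * 2, p.+1)%N.
  by rewrite (dy_scale R i p 1) addn1.
exists (i * 2)%N; split; first by rewrite expnS; lia.
rewrite -dE; split => //; rewrite /hitp -dE; split => //.
by exists m; split => //; lia.
Qed.

Lemma close_hits n p : close n p `<=` hits n p (K * 2 ^ p).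
Proof. by move=> w [i [iK [hi _]]]; exists i. Qed.

Lemma hits_Hit n p : hits n p (K * 2 ^ p) `<=` Hit n.
Proof.
move=> w [i iK [pw [m [/andP[mn _] bm]]]]; exists (i, p); split.
  by rewrite dy_lt_nat.
by split => //; exists m.
Qed.

(** Some dyadic hit is within [2^-n] of the infimum of all hits; it lies on every sufficiently fine
    grid, and its bad level is below [n + p] for large [p]. *)
Lemma Hit_close n : Hit n = \bigcup_p close n p.
Proof.
apply/seteqP; split => w; last by move=> [p _ /close_hits/hits_Hit].
move=> [u0 [u0K hu0]].
pose D := [set x | exists u, [/\ x = dy R u, dy R u < K%:R & hit n u w]].
have D0 : D !=set0 by exists (dy R u0), u0.
have lbD : lbound D 0 by move=> _ [u [-> _ _]]; exact: dy_ge0.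
have hD : has_inf D by split => //; exists 0.
have e0 : 0 < (2 ^+ n : R)^-1 by rewrite invr_gt0 exprn_gt0.
have [_ [[i p0] [-> uK [pu [m [nm bm]]]]] lt] := inf_adherent e0 hD.
(* Large enough both for the grid to contain the chosen dyadic and for its bad level [m] to be
   smaller than [n + p]. *)
pose p := (p0 + (m.+1))%N.
have dE : dy R (i, p0) = dy R (i * 2 ^ m.+1, p)%N by rewrite (dy_scale R i p0 m.+1).
exists p => //; exists (i * 2 ^ m.+1)%N; rewrite -dE; split.
  by move: uK; rewrite dE dy_lt_nat.
split; first by rewrite /hitp -dE; split => //; exists m; split => //; rewrite /p; lia.
move=> u' u'K hu'; rewrite (lt_le_trans lt)// lerD2r.
apply: ge_inf; first by exists 0.
by exists u'.
Qed.

(** Whoever is past restart [k.+1] has hits at every level, so the estimates on finite grids pass to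
    the limsup of the events carrying a witness. *)
Lemma est_level_infty : exists A : nat -> set Om,
  [/\ forall n, measurable (A n), forall n, A n `<=` [set w | witness (n + K) w] &
  al * Pr P [set w | past k.+1 K%:R w] <= be * Pr P (lim_sup_set A)].
Proof.
(* In the error, [al] pays for replacing [Hit] by the grid hits, [be] for discarding jumps outside
   [close], and [2] for the summed [nu]. The shift by [K] ensures that only levels at least [K]
   occur. *)
have h n : exists B : set Om, [/\ measurable B,
    B `<=` [set w | witness (n + K) w] &
    al * Pr P [set w | past k.+1 K%:R w] <= be * Pr P B +
      (al + be + 2) * (2 ^+ (n + K))^-1].
  have e0 : 0 < (2 ^+ (n + K) : R)^-1 by rewrite invr_gt0 exprn_gt0.
  have [p hp] := Pr_nondecreasing P e0 (close_measurable (n + K)) (@close_mono (n + K)).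
  rewrite -Hit_close in hp.
  pose J := jhits (n + K) p (K * 2 ^ p).
  have mJ : measurable J by exact: jhits_measurable.
  have mC := close_measurable (n + K) p.
  have mH := Hit_measurable (n + K).
  have mh := hits_measurable (n + K) p (K * 2 ^ p).
  exists (J `&` close (n + K) p); split; first exact: measurableI.
    move=> w [[i iK [hi [nhi Ji]]] [i' [i'K [hi' cl]]]].
    exists (i, p); split => //.
    - by rewrite dy_lt_nat.
    - by move: hi => [pw [m [/andP[mn _] bm]]]; split => //; exists m.
    (* The first grid hit is not later than the grid hit that is close to the infimum, hence it is
       close as well. *)
    - move=> u' u'K hu'; apply: le_lt_trans (cl _ u'K hu').
      apply: grid_mono; rewrite leqNgt; apply/negP => lt.
      by apply: nhi; exists i'.
  have mW : measurable [set w | past k.+1 K%:R w].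
    by apply: (@G_meas K%:R) => //; exact: (past_meas k.+1 (ler0n _ K)).
  have W_Hit : [set w | past k.+1 K%:R w] `<=` Hit (n + K).
    move=> w [s [sK hs]]; have [u [us hu]] := hs (n + K)%N.
    by exists u; split => //; exact: lt_trans us sK.
  have h1 : Pr P [set w | past k.+1 K%:R w] <= Pr P (hits (n + K) p (K * 2 ^ p)) +
      (2 ^+ (n + K))^-1.
    rewrite (le_trans (le_Pr P mW mH W_Hit))// (le_trans hp)// lerD2r.
    by apply: le_Pr => //; exact: close_hits.
  have h2 := @est_grid (n + K)%N p _ (leq_addl n K) (leqnn _).
  have h3 := nus_le (n + K) p mh.
  have h4 : Pr P J <= Pr P (J `&` close (n + K) p) + (2 ^+ (n + K))^-1.
    have -> : Pr P J = Pr P (J `&` close (n + K) p) + Pr P (J `\` close (n + K) p).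
      rewrite -PrU//; last 3 first.
      - exact: measurableI.
      - exact: measurableD.
      - by apply/seteqP; split => // w [[_ ?] []].
      by rewrite setUIDK.
    rewrite lerD2l (@le_trans _ _ (Pr P (Hit (n + K) `\` close (n + K) p)))//.
      apply: le_Pr; [exact: measurableD..|].
      apply: setSD => w Jw; apply: (@hits_Hit _ p).
      by case: Jw => i iK [hi _]; exists i.
    rewrite PrD//; first by move: hp; lra.
    by rewrite Hit_close; exact: bigcup_sup.
  have h5 := ler_wpM2l (ltW al_gt0) h1; have h6 := ler_wpM2l (ltW be_gt0) h4.
  rewrite -/J in h2; rewrite !mulrDl; move: h2 h3 h5 h6; rewrite !mulrDr; lra.
have [A hA] := choice h; exists A; split; [by move=> n; case: (hA n)..|].
rewrite -ler_pdivrMl//; apply: (@Pr_lim_sup_set _ _ _ P A _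
  (fun n => be^-1 * (al + be + 2) * (2 ^+ (n + K))^-1)).
- by move=> n; case: (hA n).
- rewrite -[X in _ --> X](mulr0 (be^-1 * (al + be + 2))).
  apply: cvgMr; apply/cvgrPdist_lt => /= r r0.
  have [N hN] := half_pow_small r0; exists N => // n /= Nn.
  rewrite sub0r normrN ger0_norm ?invr_ge0 ?exprn_ge0// hN//.
  by rewrite (leq_trans Nn)// leq_addr.
- move=> n; have [_ _] := hA n; rewrite ler_pdivrMl// mulrDr => /le_trans; apply.
  by rewrite -!mulrA mulVKf ?gt_eqF.
Qed.

End Level.

(* The limit [v] of the times witnessing level [k] is a genuine jump of [Y],
   located strictly after restart [k] and not after restart [k.+1]. *)
Definition restart_jump k w (v : R) := [/\ v <= K%:R, 0 < v,
  (forall de : R, 0 < de -> exists a b : R,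
     [/\ v - de < a < v, v <= b < v + de & e' < `|Y b w - Y a w|]),
  (exists2 u, dy R u < v & past k (dy R u) w) &
  (forall t, past k.+1 t w -> v <= t)].

(** The witness times converge. Right-continuity forbids their limit to be reached from the right,
    and the left limit forbids a witnessing cell to end before it; so the cells straddle the
    limit. *)
Lemma witness_jump k w : (forall n, exists2 m, (n <= m)%N & witness k m w) ->
  exists v, restart_jump k w v.
Proof.
move=> hw; pose h n : R := (2 ^+ n)^-1.
have h0 n : 0 < h n by rewrite invr_gt0 exprn_gt0.
(* [dy R u - h n] lies below every hit of level at least [n], hence below all later witness times;
   the supremum of these lower bounds is therefore the limit of the witness times. *)
pose L := [set x : R | exists n u, x = dy R u - h n /\ wit k n u w].
have L0 : L !=set0.
  by have [m _ [u hu]] := hw 0%N; exists (dy R u - h m), m, u.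
have ubL : ubound L K%:R.
  by move=> _ [n [u [-> [uK _ _ _]]]]; move: (h0 n); lra.
have hL : has_sup L by split => //; exists K%:R.
pose v := sup L.
have vK : v <= K%:R by exact: ge_sup.
have near_v (r : R) : 0 < r -> exists n u, [/\ h n < r, v - r < dy R u < v + r &
    wit k n u w].
  move=> r0; have [_ [N [uN [-> [uNK hN _ cN]]]] lN] := sup_adherent r0 hL.
  have [N1 hN1] := half_pow_small r0.
  have [n nN [u hu]] := hw (maxn N N1); have [uK [pu [m [nm bm]]] Ju cu] := hu.
  have hn : h n < r by apply: hN1; rewrite (leq_trans _ nN)// leq_maxr.
  exists n, u; split => //.
  have uv : dy R u - h n <= v by apply: sup_ubound; [exact: hL.2|exists n, u].
  have : dy R uN < dy R u + h N.
    apply: cN => //; split => //; exists m; split => //.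
    by rewrite (leq_trans _ nm)// (leq_trans _ nN)// leq_maxl.
  by move: lN; rewrite -/v; lra.
have v0 : 0 <= v.
  rewrite leNgt; apply/negP => v0.
  have [n [u [_ /andP[_ uv] _]]] : exists n u, [/\ h n < - v,
    v - (- v) < dy R u < v + (- v) & wit k n u w] by apply: near_v; lra.
  by have := dy_ge0 R u; lra.
have e2 : 0 < e' / 2 by rewrite divr_gt0.
have [d1 d10 hd1] := Yrc w v0 e2.
(* Just after [v] the path stays within [e' / 2] of its value at [v], leaving no room for a move
   larger than [e']. Taking [r <= d1 / 2] keeps both ends of the cell before [v + d1]. *)
have left_v (r : R) : 0 < r -> r <= d1 / 2 -> exists n u, [/\ h n < r,
    v - r < dy R u < v & wit k n u w].
  move=> r0 rd; have [n [u [hn /andP[u1 u2] hu]]] := near_v _ r0.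
  exists n, u; split => //; rewrite u1/= ltNge; apply/negP => vu.
  have [_ _ [m nm Jm] _] := hu.
  have /andP[q1 q2] := q_itv m (dy_ge0 R u).
  have hm : h m <= h n.
    by rewrite lef_pV2 ?posrE ?exprn_gt0// ler_weXn2l// ler1n.
  have y1 : `|Y (dy R u) w - Y v w| < e' / 2 by apply: hd1; rewrite vu/=; lra.
  have y2 : `|Y (q m (dy R u)) w - Y v w| < e' / 2.
    by apply: hd1; rewrite (le_trans vu (ltW q1))/=; rewrite -/(h m) in q2; lra.
  have := ler_distD (Y v w) (Y (q m (dy R u)) w) (Y (dy R u) w).
  rewrite (distrC (Y v w)); move: Jm; rewrite /jumpy/=; lra.
have v_gt0 : 0 < v.
  have [||n [u [_ /andP[_ uv] _]]] := left_v (d1 / 2); [lra|lra|].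
  exact: le_lt_trans (dy_ge0 R u) uv.
have [l hl] := Yll w v_gt0; have [d2 d20 hd2] := hl _ e2.
exists v; split => //.
- move=> de de0.
  pose r := Num.min (de / 2) (Num.min (d1 / 2) (d2 / 2)).
  have r0 : 0 < r by rewrite !lt_min; apply/and3P; split; lra.
  have r1 : r <= de / 2 by rewrite ge_min lexx.
  have r2 : r <= d1 / 2 by rewrite !ge_min lexx orbT.
  have r3 : r <= d2 / 2 by rewrite !ge_min lexx !orbT.
  have [n [u [hn /andP[u1 u2] hu]]] := left_v _ r0 r2.
  have [_ _ [m nm Jm] _] := hu.
  have /andP[q1 q2] := q_itv m (dy_ge0 R u); rewrite -/(h m) in q2.
  have hm : h m <= h n.
    by rewrite lef_pV2 ?posrE ?exprn_gt0// ler_weXn2l// ler1n.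
  exists (dy R u), (q m (dy R u)); split.
  + by rewrite u2 andbT; lra.
  + apply/andP; split; last by lra.
    (* A cell ending before [v] would have both end values within [e' / 2] of the left limit. *)
    rewrite leNgt; apply/negP => qv.
    have y1 : `|Y (dy R u) w - l| < e' / 2 by apply: hd2; rewrite u2 andbT; lra.
    have y2 : `|Y (q m (dy R u)) w - l| < e' / 2.
      by apply: hd2; rewrite qv andbT; lra.
    have := ler_distD l (Y (q m (dy R u)) w) (Y (dy R u) w).
    rewrite (distrC l); move: Jm; rewrite /jumpy/=; lra.
  + exact: Jm.
- have [||n [u [_ /andP[_ uv] [_ [pu _] _ _]]]] := left_v (d1 / 2); [lra|lra|].
  by exists u.
- move=> t [s [st hs]]; rewrite leNgt; apply/negP => tv.
  have r0 : 0 < (v - t) / 2 by lra.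
  have [n [u [hn /andP[u1 _] [_ _ _ cu]]]] := near_v _ r0.
  have [u' [u's hu']] := hs n.
  have : dy R u < dy R u' + h n by apply: cu => //; lra.
  lra.
Qed.

(** Successive restarts give strictly later jump times, all bounded by [K]; jumps larger than [e']
    would accumulate at the supremum from the left, where a left limit exists. *)
Lemma restart_jump_finite w :
  ~ (forall n, exists2 k, (n <= k)%N & exists v, restart_jump k w v).
Proof.
move=> hk; pose L := [set v : R | exists k, restart_jump k w v].
have L0 : L !=set0 by have [k _ [v hv]] := hk 0%N; exists v, k.
have hL : has_sup L by split => //; exists K%:R => v [k []].
have gtL v : L v -> exists2 v', L v' & v < v'.
  move=> [k [vK v0 _ _ hv]]; have [l kl [v' hv']] := hk k.+1.
  exists v'; first by exists l.
  have [_ _ _ [u uv' pu] _] := hv'.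
  by apply: le_lt_trans uv'; apply: hv; exact: past_le pu.
have ltL v : L v -> v < sup L.
  move=> /gtL[v' Lv' vv']; apply: (lt_le_trans vv').
  by apply: sup_ubound => //; exact: hL.2.
have sup0 : 0 < sup L.
  have [v Lv] := L0; have := ltL _ Lv; have [k [_ v0 _ _ _]] := Lv.
  exact: lt_trans.
have [l hl] := Yll w sup0.
have [|d1 d10 hd1] := hl (e' / 2); first by rewrite divr_gt0.
have [v Lv lv] := sup_adherent d10 hL.
have vs := ltL _ Lv; have [k [_ _ hv _ _]] := Lv.
pose r := Num.min (v - (sup L - d1)) (sup L - v).
have r0 : 0 < r by rewrite lt_min; apply/andP; split; lra.
have r1 : r <= v - (sup L - d1) by rewrite ge_min lexx.
have r2 : r <= sup L - v by rewrite ge_min lexx orbT.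
have [a [b [/andP[a1 a2] /andP[b1 b2]]]] := hv _ r0.
have y1 : `|Y a w - l| < e' / 2 by apply: hd1; apply/andP; split; lra.
have y2 : `|Y b w - l| < e' / 2 by apply: hd1; apply/andP; split; lra.
have := ler_distD l (Y b w) (Y a w); rewrite (distrC l); lra.
Qed.

(** Each restart carries a jump with probability at least [al / be] times that of the event. If this
    were positive, infinitely many restarts would carry a jump with positive probability, whereas
    this never happens. *)
Lemma past_null : P [set w | forall k, past k K%:R w] = 0%E.
Proof.
have mp k : measurable [set w | past k K%:R w].
  by apply: (@G_meas K%:R) => //; exact: (past_meas k (ler0n _ K)).
have mW : measurable [set w | forall k, past k K%:R w].
  exact: (sa_all measurable_sa).
apply: Pr_eq0 => //; apply/eqP; rewrite eq_le Pr_ge0 andbT.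
have [A hA] := choice est_level_infty.
pose B k := lim_sup_set (A k).
have mB k : measurable (B k).
  have [mA _ _] := hA k; apply: bigcapT_measurable => n.
  by apply: bigcup_measurable => j _; exact: mA.
have hB k : (al / be) * Pr P [set w | forall k, past k K%:R w] <= Pr P (B k).
  have [_ _ h] := hA k; rewrite mulrAC ler_pdivrMr// mulrC [leRHS]mulrC.
  apply: le_trans h; rewrite mulrC ler_pM2l//; apply: le_Pr => //.
  by move=> w; exact.
have : (al / be) * Pr P [set w | forall k, past k K%:R w] <= Pr P (lim_sup_set B).
  apply: (@Pr_lim_sup_set _ _ _ P B _ (fun=> 0)) => //; first exact: cvg_cst.
  by move=> n; rewrite addr0.
have -> : lim_sup_set B = set0.
  apply/seteqP; split => // w Bw; apply: (@restart_jump_finite w) => n.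
  have [k /= nk Bk] := Bw n I; exists k => //; apply: witness_jump => m.
  have [j /= mj Aj] := Bk m I; exists (j + K)%N; first by rewrite (leq_trans mj)// leq_addr.
  by have [_ sA _] := hA k; exact: sA Aj.
rewrite /Pr measure0/= => h; rewrite -(ler_pM2l (divr_gt0 al_gt0 be_gt0)) mulr0.
exact: h.
Qed.

Lemma bad_evanescent w t : ~ (forall k, past k K%:R w) -> 0 <= t -> t < K%:R ->
  ~ (forall n, exists2 m, (n <= m)%N & bad m t w).
Proof. by move=> np t0 tK hb; apply: np => k; exact: bad_past tK. Qed.

End ApproximateProjection.

(** * Uniform approximation and conditional probabilities *)

Lemma simple_approx (T : pointedType) (R : realType) (H : set (set T))
    (V : (T -> R) -> Prop) (g : T -> R) (e : R) :
  sigma_algebra setT H -> (forall c, V (fun=> c)) ->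
  (forall f A c, V f -> H A -> V (fun x => f x + c * \1_A x)) ->
  mf H g -> (exists C : R, forall x, `|g x| <= C) -> 0 < e ->
  exists2 s, V s & forall x, `|g x - s x| <= e.
Proof.
move=> hH V0 VD mg [C gC] e0.
(* Induction on the range: subtracting [e] where [f >= e] shortens the range by one step and costs
   one indicator. The offset [c] lets the induction start from a constant and later undoes the shift
   making [g] nonnegative. *)
have pos N c (f : T -> R) : mf H f -> (forall x, 0 <= f x <= N.+1%:R * e) ->
    exists2 s, V s & forall x, `|f x - (s x - c)| <= e.
  elim: N f => [|N IH] f mf_ fN.
    exists (fun=> c) => // x; rewrite subrr subr0.
    by have /andP[f0 f1] := fN x; rewrite ger0_norm// (le_trans f1)// mul1r.
  pose A := [set x | e <= f x].
  have HA : H A by exact: mf_le.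
  have [||s Vs hs] := IH (fun x => f x - e * \1_A x).
  - by apply: mfB => //; apply: mfM => //; [exact: mf_cst|exact: mf_indic].
  - move=> x; have /andP[f0 f1] := fN x; rewrite indicE; case: (boolP (x \in A)).
      rewrite inE /A/= => ef; rewrite mulr1; apply/andP; split; first by lra.
      by rewrite lerBlDr; move: f1; rewrite -natr1 mulrDl mul1r.
    rewrite notin_setE /A/= => /negP; rewrite -ltNge => fe; rewrite mulr0 subr0 f0/=.
    by rewrite (le_trans (ltW fe))// ler_peMl ?(ltW e0)// ler1n.
  exists (fun x => s x + e * \1_A x); first exact: VD.
  by move=> x; have := hs x; rewrite (_ : f x - _ - _ = f x - (s x + e * \1_A x - c))//; lra.
have C0 : 0 <= C by exact: le_trans (gC point).
have [||s Vs hs] := pos (Num.trunc (2 * C / e)) (- C) (fun x => g x + C).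
- by apply: mfD => //; exact: mf_cst.
- move=> x; have := gC x; rewrite ler_norml => /andP[g1 g2]; apply/andP; split; first by lra.
  apply: (@le_trans _ _ (2 * C)); first by lra.
  by rewrite -ler_pdivrMr// ltW// truncnS_gt.
exists s => // x; have := hs x.
by rewrite opprK opprD addrACA subrr addr0.
Qed.

Section SubMeasure.
Context {d : measure_display} {T : measurableType d} {R : realType}.
Variables (m : {finite_measure set T -> \bar R}) (H : set (set T)).

(** The set function is unchanged; only the type changes, so that a Radon-Nikodym density taken
    there is measurable for the small sigma-algebra. *)
Definition msub of (<<s H >> `<=` @measurable _ T) :
  set (g_sigma_algebraType H) -> \bar R := m.

Hypothesis hH : <<s H >> `<=` @measurable _ T.

Let msub0 : msub hH set0 = 0%E. Proof. exact: measure0. Qed.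

Let msub_ge0 A : (0 <= msub hH A)%E. Proof. exact: measure_ge0. Qed.

Let msub_sigma_additive : semi_sigma_additive (msub hH).
Proof.
move=> F mF tF mUF; apply: measure_semi_sigma_additive => //.
- by move=> n; apply: hH; exact: mF.
- by apply: hH.
Qed.

HB.instance Definition _ := isMeasure.Build _ _ _
  (msub hH) msub0 msub_ge0 msub_sigma_additive.

Let msub_fin : fin_num_fun (msub hH).
Proof. by move=> A mA; apply: fin_num_measure; exact: hH. Qed.

HB.instance Definition _ := Measure_isFinite.Build _ _ _ (msub hH) msub_fin.

(** The restricted measure is the image of [m] under the identity map into the coarser measurable
    space. *)
Lemma integral_msub (f : T -> \bar R) (A : set T) : <<s H >> A ->
  measurable_fun (setT : set (g_sigma_algebraType H)) f ->
  (forall x, 0 <= f x)%E ->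
  (\int[msub hH]_(x in A) f x = \int[m]_(x in A) f x)%E.
Proof.
move=> HA mf_ f0.
have mid : measurable_fun (setT : set T) (idfun : T -> g_sigma_algebraType H).
  by move=> _ B mB; rewrite setTI; exact: hH.
have := @ge0_integral_pushforward _ _ _ _ _ _ mid m A f HA.
apply => //; exact: measurable_funTS.
Qed.

End SubMeasure.

Section ConditionalProbability.
Context {d : measure_display} {Om : measurableType d} {R : realType}.
Variables (Q : probability Om R) (H : set (set Om)) (B : set Om).
Hypothesis H_sa : sigma_algebra setT H.
Hypothesis H_meas : H `<=` measurable.
Hypothesis mB : measurable B.

(** A version with values in [[0, 1]] everywhere, so that no exceptional set has to be carried
    along. *)
Definition cond_prob (f : Om -> R) := [/\ mf H f, forall x, 0 <= f x <= 1 &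
  forall A, H A -> Ex Q (fun x => f x * \1_A x) = Pr Q (A `&` B)].

Lemma mf_measurable (f : Om -> R) : mf H f -> measurable_fun setT f.
Proof. by move=> mf_ _ C mC; rewrite setTI; apply/H_meas/mf_. Qed.

Lemma mf_bm (f : Om -> R) (C : R) : mf H f -> (forall x, `|f x| <= C) -> bm f.
Proof. by move=> mf_ fC; split; [exact: mf_measurable|exists C]. Qed.

Lemma mf_bm01 (f : Om -> R) : mf H f -> (forall x, 0 <= f x <= 1) -> bm f.
Proof.
by move=> mf_ f01; apply: (mf_bm (C := 1)) => // x; have /andP[? ?] := f01 x; rewrite ger0_norm.
Qed.

(** The density of [Q(.]&[B)] with respect to [Q] on the small sigma-algebra is at most 1 almost
    surely; truncating it at 1 changes it on a null set only. *)
Lemma cond_prob_exists : exists f, cond_prob f.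
Proof.
have hH : <<s H >> `<=` @measurable _ Om by rewrite sigma_algebra_id.
pose mu : {finite_measure set (g_sigma_algebraType H) -> \bar R} := msub Q hH.
have QBoo : (Q B < +oo)%E by apply: le_lt_trans (probability_le1 Q mB) _; rewrite ltry.
pose nu : {finite_measure set (g_sigma_algebraType H) -> \bar R} :=
  msub (mfrestr mB QBoo) hH.
have numu : nu `<< mu.
  apply/null_content_dominatesP => A mA mu0; apply/eqP; rewrite eq_le measure_ge0 andbT.
  have <- : mu A = 0%E by [].
  rewrite /nu/= /msub/= /mfrestr/= /mrestr le_measure// inE.
    by apply: measurableI => //; exact: (hH _ mA).
  exact: (hH _ mA).
have [f' [f'0 f'fin f'int f'E]] := radon_nikodym_sigma_finite numu.
pose f1 (x : Om) : R := fine (f' x).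
have f1E x : f' x = (f1 x)%:E by rewrite /f1 fineK.
have mf' : measurable_fun (setT : set (g_sigma_algebraType H)) f'.
  exact: measurable_int f'int.
have mf1 : mf H f1.
  apply/mfP => //; apply/measurable_EFinP.
  by rewrite (_ : EFin \o f1 = f')//; apply/funext => x /=; rewrite f1E.
have f10 x : 0 <= f1 x by rewrite fine_ge0.
have f1I A : H A -> (\int[Q]_(x in A) (f1 x)%:E = Q (A `&` B))%E.
  move=> HA; have mA : <<s H >> A by exact: sub_sigma_algebra.
  transitivity (nu A); last by rewrite /nu/= /msub/= /mfrestr/= /mrestr.
  rewrite f'E// integral_msub//; apply: eq_integral => x _; rewrite f1E//.
have mf1' : measurable_fun (setT : set Om) f1 by exact: mf_measurable.
(* Integrating over [D k] gives [(1 + 1/(k+1)) Q(D k) <= Q(D k)], so each [D k] is null; their union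
   is where the density exceeds 1. *)
pose D k := [set x | 1 + k.+1%:R^-1 <= f1 x].
have HD k : H (D k) by exact: mf_le.
have D0 k : Q (D k) = 0%E.
  apply: Pr_eq0; first exact: H_meas.
  have k0 : 0 < k.+1%:R^-1 :> R by rewrite invr_gt0.
  have : ((1 + k.+1%:R^-1)%:E * Q (D k) <= Q (D k))%E.
    apply: (@le_trans _ _ (Q (D k `&` B))); last first.
      by apply: le_measure; rewrite ?inE; [apply: measurableI => //| |]; try exact: H_meas.
    rewrite -f1I// -integral_cst; last exact: H_meas.
    apply: ge0_le_integral => //.
    - exact: H_meas.
    - by move=> x _; rewrite lee_fin addr_ge0// ltW.
    - by apply/measurable_EFinP; exact: measurable_funTS.
  rewrite PrE; last exact: H_meas.
  rewrite -EFinM lee_fin mulrDl mul1r gerDl => h; apply/eqP.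
  by rewrite eq_le Pr_ge0 andbT -(pmulr_rle0 _ k0).
pose N := \bigcup_k D k.
have HN : H N by exact: sa_bigcup.
have N0 : Q N = 0%E.
  by apply: null_bigcup => // k; exact: H_meas.
have Nf x : ~ N x -> f1 x <= 1.
  move=> Nx; rewrite leNgt; apply/negP => f1x; apply: Nx.
  have x0 : 0 < f1 x - 1 by lra.
  have [k] := ltr_add_invr f1x; rewrite /D => kx; exists k => //=; exact: ltW.
exists (fun x => Num.min (f1 x) 1); split.
- apply: (@mf_comp _ _ _ (fun y => Num.min y 1) f1) => //.
  by apply: measurable_minr => //; exact: measurable_cst.
- by move=> x; rewrite le_min f10 ler01 ge_min lexx orbT.
- move=> A HA; apply: EFin_inj; rewrite -PrE; last first.
    by apply: measurableI => //; exact: H_meas.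
  have bmf : bm (fun x => Num.min (f1 x) 1 * \1_A x : R).
    apply: bmM; last by apply: bm_indic; exact: H_meas.
    split; first by apply: measurable_minr => //; exact: measurable_cst.
    by exists 1 => x; rewrite ger0_norm ?ge_min ?lexx ?orbT// le_min f10 ler01.
  rewrite -ExE// -f1I// [RHS]integral_mkcond; apply: ae_eq_integral => //.
  + by apply/measurable_EFinP; exact: bmf.1.
  + apply/(measurable_restrictT _ _).1; first exact: H_meas.
    by apply/measurable_EFinP; exact: measurable_funTS.
  + exists N; split => //; first exact: H_meas.
    move=> x /=; apply: contra_notP => Nx _.
    rewrite /patch min_l; last exact: Nf.
    by rewrite indicE; case: (x \in A); rewrite ?mulr1 ?mulr0.
Qed.

(** The identity passes from indicators to constants and linear combinations, and then to bounded
    functions by uniform approximation, as both factors [f] and [\1_B] are bounded by 1. *)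
Lemma cond_probP f (g : Om -> R) (C : R) : cond_prob f -> mf H g ->
  (forall x, `|g x| <= C) ->
  Ex Q (fun x => f x * g x) = Ex Q (fun x => \1_B x * g x).
Proof.
move=> [mf_ f01 fA] mg gC.
have bf : bm f by exact: mf_bm01.
have bB : bm (\1_B : Om -> R) by exact: bm_indic.
have bg : bm g by exact: mf_bm gC.
pose V (s : Om -> R) := bm s /\
  Ex Q (fun x => f x * s x) = Ex Q (fun x => \1_B x * s x).
have V0 c : V (fun=> c).
  split; first exact: bm_cst.
  have cE (h : Om -> R) : bm h -> Ex Q (fun x => h x * c) = c * Ex Q h.
    by move=> bh; rewrite -ExZ//; apply: Ex_ext => x; rewrite mulrC.
  rewrite !cE//; congr (_ * _); rewrite Ex_indic//.
  have := fA _ (saT H_sa); rewrite setTI => <-; apply: Ex_ext => x.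
  by rewrite indicT mulr1.
have VD s A c : V s -> H A -> V (fun x => s x + c * \1_A x).
  move=> [bs sE] HA; have bA : bm (\1_A : Om -> R) by apply: bm_indic; exact: H_meas.
  have bcA : bm (fun x => c * \1_A x : R) by apply: bmM => //; exact: bm_cst.
  split; first exact: bmD.
  have cE (h : Om -> R) : bm h -> Ex Q (fun x => h x * (s x + c * \1_A x)) =
     Ex Q (fun x => h x * s x) + c * Ex Q (fun x => h x * \1_A x).
    move=> bh; rewrite -ExZ; last exact: bmM.
    rewrite -ExD; [|exact: bmM|apply: bmM; [exact: bm_cst|exact: bmM]].
    by apply: Ex_ext => x; rewrite mulrDr mulrCA.
  rewrite !cE// sE; congr (_ + c * _); rewrite fA//.
  rewrite -Ex_indic; last by apply: measurableI => //; exact: H_meas.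
  by apply: Ex_ext => x; rewrite indicI/= mulrC.
apply/eqP; rewrite -subr_eq0 -normr_le0; apply/ler_addgt0Pr => e e0; rewrite add0r.
have e2 : 0 < e / 2 by rewrite divr_gt0.
have [s [bs sE] hs] := simple_approx H_sa V0 VD mg (ex_intro _ C gC) e2.
have key (h : Om -> R) : bm h -> (forall x, `|h x| <= 1) ->
    `|Ex Q (fun x => h x * g x) - Ex Q (fun x => h x * s x)| <= e / 2.
  move=> bh h1; rewrite -ExB; [|exact: bmM..].
  have b1 : bm (fun x => h x * g x - h x * s x) by apply: bmB; exact: bmM.
  rewrite (le_trans (le_norm_Ex Q b1))// -(Ex_cst Q (e / 2)).
  apply: le_Ex; [exact: bm_norm|exact: bm_cst|move=> x].
  by rewrite -mulrBr normrM -[leRHS]mul1r ler_pM.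
have k1 : `|Ex Q (fun x => f x * g x) - Ex Q (fun x => f x * s x)| <= e / 2.
  by apply: key => // x; have /andP[? ?] := f01 x; rewrite ger0_norm.
have k2 : `|Ex Q (fun x => \1_B x * g x) - Ex Q (fun x => \1_B x * s x)| <= e / 2.
  by apply: key => // x; rewrite indicE; case: (x \in B); rewrite ?normr1 ?normr0.
rewrite -sE in k2.
rewrite (_ : _ - _ = (Ex Q (fun x => f x * g x) - Ex Q (fun x => f x * s x)) -
  (Ex Q (fun x => \1_B x * g x) - Ex Q (fun x => f x * s x))); last by ring.
by rewrite (le_trans (ler_normB _ _))//; lra.
Qed.

End ConditionalProbability.

Section NextDyadic.
Variable R : realType.

(** The successor makes the grid time strictly later than [t] even when [t] lies on the grid; limits
    along these times are genuine limits from the right. *)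
Definition qidx (n : nat) (t : R) : nat * nat := ((Num.trunc (t * 2 ^+ n)).+1, n).

Definition qn n t : R := dy R (qidx n t).

Lemma qn_itv n t : 0 <= t -> t < qn n t <= t + (2 ^+ n)^-1.
Proof.
move=> t0; have p0 : 0 < 2 ^+ n :> R by rewrite exprn_gt0.
have tp : 0 <= t * 2 ^+ n by rewrite mulr_ge0// ltW.
have /andP[t1 t2] := truncn_itv tp.
rewrite /qn /dy/=; apply/andP; split; first by rewrite ltr_pdivlMr.
by rewrite ler_pdivrMr// mulrDl mulVf ?gt_eqF// -natr1 lerD2r.
Qed.

Lemma qn_ge0 n t : 0 <= qn n t. Proof. exact: dy_ge0. Qed.

Lemma qn_near t de : 0 <= t -> 0 < de -> exists N, forall n, (N <= n)%N ->
  t < qn n t < t + de.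
Proof.
move=> t0 /half_pow_small[N hN]; exists N => n /hN h.
have /andP[-> h2] := qn_itv n t0; apply: (le_lt_trans h2).
by rewrite ltrD2l.
Qed.

End NextDyadic.

Lemma bm_sum {d} {T : measurableType d} {R : realType} (f : nat -> T -> R) n :
  (forall i, bm (f i)) -> bm (fun x => \sum_(0 <= i < n) f i x).
Proof.
move=> bf; elim: n => [|n IH].
  rewrite (_ : (fun x => _) = (fun=> 0)); first exact: bm_cst.
  by apply/funext => x; rewrite big_geq.
rewrite (_ : (fun x => _) = (fun x => \sum_(0 <= i < n) f i x + f n x)).
  exact: bmD.
by apply/funext => x; rewrite big_nat_recr.
Qed.

Lemma Ex_sum {d} {T : measurableType d} {R : realType} (P : probability T R)
    (f : nat -> T -> R) n :
  (forall i, bm (f i)) -> Ex P (fun x => \sum_(0 <= i < n) f i x) =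
    \sum_(0 <= i < n) Ex P (f i).
Proof.
move=> bf; elim: n => [|n IH].
  by rewrite [RHS]big_geq// -[RHS](Ex_cst P); apply: Ex_ext => x; rewrite big_geq.
rewrite big_nat_recr//= -IH -ExD//; last exact: bm_sum.
by apply: Ex_ext => x; rewrite big_nat_recr.
Qed.

(** * Cadlag versions of bounded martingales *)

Lemma indic_setb (R : realType) (T : Type) (b : T -> bool) w :
  (\1_[set x | b x] w : R) = (b w)%:R.
Proof.
rewrite indicE; congr (_%:R); congr nat_of_bool.
by apply/idP/idP => [/set_mem//|bw]; exact: mem_set.
Qed.

Section Oscillation.
Context {R : realType} {Om : Type}.
Variables (X : R -> Om -> R) (e : R) (K : nat).

(** The anchor follows the path only when the path has moved away from it by more than [e]. Counting
    its changes plays the role of counting upcrossings. *)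
Fixpoint anchor n i (w : Om) : R :=
  if i is j.+1 then
    if e < `|X (dy R (i, n)) w - anchor n j w| then X (dy R (i, n)) w
    else anchor n j w
  else X (dy R (0%N, n)) w.

Definition chg n i w : bool := e < `|X (dy R (i.+1, n)) w - anchor n i w|.

Definition cnt n i j w : nat := \sum_(i <= k < j) (chg n k w : nat).

Hypothesis e_ge0 : 0 <= e.

Lemma anchor_close n i w : `|X (dy R (i, n)) w - anchor n i w| <= e.
Proof.
case: i => [|i] /=; first by rewrite subrr normr0.
by case: ltP => //; rewrite subrr normr0.
Qed.

Lemma anchor_nochg n i j w : (i <= j)%N ->
  (forall k, (i <= k < j)%N -> chg n k w = false) -> anchor n j w = anchor n i w.
Proof.
elim: j => [|j IH]; first by rewrite leqn0 => /eqP ->.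
rewrite leq_eqVlt => /predU1P[->//|ij] h /=.
have := h j; rewrite /chg => -> //; last by lia.
by apply: IH => [|k kj]; [lia|apply: h; lia].
Qed.

(** As long as the anchor does not change, every grid value is within [e] of it, hence any two are
    within [2e] of each other. *)
Lemma cnt_pair n i j w : (i < j)%N ->
  e * 2 < `|X (dy R (i, n)) w - X (dy R (j, n)) w| -> (1 <= cnt n i j w)%N.
Proof.
move=> ij h; rewrite lt0n; apply/eqP => c0.
have nochg k : (i <= k < j)%N -> chg n k w = false.
  move=> kij; apply/negbTE/negP => ck; move: c0; rewrite /cnt.
  rewrite (big_cat_nat (n := k)) ?(big_nat_recl _ k) /=; [|lia..].
  by rewrite (@big_ltn _ _ _ k)//; [rewrite ck; lia|lia].
have aE := anchor_nochg (ltnW ij) nochg.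
have h1 := anchor_close n i w; have h2 := anchor_close n j w; rewrite aE in h2.
have := ler_distD (anchor n i w) (X (dy R (i, n)) w) (X (dy R (j, n)) w).
by rewrite (distrC (anchor n i w)); lra.
Qed.

Lemma cnt_cat n i j k w : (i <= j)%N -> (j <= k)%N ->
  (cnt n i k w = cnt n i j w + cnt n j k w)%N.
Proof. by move=> ij jk; rewrite /cnt (big_cat_nat (n := j)). Qed.

Lemma cnt_sub n i i' j' j w : (i <= i')%N -> (i' <= j')%N -> (j' <= j)%N ->
  (cnt n i' j' w <= cnt n i j w)%N.
Proof.
move=> h1 h2 h3; rewrite (@cnt_cat n i i')//; last exact: leq_trans h3.
by rewrite (@cnt_cat n i' j' j)//; lia.
Qed.

(** The count is not monotone in [n], so the bound is asked along infinitely many grids only: its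
    failure means that all sufficiently fine grids have large counts, which Markov's inequality on
    one grid controls. *)
Definition osc_bounded w := exists k, forall n0, exists2 n, (n0 <= n)%N &
  (cnt n 0 (K * 2 ^ n) w < k)%N.

Lemma dy_refine (u : nat * nat) n : (u.2 <= n)%N ->
  dy R u = dy R (u.1 * 2 ^ (n - u.2), n)%N.
Proof.
by case: u => i p /= pn; rewrite (dy_scale R i p (n - p)) subnKC.
Qed.

Lemma dy_lt_idx i j n : (dy R (i, n) < dy R (j, n)) = (i < j)%N.
Proof. by rewrite /dy/= ltr_pM2r ?invr_gt0 ?exprn_gt0// ltr_nat. Qed.

Lemma dy_le_idx i j n : (dy R (i, n) <= dy R (j, n)) = (i <= j)%N.
Proof. by rewrite /dy/= ler_pM2r ?invr_gt0 ?exprn_gt0// ler_nat. Qed.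

Lemma dy_nat n : dy R (K * 2 ^ n, n)%N = K%:R.
Proof. by rewrite /dy/= natrM natrX mulfK// expf_neq0. Qed.

Lemma far_pair w (a b : R) :
  ~ (exists u v, [/\ a < dy R u, dy R u < dy R v, dy R v < b &
      e * 2 < `|X (dy R u) w - X (dy R v) w|]) ->
  forall u v, a < dy R u < b -> a < dy R v < b -> `|X (dy R u) w - X (dy R v) w| <= e * 2.
Proof.
move=> h u v /andP[u1 u2] /andP[v1 v2]; rewrite leNgt; apply/negP => lt.
have [uv|uv|uv] := ltgtP (dy R u) (dy R v).
- by apply: h; exists u, v.
- by apply: h; exists v, u; rewrite distrC.
- by move: lt; rewrite uv subrr normr0 ltNge mulr_ge0.
Qed.

(** Otherwise arbitrarily many disjoint pairs with gap above [2e] can be chosen ever closer to [t];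
    on every grid refining them each pair forces an anchor change, contradicting the bound on the
    count. *)
Lemma osc_right w (t : R) : osc_bounded w -> 0 <= t < K%:R ->
  exists2 de : R, 0 < de & forall u v, t < dy R u < t + de -> t < dy R v < t + de ->
    `|X (dy R u) w - X (dy R v) w| <= e * 2.
Proof.
move=> [k hk] /andP[t0 tK]; apply: contrapT => hn.
have hfail (de : R) : 0 < de -> exists u v, [/\ t < dy R u, dy R u < dy R v,
    dy R v < t + de & e * 2 < `|X (dy R u) w - X (dy R v) w|].
  by move=> de0; apply: contrapT => h; apply: hn; exists de => //; exact: far_pair.
have claim l : exists u, t < dy R u < K%:R /\ forall n, (u.2 <= n)%N ->
    (l <= cnt n (u.1 * 2 ^ (n - u.2)) (K * 2 ^ n) w)%N.
  elim: l => [|l [u0 [/andP[tu0 u0K] hu0]]].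
    by have [u hu] := dy_dense t0 tK; exists u.
  have [|u [v [tu uv vu0 h]]] := hfail (dy R u0 - t); first by lra.
  have {}vu0 : dy R v < dy R u0 by lra.
  pose p := maxn u.2 (maxn v.2 u0.2).
  have pu : (u.2 <= p)%N by rewrite leq_maxl.
  have pv : (v.2 <= p)%N by rewrite leq_max leq_max leqnn orbT.
  have pu0 : (u0.2 <= p)%N by rewrite leq_max leq_max leqnn !orbT.
  exists (u.1 * 2 ^ (p - u.2), p)%N; rewrite -dy_refine//; split.
    by rewrite tu/=; lra.
  move=> n /= pn.
  have -> : (u.1 * 2 ^ (p - u.2) * 2 ^ (n - p) = u.1 * 2 ^ (n - u.2))%N.
    by rewrite -mulnA -expnD addnC addnBA// subnK.
  have un := leq_trans pu pn; have vn := leq_trans pv pn.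
  have u0n := leq_trans pu0 pn.
  move: uv vu0 u0K h; rewrite (dy_refine un) (dy_refine vn) (dy_refine u0n).
  rewrite -(dy_nat n) !dy_lt_idx => uv vu0 u0K h.
  rewrite (cnt_cat _ _ (ltnW uv) (ltnW (ltn_trans vu0 u0K))) -add1n leq_add//.
    exact: cnt_pair.
  exact: leq_trans (hu0 n u0n) (cnt_sub _ _ (ltnW vu0) (ltnW u0K) (leqnn _)).
have [u [/andP[_ uK] hu]] := claim k.
have [n un] := hk u.2; have := hu n un.
have : (cnt n (u.1 * 2 ^ (n - u.2)) (K * 2 ^ n) w <= cnt n 0 (K * 2 ^ n) w)%N.
  apply: cnt_sub => //; move: uK; rewrite (dy_refine un) -(dy_nat n) dy_lt_idx.
  exact: ltnW.
by move=> c1 c2 c3; have := leq_ltn_trans (leq_trans c2 c1) c3; rewrite ltnn.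
Qed.

Lemma osc_left w (t : R) : osc_bounded w -> 0 < t <= K%:R ->
  exists2 de : R, 0 < de & forall u v, t - de < dy R u < t -> t - de < dy R v < t ->
    `|X (dy R u) w - X (dy R v) w| <= e * 2.
Proof.
move=> [k hk] /andP[t0 tK]; apply: contrapT => hn.
have hfail (de : R) : 0 < de -> exists u v, [/\ t - de < dy R u, dy R u < dy R v,
    dy R v < t & e * 2 < `|X (dy R u) w - X (dy R v) w|].
  by move=> de0; apply: contrapT => h; apply: hn; exists de => //; exact: far_pair.
have claim l : exists u, dy R u < t /\ forall n, (u.2 <= n)%N ->
    (l <= cnt n 0 (u.1 * 2 ^ (n - u.2)) w)%N.
  elim: l => [|l [u0 [u0t hu0]]].
    by have [u /andP[_ hu]] := dy_dense (lexx 0) t0; exists u.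
  have [|u [v [tu uv vt h]]] := hfail (t - dy R u0); first by lra.
  have {}u0u : dy R u0 < dy R u by lra.
  pose p := maxn v.2 (maxn u.2 u0.2).
  have pv : (v.2 <= p)%N by rewrite leq_maxl.
  have pu : (u.2 <= p)%N by rewrite leq_max leq_max leqnn orbT.
  have pu0 : (u0.2 <= p)%N by rewrite leq_max leq_max leqnn !orbT.
  exists (v.1 * 2 ^ (p - v.2), p)%N; rewrite -dy_refine//; split => //.
  move=> n /= pn.
  have -> : (v.1 * 2 ^ (p - v.2) * 2 ^ (n - p) = v.1 * 2 ^ (n - v.2))%N.
    by rewrite -mulnA -expnD addnC addnBA// subnK.
  have un := leq_trans pu pn; have vn := leq_trans pv pn.
  have u0n := leq_trans pu0 pn.
  move: uv u0u h; rewrite (dy_refine un) (dy_refine vn) (dy_refine u0n).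
  rewrite !dy_lt_idx => uv u0u h.
  rewrite (cnt_cat _ _ (leq0n _) (ltnW uv)) -addn1 leq_add//; last exact: cnt_pair.
  exact: leq_trans (hu0 n u0n) (cnt_sub _ _ (leqnn _) (leq0n _) (ltnW u0u)).
have [u [ut hu]] := claim k.
have [n un] := hk u.2; have := hu n un.
have : (cnt n 0 (u.1 * 2 ^ (n - u.2)) w <= cnt n 0 (K * 2 ^ n) w)%N.
  apply: cnt_sub => //; rewrite -(dy_le_idx _ _ n) (dy_nat n) -dy_refine//.
  by rewrite (le_trans (ltW ut)).
by move=> c1 c2 c3; have := leq_ltn_trans (leq_trans c2 c1) c3; rewrite ltnn.
Qed.

End Oscillation.

Section Regularization.
Context {d : measure_display} {Om : measurableType d} {R : realType}.
Variables (Q : probability Om R) (F : R -> set (set Om)).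
Hypothesis F_sa : forall t : R, 0 <= t -> sigma_algebra setT (F t).
Hypothesis F_meas : forall t : R, 0 <= t -> F t `<=` measurable.
Hypothesis F_mono : forall s t : R, 0 <= s -> s <= t -> F s `<=` F t.
Hypothesis F_rc : forall t : R, 0 <= t ->
  F t = \bigcap_(s in [set s : R | t < s]) F s.
Hypothesis F_null : nullsa Q (sa_inf F) `<=` F 0.

Section Version.
Variables (B : set Om) (X : R -> Om -> R).
Hypothesis mB : measurable B.
Hypothesis X_cond : forall t : R, 0 <= t -> cond_prob Q (F t) B (X t).

Let x01 (t : R) w : 0 <= t -> 0 <= X t w <= 1.
Proof. by move=> /X_cond[_ + _]; exact. Qed.

Let Xmf (t : R) : 0 <= t -> mf (F t) (X t).
Proof. by move=> /X_cond[]. Qed.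

Let XmfS (s t : R) : 0 <= s -> s <= t -> mf (F t) (X s).
Proof. by move=> s0 st; apply: mf_sub (Xmf s0); exact: F_mono. Qed.

Let dyS n i : dy R (i, n) <= dy R (i.+1, n).
Proof. by rewrite dy_le_idx. Qed.

Section FixedOscillation.
Variable e : R.
Hypothesis e_gt0 : 0 < e.

Lemma anchor01 n i w : 0 <= anchor X e n i w <= 1.
Proof.
by elim: i => [|i IH] /=; [|case: ifP => // _]; exact/x01/dy_ge0.
Qed.

Lemma anchor_mf n i : mf (F (dy R (i, n))) (anchor X e n i) /\
  F (dy R (i.+1, n)) [set w | chg X e n i w].
Proof.
have chgF j : mf (F (dy R (j, n))) (anchor X e n j) ->
    F (dy R (j.+1, n)) [set w | chg X e n j w].
  move=> am; apply: (@mf_lt _ _ _ (fun w => `|X (dy R (j.+1, n)) w - anchor X e n j w|)).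
  apply: (@mf_comp _ _ _ (fun x => `|x|)) => //.
  apply: mfB; [exact/F_sa/dy_ge0|exact/Xmf/dy_ge0|].
  by apply: mf_sub am; apply: F_mono => //; exact: dy_ge0.
suff am j : mf (F (dy R (j, n))) (anchor X e n j) by split => //; exact: chgF.
elim: j => [|j IH]; first exact/Xmf/dy_ge0.
rewrite (_ : anchor X e n j.+1 = fun w => if w \in [set w | chg X e n j w]
    then X (dy R (j.+1, n)) w else anchor X e n j w); last first.
  by apply/funext => w /=; rewrite mem_setE.
apply: mf_if; [exact/F_sa/dy_ge0|exact: chgF|exact/Xmf/dy_ge0|].
by apply: mf_sub IH; apply: F_mono => //; exact: dy_ge0.
Qed.

Let a_bm n i : bm (anchor X e n i).
Proof. exact: (mf_bm01 (F_meas (dy_ge0 R (i, n))) (anchor_mf n i).1 (anchor01 n i)). Qed.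

Let X_bm (t : R) : 0 <= t -> bm (X t).
Proof. by move=> t0; apply: (mf_bm01 (F_meas t0) (Xmf t0)) => w; exact: x01. Qed.

Let c_bm n i : bm (\1_[set w | chg X e n i w] : Om -> R).
Proof. by apply/bm_indic/(F_meas (dy_ge0 R (i.+1, n))); exact: (anchor_mf n i).2. Qed.

(** This is [x^2 - (x - a)^2] with [a] the anchor. It is affine in [x], so a martingale step keeps
    its mean, while moving the anchor from [a] to [x] raises it by [(x - a)^2]. *)
Definition potential n i (x : R) w := 2 * (x * anchor X e n i w) - anchor X e n i w ^+ 2.

Let pot_bm n i (t : R) : 0 <= t -> bm (fun w => potential n i (X t w) w).
Proof.
move=> t0; apply: bmB; last by apply: bmM.
by apply: bmM; [exact: bm_cst|apply: bmM => //; exact: X_bm].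
Qed.

Lemma potential_mart n i :
  Ex Q (fun w => potential n i (X (dy R (i.+1, n)) w) w) =
  Ex Q (fun w => potential n i (X (dy R (i, n)) w) w).
Proof.
have pE (t : R) : 0 <= t -> Ex Q (fun w => potential n i (X t w) w) =
    2 * Ex Q (fun w => X t w * anchor X e n i w) - Ex Q (fun w => anchor X e n i w ^+ 2).
  move=> t0; rewrite -ExZ; last by apply: bmM => //; exact: X_bm.
  rewrite -ExB//; last by apply: bmM.
  by apply: bmM; [exact: bm_cst|apply: bmM => //; exact: X_bm].
have ab w : `|anchor X e n i w| <= 1.
  by have /andP[? ?] := anchor01 n i w; rewrite ger0_norm.
rewrite !pE ?dy_ge0//; congr (_ * _ - _).
have am := (anchor_mf n i).1.
rewrite (cond_probP (F_sa (dy_ge0 R (i, n))) (F_meas (dy_ge0 R (i, n))) mB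
  (X_cond (dy_ge0 R _)) am ab).
rewrite (cond_probP (F_sa (dy_ge0 R (i.+1, n))) (F_meas (dy_ge0 R (i.+1, n))) mB
  (X_cond (dy_ge0 R _)) _ ab)//.
by apply: mf_sub am; apply: F_mono => //; exact: dy_ge0.
Qed.

Lemma potential_step n i w :
  potential n i (X (dy R (i.+1, n)) w) w + e ^+ 2 * \1_[set w | chg X e n i w] w <=
  potential n i.+1 (X (dy R (i.+1, n)) w) w.
Proof.
rewrite indic_setb /potential /= -/(chg X e n i w); case: ifPn => [h|_]; last first.
  by rewrite mulr0 addr0.
rewrite mulr1; set x := X _ w; set a := anchor X e n i w.
have : e ^+ 2 <= `|x - a| ^+ 2 by rewrite lerXn2r ?nnegrE//; exact: ltW.
by rewrite real_normK ?num_real// !expr2; lra.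
Qed.

(** The mean of the potential starts nonnegative, stays at most 1, and each anchor change adds at
    least [e^2]. The bound does not depend on the grid. *)
Lemma chg_sum_le n j :
  e ^+ 2 * \sum_(0 <= i < j) Pr Q [set w | chg X e n i w] <= 1.
Proof.
have mc i : measurable [set w | chg X e n i w].
  by apply: (F_meas (dy_ge0 R (i.+1, n))); exact: (anchor_mf n i).2.
suff h : e ^+ 2 * \sum_(0 <= i < j) Pr Q [set w | chg X e n i w] <=
    Ex Q (fun w => potential n j (X (dy R (j, n)) w) w).
  apply: (le_trans h); rewrite -[leRHS](Ex_cst Q).
  apply: le_Ex; [exact/pot_bm/dy_ge0|exact: bm_cst|move=> w].
  rewrite /potential; have /andP[x0 x1] := x01 w (dy_ge0 R (j, n)).
  have : 0 <= (X (dy R (j, n)) w - anchor X e n j w) ^+ 2 by rewrite sqr_ge0.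
  have : X (dy R (j, n)) w ^+ 2 <= 1 by rewrite expr_le1.
  by rewrite !expr2; lra.
elim: j => [|j IH].
  rewrite big_geq// mulr0; apply: Ex_ge0; first exact/pot_bm/dy_ge0.
  move=> w; rewrite /potential/=.
  have : 0 <= X (dy R (0%N, n)) w ^+ 2 by rewrite sqr_ge0.
  by rewrite expr2; lra.
rewrite big_nat_recr//= mulrDr.
apply: (@le_trans _ _ (Ex Q (fun w => potential n j (X (dy R (j.+1, n)) w) w) +
   Ex Q (fun w => e ^+ 2 * \1_[set w | chg X e n j w] w))).
  apply: lerD; first by rewrite potential_mart.
  by rewrite ExZ// Ex_indic.
rewrite -ExD; [|exact/pot_bm/dy_ge0|by apply: bmM => //; exact: bm_cst].
apply: le_Ex; [|exact/pot_bm/dy_ge0|exact: potential_step].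
by apply: bmD; [exact/pot_bm/dy_ge0|by apply: bmM => //; exact: bm_cst].
Qed.

Variable K : nat.

Lemma cnt_F n k : F K%:R [set w | (k <= cnt X e n 0 (K * 2 ^ n) w)%N].
Proof.
have sa := F_sa (ler0n R K).
have : mf (F K%:R) (fun w => (cnt X e n 0 (K * 2 ^ n) w)%:R : R).
  rewrite /cnt; have : (K * 2 ^ n <= K * 2 ^ n)%N by [].
  elim: {1 3}(K * 2 ^ n)%N => [_|j IH jK].
    rewrite (_ : (fun w => _) = (fun=> 0)); first exact: mf_cst.
    by apply/funext => w; rewrite big_geq.
  rewrite (_ : (fun w => _) = (fun w => (\sum_(0 <= k < j) chg X e n k w)%:R +
    \1_[set w | chg X e n j w] w)).
    apply: mfD => //; first exact/IH/ltnW.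
    apply: mf_indic => //; apply: (F_mono _ _ (anchor_mf n j).2); first exact: dy_ge0.
    by rewrite -(dy_nat K n) dy_le_idx.
  by apply/funext => w; rewrite big_nat_recr//= natrD indic_setb.
move=> /(@mf_le _ _ _ _ k%:R); congr (F _ _); apply/seteqP; split => w /=;
  by rewrite ler_nat.
Qed.

Lemma cnt_markov n k : Pr Q [set w | (k.+1 <= cnt X e n 0 (K * 2 ^ n) w)%N] <=
  (e ^+ 2)^-1 * k.+1%:R^-1.
Proof.
have mA : measurable [set w | (k.+1 <= cnt X e n 0 (K * 2 ^ n) w)%N].
  by apply: (F_meas (ler0n R K)); exact: cnt_F.
have mc i : measurable [set w | chg X e n i w].
  by apply: (F_meas (dy_ge0 R (i.+1, n))); exact: (anchor_mf n i).2.
have bs : bm (fun w => \sum_(0 <= i < K * 2 ^ n) (\1_[set w | chg X e n i w] w : R)).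
  exact: bm_sum.
have h : k.+1%:R * Pr Q [set w | (k.+1 <= cnt X e n 0 (K * 2 ^ n) w)%N] <=
    \sum_(0 <= i < K * 2 ^ n) Pr Q [set w | chg X e n i w].
  rewrite -Ex_indic// -ExZ; last exact: bm_indic.
  under eq_bigr do rewrite -Ex_indic//.
  rewrite -Ex_sum//; apply: le_Ex => //.
    by apply: bmM; [exact: bm_cst|exact: bm_indic].
  move=> w; have -> : \sum_(0 <= i < K * 2 ^ n) (\1_[set w | chg X e n i w] w : R) =
      (cnt X e n 0 (K * 2 ^ n) w)%:R.
    by rewrite /cnt natr_sum; apply: eq_bigr => i _; rewrite indic_setb.
  rewrite indic_setb; case: (leqP k.+1 (cnt X e n 0 (K * 2 ^ n) w)) => [kc|_]; last by rewrite mulr0.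
  by rewrite mulr1 ler_nat.
have e2 : 0 < e ^+ 2 by rewrite exprn_gt0.
have h2 := chg_sum_le n (K * 2 ^ n).
rewrite ler_pdivlMr// mulrC; apply: (le_trans h).
by rewrite -[leRHS]mulr1 ler_pdivlMl.
Qed.

Definition osc_inf : set Om := [set w | ~ osc_bounded X e K w].

Lemma osc_infE : osc_inf = [set w | forall k, exists n0, forall n, (n0 <= n)%N ->
  (k <= cnt X e n 0 (K * 2 ^ n) w)%N].
Proof.
apply/seteqP; split => w.
  move=> h k; apply: contrapT => h'; apply: h; exists k => n0.
  apply: contrapT => h''; apply: h'; exists n0 => n nn; rewrite leqNgt; apply/negP => c.
  by apply: h''; exists n.
move=> h [k hk]; have [n0 hn] := h k; have [n /hn] := hk n0.
by rewrite leqNgt => /negP.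
Qed.

Lemma osc_inf_F : F K%:R osc_inf.
Proof.
have sa := F_sa (ler0n R K); rewrite osc_infE.
apply: sa_all => // k; apply: sa_ex => // n0; apply: sa_all => // n.
by apply: sa_imply => // _; exact: cnt_F.
Qed.

(** The events that all grids from [n0] on have more than [k] changes increase with [n0] and cover
    [osc_inf]; each is bounded by the Markov estimate on the single grid [n0], uniformly in [n0]. *)
Lemma osc_inf_null : Q osc_inf = 0%E.
Proof.
have mF := F_meas (ler0n R K); have sa := F_sa (ler0n R K).
apply: Pr_eq0; first exact/mF/osc_inf_F.
apply/eqP; rewrite eq_le Pr_ge0 andbT; apply/ler_addgt0Pr => r r0; rewrite add0r.
have e2 : 0 < e ^+ 2 by rewrite exprn_gt0.
pose k := Num.trunc ((e ^+ 2)^-1 / (r / 2)).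
have hk : (e ^+ 2)^-1 * k.+1%:R^-1 <= r / 2.
  rewrite ler_pdivrMr// mulrC -ler_pdivrMr ?divr_gt0//.
  by rewrite ltW// truncnS_gt.
pose A n0 := [set w | forall n, (n0 <= n)%N -> (k.+1 <= cnt X e n 0 (K * 2 ^ n) w)%N].
have mA n0 : measurable (A n0).
  by apply: mF; apply: sa_all => // n; apply: sa_imply => // _; exact: cnt_F.
have [|//||n0 h] := @Pr_nondecreasing _ _ _ Q A (r / 2); first by rewrite divr_gt0.
  by move=> n w An m /ltnW; exact: An.
apply: (@le_trans _ _ (Pr Q (\bigcup_n A n))).
  apply: le_Pr; [exact/mF/osc_inf_F|exact: bigcupT_measurable|].
  by rewrite osc_infE => w /(_ k.+1)[n hn]; exists n.
apply: (le_trans h).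
have : Pr Q (A n0) <= r / 2.
  apply: le_trans hk; apply: le_trans (cnt_markov n0 k); apply: le_Pr => //.
    by apply: mF; exact: cnt_F.
  by move=> w; apply.
lra.
Qed.

End FixedOscillation.

Variable r : R.
Hypothesis r_gt0 : 0 < r.
Hypothesis FB : F r B.

Let K := (Num.trunc r).+1.

Let rK : r < K%:R. Proof. exact: truncnS_gt. Qed.

Definition excep : set Om := \bigcup_j osc_inf j.+1%:R^-1 K.

Lemma excep_null : Q excep = 0%E.
Proof.
apply: null_bigcup => j; last by apply: osc_inf_null; rewrite invr_gt0.
by apply: (F_meas (ler0n R K)); exact: osc_inf_F.
Qed.

(** Irregular paths are recognized only by time [K], but they form a null event, which the
    completeness assumption puts in [F 0]; changing the process there keeps it adapted. *)
Lemma excep_F0 : F 0 excep.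
Proof.
apply: F_null; apply: sub_sigma_algebra; exists excep; split; last by split=> //; exact: excep_null.
apply: sub_sigma_algebra; exists K%:R; first exact: ler0n.
by apply: sa_bigcup; [exact: F_sa|move=> j; exact: osc_inf_F].
Qed.

Lemma excep_osc w (e : R) : ~ excep w -> 0 < e ->
  exists e' : R, [/\ 0 <= e', e' * 2 < e & osc_bounded X e' K w].
Proof.
move=> Nw e0; have h : 0 < e / 2 by rewrite divr_gt0.
have [j] := ltr_add_invr h; rewrite add0r => hj; exists j.+1%:R^-1; split.
- by rewrite invr_ge0.
- by rewrite -ltr_pdivlMr.
- by apply: contrapT => ob; apply: Nw; exists j.
Qed.

Lemma reg_right w (t e : R) : ~ excep w -> 0 <= t <= r -> 0 < e ->
  exists2 de : R, 0 < de & forall u v, t < dy R u < t + de -> t < dy R v < t + de ->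
    `|X (dy R u) w - X (dy R v) w| < e.
Proof.
move=> Nw /andP[t0 tr] e0; have [e' [e'0 e'e ob]] := excep_osc Nw e0.
have [|de de0 hd] := osc_right e'0 ob (_ : 0 <= t < K%:R).
  by rewrite t0/= (le_lt_trans tr).
by exists de => // u v hu hv; exact: le_lt_trans (hd u v hu hv) e'e.
Qed.

Lemma reg_left w (t e : R) : ~ excep w -> 0 < t <= r -> 0 < e ->
  exists2 de : R, 0 < de & forall u v, t - de < dy R u < t -> t - de < dy R v < t ->
    `|X (dy R u) w - X (dy R v) w| < e.
Proof.
move=> Nw /andP[t0 tr] e0; have [e' [e'0 e'e ob]] := excep_osc Nw e0.
have [|de de0 hd] := osc_left e'0 ob (_ : 0 < t <= K%:R).
  by rewrite t0/= (le_trans tr (ltW rK)).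
by exists de => // u v hu hv; exact: le_lt_trans (hd u v hu hv) e'e.
Qed.

Definition rlim (t : R) w : R := lim (X (qn n t) w @[n --> \oo]).

Lemma rlimP w (t : R) : ~ excep w -> 0 <= t <= r -> X (qn n t) w @[n --> \oo] --> rlim t w.
Proof.
move=> Nw tr; have /andP[t0 _] := tr.
apply: cauchy_cvg; apply: cauchy_exP => e e0.
have [de de0 hd] := reg_right Nw tr e0; have [N hN] := qn_near t0 de0.
exists (X (qn N t) w); rewrite /nbhs/=; exists N => // n /= Nn.
by apply: hd; apply: hN.
Qed.

Lemma rlim_approx w (t e de : R) : ~ excep w -> 0 <= t <= r -> 0 < e -> 0 < de ->
  exists u, t < dy R u < t + de /\ `|rlim t w - X (dy R u) w| < e.
Proof.
move=> Nw tr e0 de0; have /andP[t0 _] := tr; have [N hN] := qn_near t0 de0.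
have /cvgrPdist_lt/(_ _ e0)[N' _ hN'] := rlimP Nw tr.
exists (qidx (maxn N N') t); split; first by apply: hN; rewrite leq_maxl.
by apply: hN'; rewrite /= leq_maxr.
Qed.

Lemma rlim_cauchy w (e a b : R) : ~ excep w -> 0 < e ->
  (forall u v, a < dy R u < b -> a < dy R v < b -> `|X (dy R u) w - X (dy R v) w| < e) ->
  forall s s', 0 <= s -> 0 <= s' -> a <= s < b -> a <= s' < b -> s <= r -> s' <= r ->
  `|rlim s w - rlim s' w| < e * 3.
Proof.
move=> Nw e0 h s s' s0 s'0 /andP[as1 sb] /andP[as' s'b] sr s'r.
have [||u [/andP[u1 u2] hu]] := @rlim_approx w s e (b - s) Nw _ e0; [by rewrite s0|lra|].
have [||v [/andP[v1 v2] hv]] := @rlim_approx w s' e (b - s') Nw _ e0; [by rewrite s'0|lra|].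
have huv : `|X (dy R u) w - X (dy R v) w| < e.
  by apply: h; apply/andP; split; lra.
have -> : rlim s w - rlim s' w = (rlim s w - X (dy R u) w) +
  (X (dy R u) w - X (dy R v) w) - (rlim s' w - X (dy R v) w) by ring.
have := ler_normB (rlim s w - X (dy R u) w + (X (dy R u) w - X (dy R v) w))
  (rlim s' w - X (dy R v) w).
have := ler_normD (rlim s w - X (dy R u) w) (X (dy R u) w - X (dy R v) w).
lra.
Qed.

(** From time [r] on the value is exactly the indicator of [B], not merely almost surely; the
    terminal value can then be read off path by path. *)
Definition regX (t : R) w : R :=
  if r <= t then \1_B w else if w \in excep then 0 else rlim t w.

Lemma regX_lt (t : R) w : t < r -> regX t w = if w \in excep then 0 else rlim t w.
Proof. by move=> tr; rewrite /regX leNgt tr. Qed.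

Lemma regX_ge (t : R) w : r <= t -> regX t w = \1_B w.
Proof. by rewrite /regX => ->. Qed.

Lemma regX_cadlag : cadlag regX.
Proof.
apply/cadlagP; split => w t t0.
  move=> e e0; have [rt|tr] := leP r t.
    by exists 1 => // s /andP[ts _]; rewrite !regX_ge ?subrr ?normr0// (le_trans rt).
  have [Nw|Nw] := boolP (w \in excep).
    exists (r - t); first by lra.
    by move=> s /andP[ts str]; rewrite !regX_lt ?Nw ?subrr ?normr0//; lra.
  have Nw' : ~ excep w by move: Nw; rewrite notin_setE.
  have e3 : 0 < e / 3 by rewrite divr_gt0.
  have tr' : 0 <= t <= r by rewrite t0 ltW.
  have [de de0 hd] := reg_right Nw' tr' e3.
  exists (Num.min de (r - t)); first by rewrite lt_min de0 subr_gt0.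
  move=> s /andP[ts]; rewrite -ltrBlDl lt_min => /andP[s1 s2].
  rewrite !regX_lt ?(negbTE Nw); [|lra..].
  have -> : e = e / 3 * 3 by lra.
  by apply: (rlim_cauchy Nw' e3 hd) => //; try (apply/andP; split); lra.
apply: ll_at_cauchy => e e0; have [rt|tr] := ltP r t.
  exists (t - r); first by lra.
  move=> s s' /andP[s1 s2] /andP[s'1 s'2]; by rewrite !regX_ge ?subrr ?normr0//; lra.
have [Nw|Nw] := boolP (w \in excep).
  exists 1 => // s s' /andP[s1 s2] /andP[s'1 s'2].
  by rewrite !regX_lt ?Nw ?subrr ?normr0//; lra.
have Nw' : ~ excep w by move: Nw; rewrite notin_setE.
have e3 : 0 < e / 3 by rewrite divr_gt0.
have tr' : 0 < t <= r by rewrite t0.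
have [de de0 hd] := reg_left Nw' tr' e3.
exists (Num.min de t); first by rewrite lt_min de0.
have m1 : Num.min de t <= de by rewrite ge_min lexx.
have m2 : Num.min de t <= t by rewrite ge_min lexx orbT.
move=> s s' /andP[s1 s2] /andP[s'1 s'2].
rewrite !regX_lt ?(negbTE Nw); [|lra..].
have -> : e = e / 3 * 3 by lra.
by apply: (rlim_cauchy Nw' e3 hd) => //; try (apply/andP; split); lra.
Qed.

Lemma regX01 (t : R) w : 0 <= t -> 0 <= regX t w <= 1.
Proof.
move=> t0; rewrite /regX; case: ifPn => [_|]; first by rewrite indicE; case: (w \in B); rewrite lexx ler01.
rewrite -ltNge => tr; case: ifPn => [_|/negP Nw]; first by rewrite lexx ler01.
have {}Nw : ~ excep w by move=> h; apply: Nw; exact: mem_set.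
have cv := @rlimP w t Nw; rewrite t0 (ltW tr) in cv; have {}cv := cv isT.
rewrite -(cvg_lim _ cv)//; apply/andP; split.
  apply: limr_ge; first by apply/cvg_ex; exists (rlim t w).
  by apply: nearW => n; have /andP[] := x01 w (qn_ge0 n t).
apply: limr_le; first by apply/cvg_ex; exists (rlim t w).
by apply: nearW => n; have /andP[] := x01 w (qn_ge0 n t).
Qed.

(** For each [s > t] the right limit uses only times below [s] from some index on, so it is
    measurable for [F s]; right-continuity of the filtration brings it down to [F t]. *)
Lemma regX_adapted (t : R) : 0 <= t -> mf (F t) (regX t).
Proof.
move=> t0; have sa := F_sa t0; have [rt|tr] := leP r t.
  rewrite (_ : regX t = \1_B); last by apply/funext => w; rewrite /regX rt.
  by apply: mf_indic => //; apply: (F_mono _ rt FB); exact: ltW.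
move=> C mC; rewrite F_rc// => s /= ts.
have s0 : 0 <= s by lra.
have st0 : 0 < s - t by lra.
have [N hN] := qn_near t0 st0; have sa' := F_sa s0.
suff : mf (F s) (regX t) by exact.
apply: (@mf_lim _ _ _ sa' (fun n w => if w \in excep then 0 else X (qn (n + N) t) w)).
  move=> n; apply: mf_if => //; first by apply: F_mono excep_F0.
    exact: mf_cst.
  have /andP[_ h] := hN (n + N)%N (leq_addl _ _).
  by apply: XmfS; [exact: qn_ge0|move: h; rewrite addrC subrK => /ltW].
move=> w; rewrite /regX leNgt tr/=; have [Nw|Nw] := boolP (w \in excep); first exact: cvg_cst.
have Nw' : ~ excep w by move: Nw; rewrite notin_setE.
rewrite (cvg_shiftn N (fun n => X (qn n t) w)).
by apply: rlimP => //; rewrite t0 ltW.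
Qed.

(** The integrals along [qn n t] all equal [Pr Q (A]&[B)], because [A] belongs to the later fields
    too; bounded convergence does the rest. *)
Lemma regX_cond (t : R) A : 0 <= t <= r -> F t A ->
  Ex Q (fun w => regX t w * \1_A w) = Pr Q (A `&` B).
Proof.
move=> /andP[t0]; rewrite le_eqVlt => /predU1P[->|tr] FA.
  rewrite -Ex_indic; last by apply: measurableI => //; exact: (F_meas (ltW r_gt0)).
  by apply: Ex_ext => w; rewrite /regX lexx indicI/= mulrC.
have mA : measurable A by exact: (F_meas t0).
have b1 n : bm (fun w => X (qn n t) w * \1_A w : R).
  apply: bmM; last exact: bm_indic.
  by apply: (mf_bm01 (F_meas (qn_ge0 n t)) (Xmf (qn_ge0 n t))) => w; exact/x01/qn_ge0.
have cv : Ex Q (fun w => X (qn n t) w * \1_A w) @[n --> \oo] -->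
    Ex Q (fun w => regX t w * \1_A w).
  apply: (@Ex_cvg _ _ _ Q _ _ 1 excep).
  - by move=> n; exact: (b1 n).1.
  - apply: measurable_funM; last exact: measurable_indic.
    exact: (mf_measurable (F_meas t0) (regX_adapted t0)).
  - move=> n w; have /andP[? ?] := x01 w (qn_ge0 n t).
    by rewrite indicE; case: (w \in A); rewrite ?mulr1 ?mulr0 ?normr0// ger0_norm.
  - by apply: (F_meas (lexx 0)); exact: excep_F0.
  - exact: excep_null.
  - move=> w Nw; apply: cvgMl.
    rewrite /regX leNgt tr/= ifF; last by apply/negP => /set_mem.
    by apply: rlimP => //; rewrite t0 ltW.
rewrite -(cvg_lim _ cv)//; apply/cvg_lim => //.
rewrite (_ : (fun n => _) = cst (Pr Q (A `&` B))); first exact: cvg_cst.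
apply/funext => n; have [_ _ h] := X_cond (qn_ge0 n t); rewrite h//.
apply: F_mono FA => //; have /andP[h1 _] := qn_itv n t0; exact: ltW.
Qed.

End Version.

Definition cadlag_version (r : R) (B : set Om) (X : R -> Om -> R) := [/\ cadlag X,
  forall t : R, 0 <= t -> mf (F t) (X t), forall (t : R) w, 0 <= t -> 0 <= X t w <= 1,
  forall (t : R) w, r <= t -> X t w = \1_B w &
  forall (t : R) A, 0 <= t <= r -> F t A ->
    Ex Q (fun w => X t w * \1_A w) = Pr Q (A `&` B)].

Lemma cadlag_version_exists (r : R) (B : set Om) : 0 < r -> F r B ->
  exists X, cadlag_version r B X.
Proof.
move=> r0 FB; have mB : measurable B by exact: (F_meas (ltW r0)).
have : forall t : R, exists f, 0 <= t -> cond_prob Q (F t) B f.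
  move=> t; have [t0|t0] := leP 0 t; last by exists (fun=> 0).
  by have [f hf] := cond_prob_exists Q (F_sa t0) (F_meas t0) mB; exists f.
move=> /choice[X hX]; exists (regX B X r); split.
- exact: regX_cadlag.
- by move=> t; apply: (regX_adapted mB hX).
- by move=> t w; apply: (regX01 hX).
- by move=> t w rt; rewrite regX_ge.
- by move=> t A; apply: (regX_cond mB hX).
Qed.

End Regularization.

(** * Optional sets, split-measurable sets and functions recovered from level sets *)

Lemma sa_trace (T : Type) (D : set T) (S : set (set T)) :
  sigma_algebra D S -> sigma_algebra setT [set A | S (D `&` A)].
Proof.
move=> [S0 SD SU]; split => [|A SA|A SA] /=; first by rewrite setI0.
- rewrite setTD -setDE (_ : D `\` A = D `\` (D `&` A)); first exact: SD.
  by rewrite setDIr setDv set0U.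
- by rewrite setI_bigcupr; exact: SU.
Qed.

(** The function is the supremum of the rationals [q] with [x] in [D q]. The sets need not be
    nested, since they come from almost sure identities; the value is prescribed only where they are
    the level sets of a real number. *)
Lemma lift_levels (T : pointedType) (R : realType) (H : set (set T))
    (D : rat -> set T) : sigma_algebra setT H -> (forall q, H (D q)) ->
  exists f : T -> R, mf H f /\
    forall x y, (forall q, D q x <-> ratr q < y) -> f x = y.
Proof.
move=> hH HD.
pose g q (x : T) : \bar R := if x \in D q then (ratr q)%:E else -oo%E.
pose h x := ereal_sup (range (g ^~ x)).
exists (fun x => fine (h x)); split; last first.
  move=> x y hD; suff -> : h x = y%:E by [].
  apply/eqP; rewrite eq_le; apply/andP; split.
    apply: ge_ereal_sup => _ [q _ <-]; rewrite /g; case: ifPn => [/set_mem/hD|].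
      by move=> /ltW; rewrite lee_fin.
    by rewrite leNye.
  apply/lee_addgt0Pr => e e0.
  have [q /andP[q1 q2]] : exists q, y - e < ratr q < y.
    have [q] : exists q : rat, ratr q \in `]y - e, y[ by apply: rat_in_itvoo; lra.
    by rewrite in_itv; exists q.
  have : (g q x <= h x)%E by apply: ereal_sup_ubound; exists q.
  rewrite /g ifT; last by apply: mem_set; apply/hD.
  move=> h1; apply: (@le_trans _ _ ((ratr q)%:E + e%:E)%E); last exact: leeD2r.
  by rewrite -EFinD lee_fin; lra.
have mh : measurable_fun (setT : set (g_sigma_algebraType H)) h.
  apply: (measurability _ (ErealGenOInfty.measurableE R)).
  move=> _ [_ [c -> <-]]; rewrite setTI.
  rewrite (_ : h @^-1` _ = [set x | exists q : rat, (c < ratr q)%R /\ D q x]).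
    apply: sub_sigma_algebra; apply: sa_ex => // q; apply: sa_and => // _; exact: HD.
  apply/seteqP; split => x /=; rewrite in_itv/= andbT.
    move=> /ereal_sup_gt[_ [q _ <-]]; rewrite /g; case: ifPn => [/set_mem Dq|_ //].
    by rewrite lte_fin => cq; exists q.
  move=> [q [cq Dq]]; apply: (@lt_le_trans _ _ (g q x)).
    by rewrite /g ifT ?lte_fin//; exact: mem_set.
  by apply: ereal_sup_ubound; exists q.
apply/mfP => //.
exact: (measurableT_comp (fine_measurable measurableT)).
Qed.

Section Processes.
Context {R : realType} {d : measure_display} {Om : measurableType d}.
Variable F : R -> set (set Om).
Hypothesis F_sa : forall t : R, 0 <= t -> sigma_algebra setT (F t).
Hypothesis F_mono : forall s t : R, 0 <= s -> s <= t -> F s `<=` F t.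

(** Only the trace on nonnegative times is constrained, which gives a sigma-algebra over the whole
    type and avoids relative complements. *)
Definition opt : set (set (R * Om)) := [set A | optional_sa F (timedom `&` A)].

Definition osplit : set (set (\bar R * (R * Om))) :=
  [set C | split_sa F (ext_dom `&` C)].

Lemma opt_sa : sigma_algebra setT opt.
Proof. by apply: sa_trace; exact: smallest_sigma_algebra. Qed.

Lemma osplit_sa : sigma_algebra setT osplit.
Proof. by apply: sa_trace; exact: smallest_sigma_algebra. Qed.

Lemma opt_cadlag (X : R -> Om -> R) (B : set R) : cadlag X ->
  (forall t : R, 0 <= t -> mf (F t) (X t)) -> measurable B ->
  opt [set p | B (X p.1 p.2)].
Proof. by move=> cX aX mB; apply: sub_sigma_algebra; exists X, B; split. Qed.

Lemma opt_fun_cadlag (X : R -> Om -> R) : cadlag X ->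
  (forall t : R, 0 <= t -> mf (F t) (X t)) -> mf opt (fun p => X p.1 p.2).
Proof. by move=> cX aX B mB; exact: (opt_cadlag cX aX mB). Qed.

(* A predicate that is increasing and right-closed in time is the indicator
   of a stochastic interval [[R, oo[ and hence a cadlag process. *)
Lemma opt_upset (Z : R -> Om -> Prop) :
  (forall t : R, 0 <= t -> F t (Z t)) ->
  (forall (s t : R) w, s <= t -> Z s w -> Z t w) ->
  (forall (t : R) w, (forall s, t < s -> Z s w) -> Z t w) ->
  opt [set p | Z p.1 p.2].
Proof.
move=> FZ Zm Zr; pose X (t : R) w : R := \1_(Z t) w.
have XE (t : R) w : X t w = (`[< Z t w >])%:R.
  by rewrite /X indicE; congr (_%:R); congr nat_of_bool; apply/idP/asboolP => [/set_mem//|]; exact: mem_set.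
have -> : [set p | Z p.1 p.2] = [set p | [set 1] (X p.1 p.2)].
  apply/seteqP; split => -[t w] /=; rewrite XE; first by move=> z; rewrite asboolT.
  by case: asboolP => //= _ /eqP; rewrite eq_sym oner_eq0.
apply: opt_cadlag; last by exact: measurable_set1.
- apply/cadlagP; split => w t t0.
    move=> r r0; have [Zt|Zt] := pselect (Z t w).
      exists 1 => // s /andP[ts _]; rewrite !XE !asboolT ?subrr ?normr0//.
      exact: Zm ts Zt.
    have [s ts nZ] : exists2 s, t < s & ~ Z s w.
      apply: contrapT => h; apply: Zt; apply: Zr => s ts; apply: contrapT => nZ.
      by apply: h; exists s.
    exists (s - t); first by rewrite subr_gt0.
    move=> u /andP[tu us]; rewrite !XE !asboolF ?subrr ?normr0//.
    by move=> Zu; apply: nZ; apply: Zm Zu; lra.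
  apply: ll_at_cauchy => r r0; have [[s st Zs]|hn] := pselect (exists2 s, s < t & Z s w).
    exists (t - s); first by rewrite subr_gt0.
    move=> u u' /andP[u1 u2] /andP[u1' u2']; rewrite !XE !asboolT ?subrr ?normr0//.
      by apply: Zm Zs; lra.
    by apply: Zm Zs; lra.
  exists 1 => // u u' /andP[u1 u2] /andP[u1' u2']; rewrite !XE !asboolF ?subrr ?normr0//.
    by move=> Zu; apply: hn; exists u'.
  by move=> Zu; apply: hn; exists u.
- move=> t t0; apply: mf_indic; [exact: F_sa|exact: FZ].
Qed.

Lemma opt_ge (c : R) (B : set Om) : 0 <= c -> F c B ->
  opt [set p | c <= p.1 /\ B p.2].
Proof.
move=> c0 FB; apply: (opt_upset (Z := fun t w => c <= t /\ B w)).
- move=> t t0; apply: sa_and; first exact: F_sa.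
  by move=> ct; apply: (F_mono c0 ct).
- by move=> s t w st [cs Bw]; split => //; exact: le_trans st.
- move=> t w h; split; last by have [|_ ?] := h (t + 1); [lra|].
  rewrite leNgt; apply/negP => tc.
  have [|] := h ((t + c) / 2); lra.
Qed.

Lemma opt_gt (c : R) (B : set Om) : 0 <= c -> F c B ->
  opt [set p | c < p.1 /\ B p.2].
Proof.
move=> c0 FB.
rewrite (_ : [set p | _] = [set p | exists n, c + n.+1%:R^-1 <= p.1 /\ B p.2]).
  apply: (sa_ex opt_sa) => n; have cn : c <= c + n.+1%:R^-1 by rewrite lerDl invr_ge0.
  by apply: opt_ge; [exact: le_trans cn|exact: F_mono FB].
apply/seteqP; split => -[t w] /=.
  by move=> [/ltr_add_invr[n cn] Bw]; exists n; split => //; exact: ltW.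
by move=> [n [cn Bw]]; split => //; apply: lt_le_trans cn; rewrite ltrDl invr_gt0.
Qed.

Lemma opt_time_lt (c : R) : opt [set p | p.1 < c].
Proof.
have [c0|c0] := leP 0 c.
  rewrite (_ : [set p | _] = ~` [set p | c <= p.1 /\ setT p.2]).
    by apply: (saC opt_sa); apply: opt_ge => //; apply: saT; exact: F_sa.
  apply/seteqP; split => -[t w] /=; first by move=> tc [ct]; lra.
  by move=> h; rewrite ltNge; apply/negP => ct; apply: h.
rewrite /opt/= (_ : _ `&` _ = set0); first by case: (smallest_sigma_algebra timedom _ : sigma_algebra _ (optional_sa F)).
by apply/seteqP; split => -[t w] //= [] /=; rewrite /timedom/=; lra.
Qed.

Lemma opt_time0 (B : set Om) : F 0 B -> opt [set p | p.1 = 0 /\ B p.2].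
Proof.
move=> FB; rewrite (_ : [set p | _] = [set p | 0 <= p.1 /\ B p.2] `\`
    [set p | 0 < p.1 /\ B p.2]).
  by apply: (saD opt_sa); [exact: opt_ge|exact: opt_gt].
apply/seteqP; split => -[t w] /=; first by move=> [-> Bw]; rewrite lexx ltxx; split=> // -[].
move=> [[t0 Bw] h]; split => //; apply/eqP; rewrite eq_le t0 andbT leNgt.
by apply/negP => t1; apply: h.
Qed.

Lemma osplit_rect (B : set (\bar R)) (A : set (R * Om)) : measurable B -> opt A ->
  osplit [set x | B x.1 /\ A x.2].
Proof.
move=> mB oA; apply: sub_sigma_algebra.
exists (B `&` [set x | (0 <= x)%E]), (timedom `&` A); split => //.
- apply: measurableI => //; rewrite (_ : [set x | _] = `[0%E, +oo[%classic).
    exact: emeasurable_itv.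
  by apply/seteqP; split => x /=; rewrite in_itv/= andbT.
- by apply/seteqP; split => -[x [t w]] /=; rewrite /timedom/ext_dom/=; tauto.
Qed.

Lemma osplit_opt (A : set (R * Om)) : opt A -> osplit [set x | A x.2].
Proof.
move=> oA; rewrite (_ : [set x | _] = [set x | [set: \bar R] x.1 /\ A x.2]).
  exact: osplit_rect.
by apply/seteqP; split => x /=; tauto.
Qed.

Lemma osplit_fst (B : set (\bar R)) : measurable B -> osplit [set x | B x.1].
Proof.
move=> mB; rewrite (_ : [set x | _] = [set x | B x.1 /\ [set: R * Om] x.2]).
  by apply: osplit_rect => //; exact: saT opt_sa.
by apply/seteqP; split => x /=; tauto.
Qed.

Lemma osplit_fun_opt (f : R * Om -> R) : mf opt f -> mf osplit (fun x => f x.2).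
Proof. by move=> of_ B mB; apply: (osplit_opt (of_ B mB)). Qed.

End Processes.

Lemma indic_setI (R : realType) (T : Type) (A B : set T) w :
  \1_(A `&` B) w = \1_A w * \1_B w :> R.
Proof. by rewrite indicI. Qed.

Lemma Ex_indic_integral {d} {T : measurableType d} {R : realType} (P : probability T R)
    (f : T -> R) (A : set T) : measurable A ->
  Ex P (fun x => f x * \1_A x) = fine (\int[P]_(x in A) (f x)%:E)%E.
Proof.
move=> mA; congr fine; rewrite [RHS]integral_mkcond; apply: eq_integral => x _.
by rewrite /patch indicE; case: (x \in A); rewrite ?mulr1 ?mulr0.
Qed.

Lemma stop_at_ge (R : realType) (Om : Type) (X : R -> Om -> R) (U : Om -> \bar R) (t : R) w :
  (t%:E <= U w)%E -> stop_at X U t w = X t w.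
Proof. by move=> tU; rewrite /stop_at ltNge tU. Qed.

Lemma stop_at_lt (R : realType) (Om : Type) (X : R -> Om -> R) (U : Om -> \bar R) (t : R) w :
  (U w < t%:E)%E -> stop_at X U t w = X (fine (U w)) w.
Proof. by move=> tU; rewrite /stop_at tU. Qed.

(** Off a null set the localizing times eventually exceed any fixed time, so the stopped values are
    eventually the true ones; the common bound [C] allows dominated convergence. *)
Lemma bounded_loc_mart {d} {Om : measurableType d} {R : realType}
    (P : probability Om R) (G : R -> set (set Om)) (Z : R -> Om -> R) (C : R) :
  (forall t : R, 0 <= t -> sigma_algebra setT (G t)) ->
  (forall t : R, 0 <= t -> G t `<=` measurable) -> local_martingale P G Z ->
  (forall (t : R) w, 0 <= t -> `|Z t w| <= C) ->
  forall (s t : R) A, 0 <= s -> s <= t -> G s A ->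
  Ex P (fun w => Z t w * \1_A w) = Ex P (fun w => Z s w * \1_A w).
Proof.
move=> G_sa G_meas [_ aZ [Tn [sT incT [M [mM PM hM]] mart]]] ZC s t A s0 st GA.
have mA := G_meas _ s0 _ GA; have t0 := le_trans s0 st.
have mZ (u : R) : 0 <= u -> measurable_fun setT (Z u).
  by move=> u0; exact: (mf_measurable (G_meas _ u0) (aZ u u0)).
have mono n m w : (n <= m)%N -> (Tn n w <= Tn m w)%E.
  elim: m => [|m IH]; first by rewrite leqn0 => /eqP ->.
  rewrite leq_eqVlt => /predU1P[->//|nm]; exact: le_trans (IH nm) (incT m w).
have cv (u : R) : 0 <= u -> Ex P (fun w => stop_at Z (Tn n) u w * \1_A w) @[n --> \oo] -->
    Ex P (fun w => Z u w * \1_A w).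
  move=> u0; apply: (@Ex_cvg _ _ _ P _ _ C M) => //.
  - move=> n; apply: measurable_funM; last exact: measurable_indic.
    have [aS _ _] := mart n; exact: (mf_measurable (G_meas _ u0) (aS u u0)).
  - by apply: measurable_funM; [exact: mZ|exact: measurable_indic].
  - move=> n x; have C0 : 0 <= C by exact: le_trans (ZC 0 point (lexx 0)).
    have : `|stop_at Z (Tn n) u x| <= C.
      rewrite /stop_at; case: ifP => _; last exact: ZC.
      by apply: ZC; apply: fine_ge0; have [h _] := sT n; exact: h.
    by rewrite indicE; case: (x \in A); rewrite ?mulr1 ?mulr0 ?normr0.
  - move=> w nM; have [n hn] := hM w nM u.
    apply/cvgrPdist_lt => e e0; exists n => // m /= nm.
    by rewrite stop_at_ge ?subrr ?normr0//; exact: le_trans (mono _ _ _ nm).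
have E1 : (fun n => Ex P (fun w => stop_at Z (Tn n) t w * \1_A w)) =
    (fun n => Ex P (fun w => stop_at Z (Tn n) s w * \1_A w)).
  apply/funext => n; rewrite !Ex_indic_integral//; congr fine.
  by have [_ _ h] := mart n; exact: h.
rewrite -(cvg_lim _ (cv t t0))// -(cvg_lim _ (cv s s0))//.
by rewrite E1.
Qed.

(** * The progressively enlarged filtration *)

Section Enlargement.
Context {R : realType} {d : measure_display} {Om : measurableType d}.
Variables (Q : probability Om R) (F : R -> set (set Om)) (tau : Om -> \bar R).
Hypothesis F_sa : forall t : R, 0 <= t -> sigma_algebra setT (F t).
Hypothesis F_meas : forall t : R, 0 <= t -> F t `<=` measurable.
Hypothesis F_mono : forall s t : R, 0 <= s -> s <= t -> F s `<=` F t.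
Hypothesis F_rc : forall t : R, 0 <= t ->
  F t = \bigcap_(s in [set s : R | t < s]) F s.
Hypothesis F_null : nullsa Q (sa_inf F) `<=` F 0.
Hypothesis tau_meas : measurable_fun setT tau.
Hypothesis tau_ge0 : forall w, (0 <= tau w)%E.
Hypothesis N_meas : Ncal Q F tau `<=` measurable.

Local Notation N := (Ncal Q F tau).
Local Notation G := (Gfilt Q F tau).
Local Notation KK := (sa_join (sigma_of tau) (sa_inf F)).

Definition nul (M : set Om) := N M /\ Q M = 0%E.

Lemma measurable_mine (s : R) : measurable_fun setT (fun x : \bar R => Order.min x s%:E).
Proof. by apply: measurable_mine => //; exact: measurable_cst. Qed.

Lemma mine_preimage (s : R) (B : set (\bar R)) : measurable B ->
  measurable [set x : \bar R | B (Order.min x s%:E)].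
Proof. by move=> mB; rewrite -[X in measurable X]setTI; exact: measurable_mine. Qed.

Lemma G_sa t : sigma_algebra setT (G t). Proof. exact: sa_g. Qed.

(** The intersection over later times lies in the field of any single later time [s], so the
    generators of that one field suffice. *)
Lemma G_gen (V : set (set Om)) (t s : R) : sigma_algebra setT V -> N `<=` V ->
  t < s -> F s `<=` V ->
  (forall B, measurable B -> V [set w | B (Order.min (tau w) s%:E)]) -> G t `<=` V.
Proof.
move=> saV NV ts FV mV; apply: sa_gen => // A [|/(_ s ts)]; first exact: NV.
apply: sa_gen => // B [|]; first exact: FV.
by apply: sa_gen => // _ [C [mC ->]]; exact: mV.
Qed.

Lemma N_G t : N `<=` G t.
Proof. by move=> A NA; apply: sub_sigma_algebra; left. Qed.

Lemma F_G (t : R) : 0 <= t -> F t `<=` G t.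
Proof.
move=> t0 A FA; apply: sub_sigma_algebra; right => s /= ts.
by apply: sub_sigma_algebra; left; apply: F_mono FA => //; exact: ltW.
Qed.

Lemma tau_G (t : R) (B : set (\bar R)) : measurable B ->
  G t [set w | (tau w <= t%:E)%E /\ B (tau w)].
Proof.
move=> mB; apply: sub_sigma_algebra; right => s /= ts.
apply: sub_sigma_algebra; right; apply: sub_sigma_algebra.
exists ([set x | (x <= t%:E)%E] `&` B); split.
  apply: measurableI => //; rewrite (_ : [set x | _] = `]-oo, t%:E]%classic).
    exact: emeasurable_itv.
  by apply/seteqP; split => x /=; rewrite in_itv.
have tse : (t%:E < s%:E)%E by rewrite lte_fin.
apply/seteqP; split => w /=.
  by move=> [h Bw]; rewrite min_l// (le_trans h)// ltW.
by rewrite ge_min [X in _ || X]leNgt tse/= orbF => -[h]; rewrite min_l ?(le_trans h)// ltW.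
Qed.

Lemma G_mono (s t : R) : s <= t -> G s `<=` G t.
Proof.
move=> st; apply: sa_gen; first exact: G_sa.
move=> A [NA|hA]; first exact: N_G.
by apply: sub_sigma_algebra; right => u /= tu; apply: hA; exact: le_lt_trans tu.
Qed.

Lemma KK_meas : KK `<=` measurable.
Proof.
apply: (sa_gen measurable_sa) => A [].
  apply: (sa_gen measurable_sa) => _ [B [mB ->]].
  by rewrite -[X in measurable X]setTI; exact: tau_meas.
by apply: (sa_gen measurable_sa) => B [t t0]; exact: F_meas.
Qed.

Lemma KK_sa : sigma_algebra setT KK. Proof. exact: sa_g. Qed.

Lemma nul_KK M : KK M -> Q M = 0%E -> nul M.
Proof.
by move=> KM QM; split => //; apply: sub_sigma_algebra; exists M; split => //; split.
Qed.

Lemma nul_bigcup (M : nat -> set Om) : (forall n, nul (M n)) -> nul (\bigcup_n M n).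
Proof.
move=> hM; split; first by apply: (sa_bigcup (sa_g _)) => n; case: (hM n).
by apply: null_bigcup => n; have [NM QM] := hM n => //; exact: N_meas.
Qed.

Lemma nul_ex (I : countType) (M : I -> set Om) : (forall n, nul (M n)) ->
  nul [set w | exists i, M i w].
Proof.
move=> hM; rewrite exists_bigcup; apply: nul_bigcup => n; case: unpickle => // ; apply: nul_KK; rewrite ?measure0//.
exact: sa0 KK_sa.
Qed.

Lemma nul0 : nul set0.
Proof. by apply: nul_KK; rewrite ?measure0//; exact: sa0 KK_sa. Qed.

Lemma nulU M M' : nul M -> nul M' -> nul (M `|` M').
Proof.
by move=> h h'; rewrite -bigcup2E; apply: nul_bigcup => -[|[|n]] //=; exact: nul0.
Qed.

(** Almost sure validity, with the exceptional set taken among the negligible sets that the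
    splitting formula may ignore. *)
Definition qs (A : Om -> Prop) := exists M, nul M /\ forall w, ~ M w -> A w.

Lemma qsT (A : Om -> Prop) : (forall w, A w) -> qs A.
Proof. by move=> hA; exists set0; split => //; exact: nul0. Qed.

Lemma qs_sub (A B : Om -> Prop) : (forall w, A w -> B w) -> qs A -> qs B.
Proof. by move=> AB [M [nM h]]; exists M; split => // w /h/AB. Qed.

Lemma qs_all (I : countType) (A : I -> Om -> Prop) : (forall i, qs (A i)) ->
  qs (fun w => forall i, A i w).
Proof.
move=> /choice[M hM]; exists [set w | exists i, M i w]; split.
  by apply: nul_ex => i; case: (hM i).
by move=> w nM i; have [_] := hM i; apply => Mi; apply: nM; exists i.
Qed.

Lemma qs_and (A B : Om -> Prop) : qs A -> qs B -> qs (fun w => A w /\ B w).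
Proof.
move=> [M [nM hA]] [M' [nM' hB]]; exists (M `|` M'); split; first exact: nulU.
by move=> w n; split; [apply: hA|apply: hB] => h; apply: n; [left|right].
Qed.

(** The sets that are negligible or have a negligible complement already form a sigma-algebra.
    Modulo null sets, [Ncal] therefore carries no information. *)
Lemma N_dichotomy A : N A -> exists M, [/\ KK M, Q M = 0%E & A `<=` M \/ ~` A `<=` M].
Proof.
pose V := [set A | exists M, [/\ KK M, Q M = 0%E & A `<=` M \/ ~` A `<=` M]].
suff saV : sigma_algebra setT V.
  move: A; apply: (sa_gen saV) => A [M [KM [QM AM]]]; exists M; split => //; by left.
split.
- by exists set0; split; [exact: sa0 KK_sa|exact: measure0|left].
- move=> B [M [KM QM AM]]; exists M; split => //; rewrite setTD setCK.
  by case: AM; tauto.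
- move=> B hB; have [M hM] := choice hB.
  exists (\bigcup_n M n); split.
  + by apply: (sa_bigcup KK_sa) => n; case: (hM n).
  + apply: null_bigcup => n; have [KM QM _] := hM n => //; exact: KK_meas.
  + have [[n hn]|hn] := pselect (exists n, ~` B n `<=` M n).
      right; rewrite setC_bigcup => w /(_ n I) Bw; exists n => //; exact: hn.
    left => w [n _ Bw]; exists n => //; have [_ _ [BM|BM]] := hM n; first exact: BM.
    by exfalso; apply: hn; exists n.
Qed.

Lemma N_qs A : N A -> qs (fun w => ~ A w) \/ qs A.
Proof.
move=> /N_dichotomy[M [KM QM [AM|AM]]]; [left|right]; exists M;
  (split; first exact: nul_KK); first by move=> w nM /AM.
by move=> w nM; apply: contrapT => /AM.
Qed.

(** The completion of [sigma(tau)] joined with [F_infinity] by its own null sets; it is large enough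
    to contain every [G t]. *)
Definition KKstar : set (set Om) := [set A | exists A' M,
  [/\ KK A', KK M, Q M = 0%E & forall w, ~ M w -> (A w <-> A' w)]].

Lemma KKstar_sa : sigma_algebra setT KKstar.
Proof.
have sK := KK_sa; have K0 := sa0 sK; split.
- by exists set0, set0; split => //; exact: measure0.
- move=> A [A' [M [KA' KM QM h]]]; exists (~` A'), M; split => //; first exact: (saC sK).
  by rewrite setTD => w /h; rewrite /setC/=; tauto.
- move=> A hA; have [A' hA'] := choice hA; have [M hM] := choice hA'.
  exists (\bigcup_n A' n), (\bigcup_n M n); split.
  + by apply: (sa_bigcup sK) => n; case: (hM n).
  + by apply: (sa_bigcup sK) => n; case: (hM n).
  + apply: null_bigcup => n; have [_ KM QM _] := hM n => //; exact: KK_meas.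
  + move=> w nM; have nMn n : ~ M n w by move=> Mn; apply: nM; exists n.
    by split=> -[n _ An]; exists n => //; have [_ _ _ /(_ w (nMn n))] := hM n; tauto.
Qed.

Lemma G_KKstar (t : R) : 0 <= t -> G t `<=` KKstar.
Proof.
move=> t0; have tt1 : t < t + 1 by rewrite ltrDl.
have sK := KK_sa; have K0 := sa0 sK; have KT := saT sK.
apply: (G_gen KKstar_sa _ tt1).
- move=> A /N_dichotomy[M [KM QM [AM|AM]]].
    by exists set0, M; split => // w nM; split => // /AM.
  by exists setT, M; split => // w nM; split => // _; apply: contrapT => /AM.
- move=> A FA; exists A, set0; split => //; try exact: measure0.
  apply: sub_sigma_algebra; right; apply: sub_sigma_algebra.
  by exists (t + 1) => //=; rewrite addr_ge0.
- move=> B mB; exists [set w | B (Order.min (tau w) (t + 1)%:E)], set0.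
  split => //; try exact: measure0.
  apply: sub_sigma_algebra; left; apply: sub_sigma_algebra.
  by exists [set x | B (Order.min x (t + 1)%:E)]; split => //; exact: mine_preimage.
Qed.

Lemma G_meas (t : R) : 0 <= t -> G t `<=` measurable.
Proof.
move=> t0; have tt1 : t < t + 1 by rewrite ltrDl.
apply: (G_gen measurable_sa _ tt1).
- exact: N_meas.
- by apply: F_meas; rewrite addr_ge0.
- move=> B mB; rewrite -[X in measurable X]setTI.
  exact: (tau_meas measurableT (mine_preimage (t + 1) mB)).
Qed.

Lemma Ginf_sa : sigma_algebra setT (Ginf Q F tau). Proof. exact: sa_g. Qed.

Lemma G_Ginf (t : R) : 0 <= t -> G t `<=` Ginf Q F tau.
Proof. by move=> t0 A GA; apply: sub_sigma_algebra; exists t. Qed.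

Lemma Ginf_KKstar : Ginf Q F tau `<=` KKstar.
Proof. by apply: (sa_gen KKstar_sa) => A [t t0]; exact: G_KKstar. Qed.

(** A set of [Ginf] differs from one of the uncompleted sigma-algebra inside a null set of the
    latter, so being null makes it a subset of such a null set. Null sets found under an equivalent
    measure thus become negligible ones. *)
Lemma Ginf_nul A : Ginf Q F tau A -> Q A = 0%E -> nul A.
Proof.
move=> GA QA; have [A' [M [KA' KM QM h]]] := Ginf_KKstar GA.
have mA' := KK_meas KA'; have mM := KK_meas KM.
split => //; apply: sub_sigma_algebra; exists (A' `|` M).
have mA : measurable A.
  by move: A GA {QA h}; apply: (sa_gen measurable_sa) => A [t t0]; exact: G_meas.
split; first exact: (saU KK_sa).
split; last first.
  move=> w Aw; have [Mw|nMw] := pselect (M w); [by right|left].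
  by have := h w nMw; tauto.
apply/eqP; rewrite eq_le measure_ge0 andbT.
have -> : 0%E = Q (A `|` M) by rewrite null_set_setU.
apply: le_measure; rewrite ?inE; [exact: measurableU..|].
move=> w [A'w|Mw]; [|by right]; have [Mw|nMw] := pselect (M w); [by right|left].
by have := h w nMw; tauto.
Qed.

(** The exceptional set of outcomes is common to all times [t], as indistinguishability requires;
    [E] itself need not belong to [V]. *)
Definition good (V : set (set (R * Om))) (E A : set (R * Om)) := exists D, V D /\
  qs (fun w => forall t : R, 0 <= t -> E (t, w) -> (A (t, w) <-> D (t, w))).

(** Split-measurable sets with their first coordinate frozen at [tau]: the shape of [Y''(tau)] in
    the splitting formula. *)
Definition at_tau : set (set (R * Om)) :=
  [set D | exists2 C, osplit F C & D = [set p | C (tau p.2, p)]].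

Lemma at_tau_sa : sigma_algebra setT at_tau.
Proof.
have sO := @osplit_sa R d Om F; split.
- by exists set0 => //; exact: sa0 sO.
- by move=> _ [C oC ->]; exists (~` C); [exact: (saC sO)|rewrite setTD].
- move=> D hD.
  have /choice[C hC] : forall n, exists C, osplit F C /\ D n = [set p | C (tau p.2, p)].
    by move=> n; have [C oC ->] := hD n; exists C.
  exists (\bigcup_n C n); first by apply: (sa_bigcup sO) => n; case: (hC n).
  apply/seteqP; split => p [n _ h]; exists n => //; have [_ E] := hC n.
    by move: h; rewrite E.
  by rewrite E.
Qed.

Lemma at_tau_opt A : opt F A -> at_tau A.
Proof. by move=> oA; exists [set x | A x.2] => //; exact: osplit_opt. Qed.

Section Good.
Variables (V : set (set (R * Om))) (E : set (R * Om)).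
Hypothesis V_sa : sigma_algebra setT V.

Lemma good_V A : V A -> good V E A.
Proof. by move=> VA; exists A; split => //; exact: qsT. Qed.

Lemma good_sa : sigma_algebra setT (good V E).
Proof.
split.
- exact: good_V (sa0 V_sa).
- move=> A [D [VD h]]; exists (~` D); split; first exact: saC.
  apply: qs_sub h => w h t t0 Et; rewrite setTD.
  by have := h t t0 Et; rewrite /setC/=; tauto.
- move=> A /choice[D hD]; exists (\bigcup_n D n); split.
    by apply: sa_bigcup => // n; case: (hD n).
  apply: (qs_sub _ (qs_all (fun n => (hD n).2))) => w h t t0 Et.
  by split=> -[n _ An]; exists n => //; have := h n t t0 Et; tauto.
Qed.

Lemma good_sub E' A : E' `<=` E -> good V E A -> good V E' A.
Proof.
move=> EE' [D [VD h]]; exists D; split => //; apply: qs_sub h => w h t t0 /EE'.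
exact: h.
Qed.

(** A representative of [A] on one piece is meaningless off that piece, so it is cut by a
    representative of the piece before the union is taken. *)
Lemma good_glue A (Ej : nat -> set (R * Om)) : E `<=` \bigcup_j Ej j ->
  (forall j, good V E (Ej j)) -> (forall j, good V (E `&` Ej j) A) -> good V E A.
Proof.
move=> EEj /choice[C hC] /choice[D hD]; exists (\bigcup_n (C n `&` D n)); split.
  by apply: sa_bigcup => // n; apply: saI => //; [case: (hC n)|case: (hD n)].
apply: (qs_sub _ (qs_and (qs_all (fun n => (hC n).2)) (qs_all (fun n => (hD n).2)))).
move=> w [hE hA] t t0 Et; split=> [Aw|[n _ [Cn Dn]]].
  have [n _ En] := EEj _ Et; exists n => //; split; first exact/(hE n t t0 Et).
  exact/(hA n t t0 (conj Et En)).
have /(hE n t t0 Et) En := Cn; exact/(hA n t t0 (conj Et En)).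
Qed.

(** Both the representable sets and, for a fixed [X], the Borel sets with representable preimage
    form sigma-algebras, so open half-lines suffice. *)
Lemma good_optional :
  (forall X, cadlag X -> (forall t : R, 0 <= t -> mf (G t) (X t)) ->
    forall c : R, good V E [set p | c < X p.1 p.2]) ->
  forall A, optional_sa G A -> good V E A.
Proof.
move=> hX A oA; suff : [set A | A `<=` timedom /\ good V E A] A by case.
move: A oA; apply: smallest_sub.
  have saG := good_sa; split.
  - by split => //; exact: sa0 saG.
  - move=> A [At gA]; split; first exact: subDsetl.
    have [D [VD h]] := gA; exists (~` D); split; first exact: saC.
    apply: qs_sub h => w h t t0 Et; have := h t t0 Et.
    by rewrite /setD/setC/timedom/=; tauto.
  - move=> A hA; split; first by apply: bigcup_sub => n _; case: (hA n).
    by apply: (sa_bigcup saG) => n; case: (hA n).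
move=> _ [X [B [cX aX mB ->]]]; split; first exact: subIsetl.
have saG := good_sa.
suff [D [VD h]] : good V E [set p | B (X p.1 p.2)].
  exists D; split => //; apply: qs_sub h => w h t t0 Et.
  by have := h t t0 Et; rewrite /timedom/=; tauto.
pose W := [set B : set R | good V E [set p | B (X p.1 p.2)]].
have saW : sigma_algebra setT W.
  split; first exact: sa0 saG.
  - by move=> C /(saC saG) hC; rewrite setTD.
  - by move=> C hC; exact: (sa_bigcup saG hC).
have {}mB : <<s @RGenOInfty.G R >> B.
  have h : (@ocitv R).-sigma.-measurable B := mB.
  by rewrite RGenOInfty.measurableE in h.
move: B mB; apply: (sa_gen saW) => _ [c ->].
rewrite /W/= (_ : [set p | _] = [set p | c < X p.1 p.2]); first exact: hX.
by apply/seteqP; split => p /=; rewrite in_itv/= andbT.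
Qed.

End Good.

(** After time [s], an event of [F s] is an optional set, an event on the minimum of [tau] and [s]
    is a function of [tau], and sets of [Ncal] are trivial; these generate a field containing
    [G q]. *)
Lemma G_repr (q s : R) A : 0 <= s -> q < s -> G q A ->
  good at_tau [set p | s < p.1] [set p | A p.2].
Proof.
move=> s0 qs; have saT1 := at_tau_sa.
pose V := [set A : set Om | good at_tau [set p | s < p.1] [set p | A p.2]].
have saV : sigma_algebra setT V.
  have [g0 gD gU] := good_sa [set p | s < p.1] saT1; split.
  - exact: g0.
  - by move=> B /gD; rewrite !setTD.
  - by move=> B hB; exact: (gU (fun n => [set p | B n p.2]) hB).
move: A; apply: (G_gen saV _ qs).
- move=> A /N_qs[h|h]; [exists set0|exists setT]; split; try exact: sa0; try exact: saT.
    by apply: qs_sub h => w h t _ _; split.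
  by apply: qs_sub h => w h t _ _; split.
- move=> A FA; exists [set p | s < p.1 /\ A p.2]; split.
    by apply: at_tau_opt; exact: opt_gt.
  by apply: qsT => w t _ /= st; tauto.
- move=> B mB; exists [set p | B (Order.min (tau p.2) s%:E)]; split.
    exists [set x | B (Order.min x.1 s%:E)] => //.
    have h := mine_preimage s mB; have := @osplit_fst R d Om F _ h.
    by apply.
  exact: qsT.
Qed.

(* [G] coincides with [F] where [tau] carries no information beyond time [t]. *)
Lemma G_trace (t : R) A (Ga : nat -> set Om) (c : nat -> \bar R) : 0 <= t ->
  (forall n w, Ga n w -> Order.min (tau w) (t + n.+1%:R^-1)%:E = c n) ->
  (forall n m w, (n <= m)%N -> Ga n w -> Ga m w) -> G t A ->
  exists B, F t B /\ qs (fun w => (exists n, Ga n w) -> (A w <-> B w)).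
Proof.
move=> t0 Gc Gm GA; pose s n : R := t + n.+1%:R^-1.
have ts n : t < s n by rewrite ltrDl invr_gt0.
have s0 n : 0 <= s n by rewrite (le_trans t0)// ltW.
(* On [Ga n] the minimum of [tau] and [s n] is the constant [c n], so the only events left there are
   those of [F (s n)]. *)
have step n : exists B, F (s n) B /\ qs (fun w => Ga n w -> (A w <-> B w)).
  have sF := F_sa (s0 n).
  pose V := [set A | exists B, F (s n) B /\ qs (fun w => Ga n w -> (A w <-> B w))].
  suff saV : sigma_algebra setT V.
    move: A GA; apply: (G_gen saV _ (ts n)).
    - move=> A /N_qs[h|h]; [exists set0|exists setT]; split; try exact: sa0; try exact: saT.
        by apply: qs_sub h => w h _; split.
      by apply: qs_sub h => w h _; split.
    - by move=> A FA; exists A; split => //; exact: qsT.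
    - move=> B mB; exists [set _ | B (c n)]; split; first exact: sa_cst.
      by apply: qsT => w /Gc /= ->.
  split.
  - by exists set0; split; [exact: sa0|exact: qsT].
  - move=> B [B' [FB' h]]; exists (~` B'); split; first exact: saC.
    apply: qs_sub h => w h Gw; rewrite setTD.
    by have := h Gw; rewrite /setC/=; tauto.
  - move=> B /choice[B' hB']; exists (\bigcup_n B' n); split.
      by apply: sa_bigcup => // k; case: (hB' k).
    apply: (qs_sub _ (qs_all (fun k => (hB' k).2))) => w h Gw.
    by split=> -[k _ Ak]; exists k => //; have := h k Gw; tauto.
have [B hB] := choice step.
(* The limsup of the [B n] depends on their tail alone, hence lies in [F u] for every [u > t]. On
   [Ga n] all [B k] with [k >= n] agree with [A], and so does the limsup. *)
exists [set w | forall m, exists n, (m <= n)%N /\ B n w]; split.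
  rewrite F_rc// => u /= tu; have u0 : 0 <= u by rewrite (le_trans t0)// ltW.
  have [n0 hn0] := ltr_add_invr tu.
  rewrite (_ : [set w | _] = [set w | forall m, exists n, (m + n0 <= n)%N /\ B n w]).
    have sF := F_sa u0; apply: sa_all => // m; apply: sa_ex => // n.
    apply: sa_and => // mn; have [FB _] := hB n; apply: F_mono FB => //.
    apply: le_trans (ltW hn0); rewrite lerD2l lef_pV2 ?posrE// ler_nat ltnS.
    exact: leq_trans (leq_addl _ _) mn.
  apply/seteqP; split => w h m; first by have [n hn] := h (m + n0)%N; exists n.
  by have [n [mn Bn]] := h m; exists n; split => //; exact: leq_trans (leq_addr _ _) mn.
apply: (qs_sub _ (qs_all (fun n => (hB n).2))) => w h [n Gn].
have hk k : (n <= k)%N -> (A w <-> B k w) by move=> nk; apply: h; exact: Gm Gn.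
split=> [Aw m|h']; last by have [k [nk Bk]] := h' n; apply/(hk k nk).
exists (maxn m n); split; first exact: leq_maxl.
by apply/(hk _ (leq_maxr _ _)).
Qed.

Lemma G_before (t : R) A : 0 <= t -> G t A ->
  exists B, F t B /\ qs (fun w => (t%:E < tau w)%E -> (A w <-> B w)).
Proof.
move=> t0 GA.
have [||B [FB h]] := @G_trace t A (fun n => [set w | ((t + n.+1%:R^-1)%:E <= tau w)%E])
    (fun n => (t + n.+1%:R^-1)%:E) t0 _ _ GA.
- by move=> n w /= h; rewrite min_r.
- move=> n m w nm /=; apply: le_trans; rewrite lee_fin lerD2l lef_pV2 ?posrE//.
  by rewrite ler_nat.
exists B; split => //; apply: qs_sub h => w h tw; apply: h.
move: tw; rewrite /=; case: (tau w) => [r| |//]; last by exists 0%N; rewrite leey.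
by rewrite lte_fin => /ltr_add_invr[n hn]; exists n; rewrite /= lee_fin ltW.
Qed.

(** For the time [0] on [{tau = 0}], which [from_pos tau] leaves out. *)
Lemma G_zero A : G 0 A -> exists B, F 0 B /\ qs (fun w => tau w = 0%E -> (A w <-> B w)).
Proof.
move=> GA.
have [||B [FB h]] := @G_trace 0 A (fun n => [set w | tau w = 0%E])
    (fun n => 0%E) (lexx _) _ _ GA => //.
- by move=> n w /= ->; rewrite min_l// lee_fin add0r.
exists B; split => //; apply: qs_sub h => w h tw; apply: h.
by exists 0%N.
Qed.

(** * Recovering level sets before [tau] from alternating crossings *)

Section Crossings.
Variables U L : nat * nat -> set Om.

(** Crossings alternate, starting with [U], at strictly increasing dyadic times strictly before [t];
    strictness makes the event known at time [t]. *)
Fixpoint cross (k : nat) (t : R) (w : Om) : Prop :=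
  if k is k'.+1 then exists u : nat * nat, dy R u < t /\
    (cross k' (dy R u) w /\ (if odd k' then L u w else U u w))
  else True.

(** The right-closed version of [cross]: the crossings are complete by [t] or immediately after it.
    This is the form needed to get a right-continuous indicator. *)
Definition zone k (t : R) w := forall u, t < dy R u -> cross k (dy R u) w.

Lemma cross_mono k (s t : R) w : s <= t -> cross k s w -> cross k t w.
Proof.
by case: k => [//|k] st [u [us h]]; exists u; split => //; exact: lt_le_trans st.
Qed.

Lemma cross_pred k (t : R) w : cross k.+1 t w -> cross k t w.
Proof. by move=> [u [ut [h _]]]; apply: cross_mono h; exact: ltW. Qed.

Lemma zone_pred k (t : R) w : zone k.+1 t w -> zone k t w.
Proof. by move=> h u tu; apply: cross_pred; exact: h. Qed.

Hypothesis FU : forall u, F (dy R u) (U u).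
Hypothesis FL : forall u, F (dy R u) (L u).

Lemma cross_F k (t : R) : 0 <= t -> F t (cross k t).
Proof.
elim: k t => [|k IH] t t0; first by apply: sa_cst; exact: F_sa.
have sa := F_sa t0; apply: sa_ex => // u; apply: sa_and => // ut.
apply: (F_mono (dy_ge0 R u) (ltW ut)).
apply: saI; [exact/F_sa/dy_ge0|exact/IH/dy_ge0|].
by case: (odd k); [exact: FL|exact: FU].
Qed.

Lemma zone_opt k : opt F [set p | zone k p.1 p.2].
Proof.
apply: opt_upset => //.
- move=> t t0; rewrite F_rc// => s /= ts.
  have s0 : 0 <= s by rewrite (le_trans t0)// ltW.
  rewrite (_ : zone k t = [set w | forall u, t < dy R u <= s -> cross k (dy R u) w]).
    have sa := F_sa s0; apply: sa_all => // u; apply: sa_imply => // /andP[_ us].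
    by apply: (F_mono (dy_ge0 R u) us); apply: cross_F; exact: dy_ge0.
  apply/seteqP; split => w h u; first by move=> /andP[tu _]; exact: h.
  move=> tu; have : t < Num.min (dy R u) s by rewrite lt_min tu.
  move=> /(dy_dense t0)[u' /andP[tu']]; rewrite lt_min => /andP[u'u u's].
  by apply: (@cross_mono _ (dy R u')); [exact: ltW|apply: h; rewrite tu'/= ltW].
- by move=> s t w st h u tu; apply: h; exact: le_lt_trans tu.
- move=> t w h u tu; apply: (h ((t + dy R u) / 2)); lra.
Qed.

Variables (x : R -> R) (w : Om) (a b : R).
Hypothesis x_rc : forall t, 0 <= t -> rc_at x t.
Hypothesis x_ll : forall t, 0 < t -> ll_at x t.
Hypothesis ab : a < b.
Hypothesis Ux : forall u, ((dy R u)%:E < tau w)%E -> (U u w <-> b < x (dy R u)).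
Hypothesis Lx : forall u, ((dy R u)%:E < tau w)%E -> (L u w <-> x (dy R u) < a).

Lemma dy_before (t t' : R) : 0 <= t -> (t%:E < tau w)%E -> t < t' ->
  exists u, [/\ t < dy R u, dy R u < t' & ((dy R u)%:E < tau w)%E].
Proof.
move=> t0 ttau tt'.
have [r tr rt] : exists2 r : R, t < r & (r%:E <= tau w)%E.
  case: (tau w) ttau => [r|_|//]; last by exists (t + 1); rewrite ?leey// ltrDl.
  by rewrite lte_fin => tr; exists r.
have : t < Num.min t' r by rewrite lt_min tt'.
move=> /(dy_dense t0)[u /andP[tu]]; rewrite lt_min => /andP[ut' ur].
by exists u; split => //; apply: lt_le_trans rt; rewrite lte_fin.
Qed.

Lemma zone_up k (t : R) : 0 <= t -> (t%:E < tau w)%E -> ~~ odd k -> zone k t w ->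
  b < x t -> zone k.+1 t w.
Proof.
move=> t0 ttau ok zk bt u tu; have r0 : 0 < x t - b by rewrite subr_gt0.
have [de de0 hd] := x_rc t0 r0.
have : t < Num.min (dy R u) (t + de) by rewrite lt_min tu ltrDl.
move=> /(dy_before t0 ttau)[u' [tu']]; rewrite lt_min => /andP[u'u u'd] u'tau.
exists u'; split => //; split; first exact: zk.
rewrite (negbTE ok); apply/Ux => //.
have : `|x (dy R u') - x t| < x t - b by apply: hd; rewrite (ltW tu') u'd.
by rewrite ltr_norml => /andP[]; lra.
Qed.

Lemma zone_down k (t : R) : 0 <= t -> (t%:E < tau w)%E -> odd k -> zone k t w ->
  x t < a -> zone k.+1 t w.
Proof.
move=> t0 ttau ok zk bt u tu; have r0 : 0 < a - x t by rewrite subr_gt0.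
have [de de0 hd] := x_rc t0 r0.
have : t < Num.min (dy R u) (t + de) by rewrite lt_min tu ltrDl.
move=> /(dy_before t0 ttau)[u' [tu']]; rewrite lt_min => /andP[u'u u'd] u'tau.
exists u'; split => //; split; first exact: zk.
rewrite ok; apply/Lx => //.
have : `|x (dy R u') - x t| < a - x t by apply: hd; rewrite (ltW tu') u'd.
by rewrite ltr_norml => /andP[]; lra.
Qed.

(** At the supremum [v] of the times reached with finitely many crossings, infinitely many crossings
    would occur in any neighbourhood of [v], against the right limit or the left limit there. *)
Lemma zone_finite (t : R) : 0 <= t -> (t%:E < tau w)%E -> ~ (forall k, zone k t w).
Proof.
move=> t0 ttau hz; pose D := [set s : R | 0 <= s /\ exists k, ~ cross k s w].
have D0 : D 0.
  by split => //; exists 1%N => -[u [u0 _]]; have := dy_ge0 R u; rewrite leNgt u0.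
have ubD : ubound D t.
  move=> s [s0 [k nc]]; rewrite leNgt; apply/negP => ts; apply: nc.
  have [u /andP[tu us]] := dy_dense t0 ts.
  by apply: (@cross_mono _ (dy R u)); [exact: ltW|exact: hz].
have hD : has_sup D by split; [exists 0|exists t].
pose v := sup D.
have v0 : 0 <= v by apply: sup_ubound; [exists t|].
have vt : v <= t by apply: ge_sup; [exists 0|].
have vtau : (v%:E < tau w)%E by apply: le_lt_trans ttau; rewrite lee_fin.
have e0 : 0 < (b - a) / 2 by rewrite divr_gt0// subr_gt0.
have [d1 d10 hd1] := x_rc v0 e0.
have [d2 [d20 [k0 nk0] hd2]] : exists d2, [/\ 0 < d2, exists k0, ~ cross k0 (v - d2) w &
    forall s, v - d2 < s < v -> forall s', v - d2 < s' < v -> 0 <= s -> 0 <= s' ->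
    `|x s - x s'| < b - a].
  have [vpos|vneg] := ltP 0 v.
    have [l hl] := x_ll vpos; have [d2 d20 hd2] := hl _ e0.
    exists d2; split => //.
      have [s [s0 [k nc]] vs] := sup_adherent d20 hD.
      by exists k => h; apply: nc; apply: cross_mono h; exact: ltW.
    move=> s hs s' hs' _ _; have y1 := hd2 _ hs; have y2 := hd2 _ hs'.
    have := ler_distD l (x s) (x s'); rewrite (distrC l); lra.
  exists 1; split => //; last by move=> s /andP[_ sv] s' _ s0; lra.
  exists 1%N => -[u [u0 _]]; have := dy_ge0 R u; lra.
have [u' [vu' u'd u'tau]] : exists u, [/\ v < dy R u, dy R u < v + d1 & ((dy R u)%:E < tau w)%E].
  by apply: dy_before => //; rewrite ltrDl.
have allc k : cross k (dy R u') w.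
  apply: contrapT => nc; have : D (dy R u') by split; [exact: dy_ge0|exists k].
  by move=> /(sup_ubound hD.2); rewrite -/v leNgt vu'.
(* Not all [k0] crossings are complete at [v - d2], so the last three of [k0.+3] occur after it. Two
   consecutive ones lie on the same side of [v], where the path oscillates by less than [b - a]. *)
have [u3 [u3u' [[u2 [u23 [[u1 [u12 [c1 h1]]] h2]]] h3]]] := allc k0.+3.
have gt1 : v - d2 < dy R u1.
  rewrite ltNge; apply/negP => h; apply: nk0; exact: cross_mono c1.
have t3 : ((dy R u3)%:E < tau w)%E by apply: lt_trans u'tau; rewrite lte_fin.
have t2 : ((dy R u2)%:E < tau w)%E by apply: lt_trans t3; rewrite lte_fin.
have t1 : ((dy R u1)%:E < tau w)%E by apply: lt_trans t2; rewrite lte_fin.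
have p1 := dy_ge0 R u1; have p2 := dy_ge0 R u2.
have j12 : b - a <= `|x (dy R u1) - x (dy R u2)|.
  move: h1 h2 => /=; case: (odd k0) => /=.
    move=> /(Lx t1) x1 /(Ux t2) x2; rewrite distrC (le_trans _ (ler_norm _))//; lra.
  by move=> /(Ux t1) x1 /(Lx t2) x2; rewrite (le_trans _ (ler_norm _))//; lra.
have j23 : b - a <= `|x (dy R u2) - x (dy R u3)|.
  move: h2 h3 => /=; case: (odd k0) => /=.
    by move=> /(Ux t2) x1 /(Lx t3) x2; rewrite (le_trans _ (ler_norm _))//; lra.
  by move=> /(Lx t2) x1 /(Ux t3) x2; rewrite distrC (le_trans _ (ler_norm _))//; lra.
have [u2v|vu2] := ltP (dy R u2) v.
  have : `|x (dy R u1) - x (dy R u2)| < b - a.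
    by apply: hd2 => //; apply/andP; split; lra.
  by lra.
have y2 : `|x (dy R u2) - x v| < (b - a) / 2 by apply: hd1; apply/andP; split; lra.
have y3 : `|x (dy R u3) - x v| < (b - a) / 2 by apply: hd1; apply/andP; split; lra.
have := ler_distD (x v) (x (dy R u2)) (x (dy R u3)); rewrite (distrC (x v)); lra.
Qed.

(** While the path is above [b], an even number of crossings is followed at once by one more. If
    every odd zone also led to the next even one, all zones would hold, against [zone_finite]. *)
Lemma zone_level (t : R) : 0 <= t -> (t%:E < tau w)%E -> b < x t ->
  exists k, zone k.*2.+1 t w /\ ~ zone k.*2.+2 t w.
Proof.
move=> t0 ttau bt; apply: contrapT => hn; apply: (zone_finite t0 ttau).
have he k : zone k.*2 t w.
  elim: k => [//|k IH]; rewrite doubleS; apply: contrapT => nz; apply: hn; exists k.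
  split => //; apply: zone_up => //; by rewrite odd_double.
move=> k; have := he k; rewrite -addnn; elim: {1}k => // j IH /zone_pred.
exact: IH.
Qed.

Lemma zone_level_ge k (t : R) : 0 <= t -> (t%:E < tau w)%E ->
  zone k.*2.+1 t w -> ~ zone k.*2.+2 t w -> a <= x t.
Proof.
move=> t0 ttau z1 z2; rewrite leNgt; apply/negP => xa; apply: z2.
by apply: zone_down => //=; rewrite odd_double.
Qed.

End Crossings.

Definition before_tau : set (R * Om) := [set p | (p.1%:E < tau p.2)%E].

Lemma good_before (X : R -> Om -> R) (c : R) : cadlag X ->
  (forall t : R, 0 <= t -> mf (G t) (X t)) ->
  good (opt F) before_tau [set p | c < X p.1 p.2].
Proof.
move=> /cadlagP[Xrc Xll] aX.
have hU (z : (nat * nat) * rat) : exists B, F (dy R z.1) B /\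
    qs (fun w => ((dy R z.1)%:E < tau w)%E -> (ratr z.2 < X (dy R z.1) w <-> B w)).
  apply: (@G_before (dy R z.1) [set w | ratr z.2 < X (dy R z.1) w]); first exact: dy_ge0.
  by apply: mf_lt; apply: aX; exact: dy_ge0.
have hL (z : (nat * nat) * rat) : exists B, F (dy R z.1) B /\
    qs (fun w => ((dy R z.1)%:E < tau w)%E -> (X (dy R z.1) w < ratr z.2 <-> B w)).
  apply: (@G_before (dy R z.1) [set w | X (dy R z.1) w < ratr z.2]); first exact: dy_ge0.
  by apply: mf_gt; apply: aX; exact: dy_ge0.
have [U hU'] := choice hU; have [L hL'] := choice hL.
pose UU b u := U (u, b); pose LL a u := L (u, a).
have FU b u : F (dy R u) (UU b u) by case: (hU' (u, b)).
have FL a u : F (dy R u) (LL a u) by case: (hL' (u, a)).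
have sO := @opt_sa R d Om F.
(* Between a crossing above [b] and the next one below [a] the path is at least [a > c]; conversely
   a value above [b] occurs only there. Rational pairs and counts [k] keep the union countable. *)
exists [set p | exists ab : rat * rat, (c < ratr ab.1 /\ ab.1 < ab.2) /\
  exists k, zone (UU ab.2) (LL ab.1) k.*2.+1 p.1 p.2 /\
    ~ zone (UU ab.2) (LL ab.1) k.*2.+2 p.1 p.2]; split.
  apply: sa_ex => // ab; apply: sa_and => // _; apply: sa_ex => // k.
  apply: (saI sO); first exact: (zone_opt (FU ab.2) (FL ab.1)).
  by apply: (saC sO); exact: (zone_opt (FU ab.2) (FL ab.1)).
apply: (qs_sub _ (qs_and (qs_all (fun z => (hU' z).2)) (qs_all (fun z => (hL' z).2)))).
move=> w [h1 h2] t t0 /= ttau.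
have Ux (b : rat) u : ((dy R u)%:E < tau w)%E -> (UU b u w <-> ratr b < X (dy R u) w).
  by move=> ut; apply: iff_sym; exact: (h1 (u, b)).
have Lx (a : rat) u : ((dy R u)%:E < tau w)%E -> (LL a u w <-> X (dy R u) w < ratr a).
  by move=> ut; apply: iff_sym; exact: (h2 (u, a)).
split=> [ct|[[a b] [[/= ca ab] [k [z1 z2]]]]].
  have [b] : exists q : rat, ratr q \in `]c, X t w[ by apply: rat_in_itvoo.
  rewrite in_itv => /= /andP[cb bX].
  have [a] : exists q : rat, ratr q \in `]c, (ratr b : R)[ by apply: rat_in_itvoo.
  rewrite in_itv => /= /andP[ca ab]; exists (a, b); rewrite /=; split.
    by split => //; rewrite -(ltr_rat R).
  apply: (@zone_level _ _ (X ^~ w) w (ratr a) (ratr b)) => //.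
  - by move=> s s0; exact: Xrc.
  - by move=> s s0; exact: Xll.
  - exact: Ux.
  - exact: Lx.
apply: (lt_le_trans ca).
apply: (@zone_level_ge (UU b) (LL a) (X ^~ w) w (ratr a) _ _ k) => //.
- by move=> s s0; exact: Xrc.
- exact: Lx.
Qed.

Lemma good_zero (X : R -> Om -> R) (c : R) :
  (forall t : R, 0 <= t -> mf (G t) (X t)) ->
  good at_tau [set p | p.1 = 0 /\ (tau p.2 <= p.1%:E)%E] [set p | c < X p.1 p.2].
Proof.
move=> aX; have [B [FB h]] := G_zero (@mf_lt _ _ _ _ c (aX 0 (lexx 0))).
exists [set p | p.1 = 0 /\ B p.2]; split; first by apply: at_tau_opt; exact: opt_time0.
apply: qs_sub h => w h t t0 /= [-> tau0].
have {}tau0 : tau w = 0%E by apply/eqP; rewrite eq_le tau0 tau_ge0.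
by have := h tau0; rewrite /=; tauto.
Qed.

(** [S < t] means [S <= u < v < t] for two dyadics; the gap between them is required by [G_repr],
    which represents events of [G] at [u] only after the later time [v]. *)
Lemma good_stopping_gt E (S : Om -> \bar R) : stopping_time G S ->
  good at_tau E [set p | (S p.2 < p.1%:E)%E].
Proof.
move=> [S0 GS]; have sT := at_tau_sa.
have hz (z : (nat * nat) * (nat * nat)) : exists D, dy R z.1 < dy R z.2 ->
    at_tau D /\ qs (fun w => forall t : R, dy R z.2 < t ->
      ((S w <= (dy R z.1)%:E)%E <-> D (t, w))).
  have [lt|nlt] := boolP (dy R z.1 < dy R z.2); last by exists set0.
  have [D [VD h]] := G_repr (dy_ge0 R z.2) lt (GS _ (dy_ge0 R z.1)).
  exists D => _; split => //; apply: qs_sub h => w h t zt.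
  by apply: h => //; rewrite (le_trans (dy_ge0 R z.2))// ltW.
have [D hD] := choice hz.
have hq z : qs (fun w => dy R z.1 < dy R z.2 -> forall t : R, dy R z.2 < t ->
    ((S w <= (dy R z.1)%:E)%E <-> D z (t, w))).
  have [lt|nlt] := boolP (dy R z.1 < dy R z.2); last exact: qsT.
  by have [_] := hD z lt; apply: qs_sub => w h _.
exists [set p | exists z, dy R z.1 < dy R z.2 /\ ((dy R z.2 < p.1 /\ setT p.2) /\ D z p)]; split.
  apply: sa_ex => // z; apply: sa_and => // lt; apply: (saI sT); last by case: (hD z lt).
  apply: at_tau_opt; apply: (opt_gt F_sa F_mono (dy_ge0 R z.2)).
  by apply: saT; exact/F_sa/dy_ge0.
apply: (qs_sub _ (qs_all hq)) => w h t t0 _ /=; split=> [St|[z [lt [[zt _] Dz]]]].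
  have [u [Su ut]] : exists u, (S w <= (dy R u)%:E)%E /\ dy R u < t.
    have S0w := S0 w; case: (S w) S0w St => // s; rewrite lee_fin lte_fin => s0 st.
    have [u /andP[su ut]] := dy_dense s0 st.
    by exists u; rewrite lee_fin ltW.
  have [v /andP[uv vt]] := dy_dense (dy_ge0 R u) ut.
  by exists (u, v); split => //; split => //; apply/(h (u, v) uv t).
apply: (@le_lt_trans _ _ (dy R z.1)%:E); first exact/(h z lt t).
by rewrite lte_fin (lt_trans lt).
Qed.

(** * Projections under one sH-measure *)

Section SplittingMeasure.
Local Notation Om' := (g_sigma_algebraType (Ginf Q F tau)).
Local Notation tau_le t := [set w | (tau w <= t%:E)%E].
Variables (S T : Om -> \bar R) (Q' : probability Om' R).
Hypothesis hS : stopping_time G S.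
Hypothesis hT : stopping_time F T.
Hypothesis hQ' : sH_measure Q' S T.

Lemma G_meas' (t : R) : 0 <= t -> G t `<=` @measurable _ Om'.
Proof. by move=> t0 A GA; apply: sub_sigma_algebra; exact: (G_Ginf t0). Qed.

Lemma null_Q' A : Ginf Q F tau A -> Q A = 0%E -> Q' A = 0%E.
Proof. by move=> GA; case: hQ' => /(_ A GA)[]. Qed.

Lemma nul_of_Q' A : Ginf Q F tau A -> Q' A = 0%E -> nul A.
Proof.
by move=> GA QA; apply: Ginf_nul => //; have [h _] := hQ'; apply/(h A GA).
Qed.

Lemma F_Ginf (t : R) : 0 <= t -> F t `<=` Ginf Q F tau.
Proof. by move=> t0 A FA; apply: (G_Ginf t0); exact: (F_G t0). Qed.

Lemma T_gt (t : R) : 0 <= t -> F t [set w | (t%:E < T w)%E].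
Proof.
move=> t0; rewrite (_ : [set w | _] = ~` [set w | (T w <= t%:E)%E]).
  by apply: saC; [exact: F_sa|case: hT => _; exact].
by apply/seteqP; split => w /=; rewrite ltNge => /negP.
Qed.

(** Up to [r] the martingale identity is the conditional probability, and past [r] the process is
    frozen at the indicator; the bounded process needs no localization, so [+oo] serves as
    localizing sequence. *)
Lemma cond_prob_loc_mart (r : R) (B : set Om) (X : R -> Om -> R) : 0 < r -> F r B ->
  cadlag_version Q F r B X -> local_martingale Q F X.
Proof.
move=> r0 FB [cX aX X01 Xr XE]; split => //; exists (fun _ _ => +oo%E); split => //.
- move=> n; split => // t t0; rewrite (_ : [set w | _] = set0); first exact: (sa0 (F_sa t0)).
  by apply/seteqP; split => w.
- exists set0; split => //.
  by move=> w _ t; exists 0%N; rewrite leey.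
move=> _; have -> : stop_at X (fun=> +oo%E) = X.
  by apply/funext => t; apply/funext => w; rewrite stop_at_ge// leey.
have bX (t : R) : 0 <= t -> bm (X t).
  by move=> t0; apply: (mf_bm01 (F_meas t0) (aX t t0)) => w; exact: X01.
split => // [t t0|s t s0 st A FA]; first exact/bm_integrable/bX.
have mB := F_meas (ltW r0) FB; have t0 := le_trans s0 st.
have mA := F_meas s0 FA.
have XA (u : R) : s <= u -> Ex Q (fun w => X u w * \1_A w) = Pr Q (A `&` B).
  move=> su; have u0 := le_trans s0 su; have [ur|ru] := leP u r.
    by apply: XE; [rewrite u0|exact: F_mono FA].
  rewrite -Ex_indic; last exact: measurableI.
  by apply: Ex_ext => w; rewrite Xr ?(ltW ru)// indicI/= mulrC.
have fin (u : R) : s <= u -> (\int[Q]_(w in A) (X u w)%:E = (Ex Q (fun w => X u w * \1_A w))%:E)%E.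
  move=> su; rewrite Ex_indic_integral// fineK//; apply: integrable_fin_num => //.
  by apply: (integrableS measurableT) => //; apply/bm_integrable/bX/(le_trans s0).
by rewrite !fin// !XA.
Qed.

(* A bounded [F]-martingale closed at time [r] by an event inside [{r < T}]
   vanishes on [[T, r]], so stopping it at [T] does not change its value at [r]. *)
Lemma stopped_terminal (r : R) (B : set Om) (X : R -> Om -> R) : 0 < r -> F r B ->
  (forall w, B w -> (r%:E < T w)%E) -> cadlag_version Q F r B X ->
  exists M, [/\ Ginf Q F tau M, Q M = 0%E &
    forall w, ~ M w -> stop_at X T r w = \1_B w].
Proof.
move=> r0 FB BT [cX aX X01 Xr XE].
pose A (u : nat * nat) := [set w | (T w <= (dy R u)%:E)%E].
have FA u : F (dy R u) (A u) by case: hT => _; apply; exact: dy_ge0.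
(* The outcomes where the martingale is still at least [1/(k+1)] at a dyadic time between [T] and
   [r]. They are null because [X] integrates over [{T <= u}] to the probability of its intersection
   with [B], which is empty. *)
pose M (z : (nat * nat) * nat) := [set w | dy R z.1 < r /\
  (A z.1 w /\ z.2.+1%:R^-1 <= X (dy R z.1) w)].
have FM z : F (dy R z.1) (M z).
  have sa := F_sa (dy_ge0 R z.1); apply: sa_and => // _; apply: saI => //.
  by apply: mf_le; apply: aX; exact: dy_ge0.
have M0 z : Q (M z) = 0%E.
  have [lt|nlt] := boolP (dy R z.1 < r); last first.
    rewrite (_ : M z = set0) ?measure0//; apply/seteqP; split => w // [lt _].
    by rewrite lt in nlt.
  have mM := F_meas (dy_ge0 R z.1) (FM z).
  have mA := F_meas (dy_ge0 R z.1) (FA z.1).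
  apply: Pr_eq0 => //; apply/eqP; rewrite eq_le Pr_ge0 andbT.
  have k0 : 0 < z.2.+1%:R^-1 :> R by rewrite invr_gt0.
  rewrite -(pmulr_rle0 _ k0) -Ex_indic// -ExZ; last exact: bm_indic.
  apply: (@le_trans _ _ (Ex Q (fun w => X (dy R z.1) w * \1_(A z.1) w))).
    apply: le_Ex.
    - by apply: bmM; [exact: bm_cst|exact: bm_indic].
    - apply: bmM; last exact: bm_indic.
      by apply: (mf_bm01 (F_meas (dy_ge0 R z.1)) (aX _ (dy_ge0 R z.1))) => w; exact/X01/dy_ge0.
    - move=> w; have /andP[x0 _] := X01 _ w (dy_ge0 R z.1).
      rewrite indicE; case: (boolP (w \in M z)) => [/set_mem [_ [Aw h]]|_].
        by rewrite mulr1 indicE mem_set// mulr1.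
      by rewrite mulr0 mulr_ge0// indicE.
  rewrite XE//; last by rewrite dy_ge0 ltW.
  rewrite (_ : A z.1 `&` B = set0) ?/Pr ?measure0//; apply/seteqP; split => w // [Aw Bw].
  have := lt_le_trans (BT w Bw) Aw; rewrite lte_fin => h.
  by have := lt_trans lt h; rewrite ltxx.
exists [set w | exists z, M z w]; split.
- apply: sa_ex; first exact: Ginf_sa.
  by move=> z; apply: (F_Ginf (dy_ge0 R z.1)); exact: FM.
- rewrite exists_bigcup; apply: null_bigcup => n; case: unpickle => [z|] //.
  exact: (F_meas (dy_ge0 R z.1) (FM z)).
move=> w nM; have T0 : (0 <= T w)%E by case: hT.
have [Tr|rT] := ltP (T w) r%:E; last by rewrite stop_at_ge// Xr.
rewrite stop_at_lt//.
have [t tE] : exists t, T w = t%:E.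
  by case: (T w) T0 Tr => [t| |]// _ _; exists t.
rewrite tE lte_fin in Tr; rewrite tE lee_fin in T0; rewrite tE /=.
have -> : \1_B w = 0 :> R.
  rewrite indicE memNset// => /BT; rewrite tE lte_fin => h.
  by have := lt_trans Tr h; rewrite ltxx.
have X0 u : t < dy R u < r -> X (dy R u) w = 0.
  move=> /andP[tu ur]; have /andP[x0 _] := X01 _ w (dy_ge0 R u).
  apply/eqP; rewrite eq_le x0 andbT leNgt; apply/negP => xpos.
  have [k] := ltr_add_invr xpos; rewrite add0r => hk.
  apply: nM; exists (u, k); split => //=; split; last exact: ltW.
  by rewrite /A/= tE lee_fin ltW.
apply/eqP; rewrite -normr_le0; apply/ler_addgt0Pr => e e0; rewrite add0r.
have /cadlagP[Xrc _] := cX; have [de de0 hd] := Xrc w t T0 e e0.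
have : t < Num.min (t + de) r by rewrite lt_min Tr ltrDl de0.
move=> /(dy_dense T0)[u /andP[tu]]; rewrite lt_min => /andP[ud ur].
have : `|X (dy R u) w - X t w| < e by apply: hd; rewrite (ltW tu) ud.
by rewrite X0 ?tu// sub0r normrN => /ltW.
Qed.

(** Over an event of [G s] inside [{S <= s < T}], the increment from [s] to [r] of the part of [X]
    on [(S, T]] is [\1_B - X s] almost surely. This part is bounded, hence a true martingale under
    [Q'], and the increment has mean zero. *)
Lemma projection (r : R) (B : set Om) : 0 < r -> F r B ->
  (forall w, B w -> (r%:E < T w)%E) ->
  exists X : R -> Om -> R, [/\ cadlag X, forall t : R, 0 <= t -> mf (F t) (X t),
    forall (t : R) w, 0 <= t -> 0 <= X t w <= 1 &
    forall (s : R) A, 0 <= s <= r -> G s A ->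
      A `<=` [set w | (S w <= s%:E)%E /\ (s%:E < T w)%E] ->
      Ex Q' (fun w => X s w * \1_A w) = Pr Q' (A `&` B)].
Proof.
move=> r0 FB BT.
have [X vX] := cadlag_version_exists F_sa F_meas F_mono F_rc F_null r0 FB.
have [cX aX X01 Xr XE] := vX; exists X; split => // s A /andP[s0 sr] GA AST.
have [M [GM QM hM]] := stopped_terminal r0 FB BT vX.
have lm := cond_prob_loc_mart r0 FB vX.
have [_ /(_ X lm) lm'] := hQ'.
set Z := (fun t w => _) in lm'.
have GS (t : R) : 0 <= t -> sigma_algebra setT (G t) by move=> _; exact: G_sa.
have stop01 (U : Om -> \bar R) (t : R) w : (0 <= U w)%E -> 0 <= t -> 0 <= stop_at X U t w <= 1.
  move=> U0 t0; rewrite /stop_at; case: ifP => _; last exact: X01.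
  by apply: X01; exact: fine_ge0.
have S0 w : (0 <= S w)%E by case: hS.
have T0 w : (0 <= T w)%E by case: hT.
have max0 w : (0 <= Order.max (S w) (T w))%E by rewrite le_max S0.
have ZC (t : R) w : 0 <= t -> `|Z t w| <= 1.
  move=> t0; have /andP[a0 a1] := stop01 S t w (S0 w) t0.
  have /andP[b0 b1] := stop01 (fun w => Order.max (S w) (T w)) t w
    (max0 w) t0.
  by rewrite /Z ler_norml; apply/andP; split; lra.
have mart := @bounded_loc_mart _ Om' R Q' G Z 1 GS G_meas' lm' ZC s r A s0 sr GA.
have mA : @measurable _ Om' A := G_meas' s0 GA.
have mM : @measurable _ Om' M by exact: sub_sigma_algebra.
have mB : @measurable _ Om' B by apply: sub_sigma_algebra; exact: (F_Ginf (ltW r0)).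
have QM' := null_Q' GM QM.
have bZ (t : R) : 0 <= t -> bm (Z t : Om' -> R).
  move=> t0; have [_ aZ _] := lm'.
  by apply: (@mf_bm _ Om' _ (G t) (G_meas' t0) (Z t) 1 (aZ t t0)) => w; exact: ZC.
have bX : bm (X s : Om' -> R).
  apply: (@mf_bm01 _ Om' _ (G s) (G_meas' s0)); last by move=> w; exact: X01.
  by apply: mf_sub (aX s s0); exact: (F_G s0).
have bA : bm (\1_A : Om' -> R) by exact: bm_indic.
have bB : bm (\1_B : Om' -> R) by exact: bm_indic.
have r0' := ltW r0.
(* On [A] the process stopped at [S] has the same value at [s] and at [r], so it cancels; the null
   set [M] is where the process stopped at [T] might miss the terminal value. *)
have key : Ex Q' (fun w => \1_B w * \1_A w - X s w * \1_A w) =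
    Ex Q' (fun w => Z r w * \1_A w - Z s w * \1_A w).
  apply: (@Ex_ae _ _ _ Q' _ _ M) => //.
  - by apply: bmB; apply: bmM.
  - by apply: bmB; apply: bmM => //; exact: bZ.
  move=> w nMw; rewrite [\1_A w]indicE; case: (boolP (w \in A)) => [/set_mem/AST[Ss sT]|_]; last by rewrite !mulr0.
  rewrite !mulr1 /Z.
  have ST : Order.max (S w) (T w) = T w by rewrite max_r// ltW// (le_lt_trans Ss).
  have -> : stop_at X (fun w => Order.max (S w) (T w)) r w = \1_B w.
    by rewrite /stop_at ST; exact: hM.
  have -> : stop_at X (fun w => Order.max (S w) (T w)) s w = X s w.
    by rewrite stop_at_ge//= ST ltW.
  suff -> : stop_at X S r w = stop_at X S s w by rewrite opprB addrA subrK.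
  move: Ss; rewrite le_eqVlt => /predU1P[SE|Ss].
    rewrite [RHS]stop_at_ge ?SE//; move: (sr); rewrite le_eqVlt => /predU1P[srE|{}sr].
      by rewrite -srE stop_at_ge// SE.
    by rewrite stop_at_lt ?SE ?lte_fin.
  by rewrite !stop_at_lt//; apply: lt_le_trans Ss _; rewrite lee_fin.
rewrite ExB in key; [|exact: bmM..]; rewrite ExB in key; [|by apply: bmM => //; exact: bZ..].
rewrite mart subrr in key.
have -> : Ex Q' (fun w => X s w * \1_A w) = Ex Q' (fun w => \1_B w * \1_A w).
  by apply/esym/eqP; rewrite -subr_eq0; exact/eqP.
rewrite -Ex_indic; last exact: measurableI.
by apply: Ex_ext => w; rewrite indicI/= mulrC.
Qed.

(** Processes [m(tau, t)]. Adaptedness is asked only on [{tau <= t}], where [tau] is known at time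
    [t]. *)
Definition split_proc (m : \bar R -> R * Om -> R) := [/\
  mf (osplit F) (fun x => m x.1 x.2),
  exists C : R, forall x (t : R) w, 0 <= t -> `|m x (t, w)| <= C,
  forall x w (t : R), 0 <= t -> rc_at (fun s => m x (s, w)) t &
  forall t : R, 0 <= t ->
    mf (G t) (fun w => \1_(tau_le t) w * m (tau w) (t, w))].

Lemma tau_le_G (t : R) : G t (tau_le t).
Proof.
rewrite (_ : tau_le t = [set w | (tau w <= t%:E)%E /\ [set: \bar R] (tau w)]).
  exact: tau_G.
by apply/seteqP; split => w /=; tauto.
Qed.

Lemma split_proc_cst (c : R) : split_proc (fun _ _ => c).
Proof.
have sO := @osplit_sa R d Om F; split.
- exact: mf_cst.
- by exists `|c|.
- by move=> x w t t0 r r0; exists 1 => // s _; rewrite subrr normr0.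
- move=> t t0; apply: mfM; [exact: G_sa| |exact: (mf_cst (G_sa t) c)].
  by apply: mf_indic; [exact: G_sa|exact: tau_le_G].
Qed.

Lemma split_procD m m' (c : R) : split_proc m -> split_proc m' ->
  split_proc (fun x p => m x p + c * m' x p).
Proof.
move=> [h1 [C hC] h3 h4] [h1' [C' hC'] h3' h4']; have sO := @osplit_sa R d Om F; split.
- by apply: mfD => //; apply: mfM => //; exact: mf_cst.
- exists (C + `|c| * C') => x t w t0; rewrite (le_trans (ler_normD _ _))// lerD//.
    exact: hC.
  by rewrite normrM ler_wpM2l//; exact: hC'.
- move=> x w t t0 r r0; pose r' := r / (2 * (`|c| + 1)).
  have c0 : 0 < `|c| + 1 by rewrite ltr_wpDl.
  have r'0 : 0 < r' by rewrite divr_gt0// mulr_gt0.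
  have r2 : 0 < r / 2 by rewrite divr_gt0.
  have [d1 d10 hd1] := h3 x w t t0 _ r2; have [d2 d20 hd2] := h3' x w t t0 _ r'0.
  exists (Num.min d1 d2); first by rewrite lt_min d10.
  move=> s /andP[ts]; rewrite -ltrBlDl lt_min => /andP[s1 s2].
  have y1 : `|m x (s, w) - m x (t, w)| < r / 2 by apply: hd1; rewrite ts/= -ltrBlDl.
  have y2 : `|m' x (s, w) - m' x (t, w)| < r' by apply: hd2; rewrite ts/= -ltrBlDl.
  rewrite (_ : _ - _ = (m x (s, w) - m x (t, w)) + c * (m' x (s, w) - m' x (t, w))); last by ring.
  rewrite (le_lt_trans (ler_normD _ _))// [ltRHS]splitr ltr_leD// normrM.
  apply: (@le_trans _ _ ((`|c| + 1) * r')).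
    by apply: ler_pM => //; [rewrite lerDl|exact: ltW].
  by rewrite /r' invfM mulrCA (mulrCA _ _ (_ ^-1)) divff ?gt_eqF// mulr1.
- move=> t t0; have sG := G_sa t.
  rewrite (_ : (fun w => _) = (fun w => \1_(tau_le t) w * m (tau w) (t, w) +
     c * (\1_(tau_le t) w * m' (tau w) (t, w)))).
    by apply: mfD => //; [exact: h4|apply: mfM => //; [exact: mf_cst|exact: h4']].
  by apply/funext => w; rewrite mulrDr mulrCA.
Qed.

Lemma split_proc_indic (H : set (\bar R)) (X : R -> Om -> R) : measurable H ->
  cadlag X -> (forall t : R, 0 <= t -> mf (F t) (X t)) ->
  (forall (t : R) w, 0 <= t -> 0 <= X t w <= 1) ->
  split_proc (fun x p => \1_H x * X p.1 p.2).
Proof.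
move=> mH cX aX X01; have sO := @osplit_sa R d Om F.
have /cadlagP[Xrc _] := cX.
have i01 x : `|\1_H x : R| <= 1.
  by rewrite indicE; case: (x \in H); rewrite ?normr1 ?normr0.
split.
- apply: mfM => //.
    rewrite (_ : (fun x => _) = \1_[set x | H x.1]); first by apply: mf_indic => //; exact: osplit_fst.
    by apply/funext => x; rewrite !indicE; congr (_%:R); congr nat_of_bool; apply/idP/idP => /set_mem h; exact: mem_set.
  by apply: (@osplit_fun_opt _ _ _ F (fun p => X p.1 p.2)); exact: opt_fun_cadlag.
- exists 1 => x t w t0; rewrite normrM -[leRHS]mulr1 ler_pM//=.
  by have /andP[? ?] := X01 t w t0; rewrite ger0_norm.
- move=> x w t t0 r r0; have [de de0 hd] := Xrc w t t0 r r0; exists de => // s hs /=.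
  rewrite -mulrBr normrM (le_lt_trans _ (hd s hs))//.
  by rewrite -[leRHS]mul1r ler_wpM2r.
- move=> t t0; have sG := G_sa t.
  rewrite (_ : (fun w => _) = (fun w => \1_[set w | (tau w <= t%:E)%E /\ H (tau w)] w * X t w)).
    apply: mfM => //; first by apply: mf_indic => //; exact: tau_G.
    by apply: mf_sub (aX t t0); exact: (F_G t0).
  apply/funext => w /=; rewrite mulrA; congr (_ * _).
  rewrite -[RHS]/(\1_((tau_le t) `&` [set w | H (tau w)]) w) indicI/=.
  by congr (_ * _); rewrite !indicE; congr (_%:R); congr nat_of_bool.
Qed.

Definition active (s : R) : set Om :=
  [set w | [/\ (S w <= s%:E)%E, (s%:E < T w)%E & (tau w <= s%:E)%E]].

Section Projections.
Variable q : R.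
Hypothesis q_ge0 : 0 <= q.

(** [m(tau, s)] acts as the conditional expectation of [eta] under [Q'] given [G s], tested only on
    events inside [active s]. *)
Definition projects (eta : Om -> R) m := [/\ bm (eta : Om' -> R), split_proc m &
  forall (s : R) A, 0 <= s <= q -> G s A -> A `<=` active s ->
    Ex Q' (fun w => eta w * \1_A w) = Ex Q' (fun w => m (tau w) (s, w) * \1_A w)].

(** Closure in [L^1(Q')] of the variables with an explicit projection. Each approximant keeps its
    own projection, so no limit of projections has to be shown to be of the form [m(tau, s)]. *)
Definition approx (eta : Om -> R) := bm (eta : Om' -> R) /\
  forall e : R, 0 < e -> exists eta' m, projects eta' m /\
    Ex Q' (fun w => `|eta w - eta' w|) <= e.

Lemma split_proc_bm m (s : R) A : split_proc m -> 0 <= s -> G s A -> A `<=` active s ->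
  bm (fun w : Om' => m (tau w) (s, w) * \1_A w).
Proof.
move=> [_ [C hC] _ h4] s0 GA Aa; have sG := G_sa s.
rewrite (_ : (fun w => _) = (fun w => (\1_(tau_le s) w * m (tau w) (s, w)) * \1_A w)).
  have C0 : 0 <= C by exact: le_trans (hC 0%E 0 point (lexx 0)).
  have i01 (B : set Om) x : `|\1_B x : R| <= 1.
    by rewrite indicE; case: (x \in B); rewrite ?normr1 ?normr0.
  apply: bmM; last by apply: bm_indic; exact: (G_meas' s0).
  apply: (@mf_bm _ Om' _ (G s) (G_meas' s0) _ C (h4 s s0)) => w.
  by rewrite normrM -[leRHS]mul1r ler_pM//; exact: hC.
apply/funext => w; rewrite [\1_A w]indicE; case: (boolP (w \in A)) => [/set_mem/Aa[_ _ h]|_].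
  by rewrite indicE mem_set// mul1r.
by rewrite !mulr0.
Qed.

Lemma projectsD eta eta' m m' (c : R) : projects eta m -> projects eta' m' ->
  projects (fun w => eta w + c * eta' w) (fun x p => m x p + c * m' x p).
Proof.
move=> [b1 s1 h1] [b2 s2 h2]; split.
- by apply: bmD => //; apply: bmM => //; exact: bm_cst.
- exact: split_procD.
move=> s A sq GA Aa; have /andP[s0 _] := sq.
have bA : bm (\1_A : Om' -> R) by apply: bm_indic; exact: (G_meas' s0).
have E (f g : Om' -> R) : bm (fun w => f w * \1_A w) -> bm (fun w => g w * \1_A w) ->
    Ex Q' (fun w => (f w + c * g w) * \1_A w) =
    Ex Q' (fun w => f w * \1_A w) + c * Ex Q' (fun w => g w * \1_A w).
  move=> bf bg; rewrite -ExZ// -ExD//; last by apply: bmM => //; exact: bm_cst.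
  by apply: Ex_ext => w; rewrite mulrDl mulrA.
rewrite E; [|exact: bmM..]; rewrite (E (fun w => m (tau w) (s, w)) (fun w => m' (tau w) (s, w))).
- by rewrite (h1 s A)// (h2 s A).
- exact: split_proc_bm.
- exact: split_proc_bm.
Qed.

Lemma approx_projects eta m : projects eta m -> approx eta.
Proof.
move=> pe; have [be _ _] := pe; split => // e e0; exists eta, m; split => //.
by rewrite (_ : Ex _ _ = 0) ?ltW// -[RHS](Ex_cst Q' 0); apply: Ex_ext => w; rewrite subrr normr0.
Qed.

Lemma approx_lim eta : bm (eta : Om' -> R) ->
  (forall e : R, 0 < e -> exists eta', approx eta' /\
    Ex Q' (fun w => `|eta w - eta' w|) <= e) -> approx eta.
Proof.
move=> be h; split => // e e0; have e2 : 0 < e / 2 by rewrite divr_gt0.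
have [eta1 [[b1 a1] h1]] := h _ e2; have [eta2 [m [p2 h2]]] := a1 _ e2.
exists eta2, m; split => //; have [b2 _ _] := p2.
apply: (@le_trans _ _ (Ex Q' (fun w => `|eta w - eta1 w| + `|eta1 w - eta2 w|))).
  apply: le_Ex; [by apply: bm_norm; exact: bmB|by apply: bmD; apply: bm_norm; exact: bmB|].
  move=> w; rewrite (_ : eta w - eta2 w = (eta w - eta1 w) + (eta1 w - eta2 w)); last by ring.
  exact: ler_normD.
by rewrite ExD; [lra|apply: bm_norm; exact: bmB..].
Qed.

Lemma approxD eta eta' (c : R) : approx eta -> approx eta' ->
  approx (fun w => eta w + c * eta' w).
Proof.
move=> [b1 a1] [b2 a2]; split; first by apply: bmD => //; apply: bmM => //; exact: bm_cst.
move=> e e0; have e2 : 0 < e / 2 by rewrite divr_gt0.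
have c0 : 0 < `|c| + 1 by rewrite ltr_wpDl.
have e3 : 0 < e / 2 / (`|c| + 1) by rewrite divr_gt0.
have [f1 [m1 [p1 h1]]] := a1 _ e2; have [f2 [m2 [p2 h2]]] := a2 _ e3.
exists (fun w => f1 w + c * f2 w), (fun x p => m1 x p + c * m2 x p).
split; first exact: projectsD.
have [d1 _ _] := p1; have [d2 _ _] := p2.
have n1 : bm (fun w : Om' => `|eta w - f1 w|) by apply: bm_norm; exact: bmB.
have n2 : bm (fun w : Om' => `|eta' w - f2 w|) by apply: bm_norm; exact: bmB.
have n3 : bm (fun w : Om' => `|c| * `|eta' w - f2 w|) by apply: bmM => //; exact: bm_cst.
apply: (@le_trans _ _ (Ex Q' (fun w => `|eta w - f1 w| + `|c| * `|eta' w - f2 w|))).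
  apply: le_Ex.
  - apply: bm_norm; apply: bmB; apply: bmD => //; apply: bmM => //; exact: bm_cst.
  - exact: bmD.
  - move=> w; rewrite (_ : _ - _ = (eta w - f1 w) + c * (eta' w - f2 w)); last by ring.
    by rewrite (le_trans (ler_normD _ _))// normrM.
rewrite ExD// ExZ// [leRHS]splitr lerD//.
apply: (@le_trans _ _ ((`|c| + 1) * (e / 2 / (`|c| + 1)))).
  by apply: ler_pM => //; [exact: Ex_ge0|rewrite lerDl].
by rewrite mulrC divfK// gt_eqF.
Qed.

Lemma approx_ae eta eta' M : bm (eta : Om' -> R) -> approx eta' ->
  @measurable _ Om' M -> Q' M = 0%E -> (forall w, ~ M w -> eta w = eta' w) -> approx eta.
Proof.
move=> be ae mM M0 h; apply: approx_lim => // e e0; exists eta'; split => //.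
have [b' _] := ae; rewrite (_ : Ex _ _ = 0) ?ltW// -[RHS](Ex_cst Q' 0).
apply: (@Ex_ae _ _ _ Q' _ _ M) => //; [by apply: bm_norm; exact: bmB|exact: bm_cst|].
by move=> w /h ->; rewrite subrr normr0.
Qed.

Lemma approx0 : approx (fun=> 0).
Proof.
apply: (@approx_projects _ (fun _ _ => 0)); split.
- exact: bm_cst.
- exact: split_proc_cst.
- by move=> s A _ _ _.
Qed.

Lemma approx_nondecreasing (A : nat -> set Om) :
  (forall n, @measurable _ Om' (A n)) -> (forall n, A n `<=` A n.+1) ->
  (forall n, approx \1_(A n)) -> approx \1_(\bigcup_n A n).
Proof.
move=> mA hA aA; have mU : @measurable _ Om' (\bigcup_n A n) by exact: bigcupT_measurable.
apply: approx_lim => [|e e0]; first exact: bm_indic.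
have [n hn] := Pr_nondecreasing Q' e0 mA hA; exists \1_(A n); split => //.
rewrite (_ : Ex _ _ = Pr Q' ((\bigcup_n A n) `\` A n)).
  rewrite PrD//; first by rewrite lerBlDr addrC.
  exact: bigcup_sup.
rewrite -Ex_indic; last exact: measurableD.
apply: Ex_ext => w; rewrite !indicE in_setD.
have [An|nAn] := boolP (w \in A n).
  rewrite (_ : w \in _) ?subrr ?normr0//; apply: mem_set; exists n => //.
  exact: set_mem.
by rewrite subr0 andbT; case: (w \in _); rewrite ?normr1 ?normr0.
Qed.

Section Level.
Variable r : R.
Hypothesis qr : q < r.
Local Notation Rr := [set w | (r%:E < T w)%E].

Let r_gt0 : 0 < r. Proof. exact: le_lt_trans q_ge0 qr. Qed.

Lemma Rr_meas : @measurable _ Om' Rr.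
Proof. by apply: sub_sigma_algebra; apply: (F_Ginf (ltW r_gt0)); apply: T_gt; exact: ltW. Qed.

(** A pi-system whose generated sigma-algebra contains [G q], since [q < r]. *)
Definition rectangles : set (set Om) := [set A | exists H B C,
  [/\ measurable H, F r B, Ncal Q F tau C & A = [set w | H (tau w)] `&` B `&` C]].

Lemma rectangles_setI : setI_closed rectangles.
Proof.
move=> _ _ [H [B [C [mH FB NC ->]]]] [H' [B' [C' [mH' FB' NC' ->]]]].
exists (H `&` H'), (B `&` B'), (C `&` C'); split.
- exact: measurableI.
- by apply: saI => //; exact: (F_sa (ltW r_gt0)).
- exact: (saI (sa_g _)).
- by apply/seteqP; split => w /=; tauto.
Qed.

Lemma tau_Ginf (H : set (\bar R)) : measurable H -> @measurable _ Om' [set w | H (tau w)].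
Proof.
move=> mH.
pose A n := [set w | (tau w <= n%:R%:E)%E /\ H (tau w)].
have mA n : @measurable _ Om' (A n) by apply: (G_meas' (ler0n R n)); exact: tau_G.
have mT n : @measurable _ Om' (tau_le n%:R).
  by apply: (G_meas' (ler0n R n)); exact: tau_le_G.
rewrite (_ : [set w | _] = \bigcup_n A n `|` (~` (\bigcup_n (tau_le n%:R)) `&`
    [set w | H +oo%E])).
  apply: measurableU; first exact: bigcupT_measurable.
  apply: measurableI; first by apply: measurableC; exact: bigcupT_measurable.
  by apply: (sa_cst (@measurable_sa _ Om')).
have fin w : tau w <> +oo%E -> exists n, (tau w <= n%:R%:E)%E.
  have := tau_ge0 w; case: (tau w) => // x x0 _; exists (Num.trunc x).+1.
  by rewrite lee_fin ltW// truncnS_gt.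
apply/seteqP; split => w /=.
  move=> Hw; have [too|/fin[n hn]] := pselect (tau w = +oo%E); last by left; exists n.
  right; split; last by rewrite -too.
  by move=> [n _] /=; rewrite too.
move=> [[n _ []]//|[nw Hoo]]; have [->//|/fin[n hn]] := pselect (tau w = +oo%E).
by exfalso; apply: nw; exists n.
Qed.

(** The factor [C] is trivial up to a null set. The projection of [B] restricted to [{r < T}] is
    multiplied by [\1_H(tau)], which may be moved into the test event. *)
Lemma approx_rectangle A : rectangles A -> approx \1_(A `&` Rr).
Proof.
move=> [H [B [C [mH FB NC ->]]]].
have mR := Rr_meas; have mtH := tau_Ginf mH.
have mB : @measurable _ Om' B by apply: sub_sigma_algebra; exact: (F_Ginf (ltW r_gt0)).
have mC : @measurable _ Om' C.
  by apply: (G_meas' (lexx 0)); exact: N_G.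
have b1 : bm (\1_([set w | H (tau w)] `&` B `&` C `&` Rr) : Om' -> R).
  by apply: bm_indic; do 3 apply: measurableI => //.
have [M [KM QM CM]] := N_dichotomy NC.
have GM : Ginf Q F tau M.
  by apply: (G_Ginf (lexx 0)); apply: N_G; case: (nul_KK KM QM).
have mM : @measurable _ Om' M by exact: sub_sigma_algebra.
have QM' := null_Q' GM QM.
case: CM => CM.
  apply: (@approx_ae _ _ M b1 approx0 mM QM') => w nM.
  by rewrite indicE memNset// => -[[_ /CM]].
have FBR : F r (B `&` Rr).
  by apply: saI => //; [exact: (F_sa (ltW r_gt0))|apply: T_gt; exact: ltW].
have [X [cX aX X01 hX]] := projection r_gt0 FBR (fun w h => h.2).
have b2 : bm (\1_([set w | H (tau w)] `&` (B `&` Rr)) : Om' -> R).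
  by apply: bm_indic; do 2 apply: measurableI => //.
apply: (@approx_ae _ (\1_([set w | H (tau w)] `&` (B `&` Rr))) M b1 _ mM QM').
  apply: (@approx_projects _ (fun x p => \1_H x * X p.1 p.2)); split => //.
    exact: split_proc_indic.
  move=> s D /andP[s0 sq] GA Aa; have sG := G_sa s.
  (* Test events lie in [{tau <= s}], where the value of [tau] is known at time [s]; so cutting by
     [{tau \in H}] stays inside [G s]. *)
  have AE : D `&` [set w | H (tau w)] = D `&` [set w | (tau w <= s%:E)%E /\ H (tau w)].
    by apply/seteqP; split => w /= [Aw]; [move=> Hw; have [_ _ h] := Aa w Aw|move=> []].
  have GA' : G s (D `&` [set w | H (tau w)]).
    by rewrite AE; apply: (saI sG) => //; exact: tau_G.
  have Es : Ex Q' (fun w => X s w * \1_(D `&` [set w | H (tau w)]) w) =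
      Pr Q' ((D `&` [set w | H (tau w)]) `&` (B `&` Rr)).
    apply: hX => //; first by rewrite s0 (le_trans sq)// ltW.
    by move=> w [/Aa[h1 h2 _] _].
  have mA : @measurable _ Om' D := G_meas' s0 GA.
  transitivity (Pr Q' ((D `&` [set w | H (tau w)]) `&` (B `&` Rr))).
    rewrite -Ex_indic; last by do 2 apply: measurableI => //.
    apply: Ex_ext => w; rewrite (_ : D `&` _ `&` _ = ([set w | H (tau w)] `&` (B `&` Rr)) `&` D).
      by rewrite [RHS]indic_setI.
    by rewrite -setIA setIC.
  rewrite -Es; apply: Ex_ext => w; rewrite indicI/=.
  have -> : \1_[set w | H (tau w)] w = \1_H (tau w) :> R.
    by rewrite !indicE; congr (_%:R); congr nat_of_bool; apply/idP/idP => /set_mem h; exact: mem_set.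
  by rewrite mulrC -mulrA mulrC.
move=> w nM; rewrite !indicE; congr (_%:R); congr nat_of_bool.
have Cw : C w by apply: contrapT => /CM.
apply/idP/idP => /set_mem h; apply: mem_set; move: h => /=; tauto.
Qed.

Lemma rectangles_meas A : <<s rectangles >> A -> @measurable _ Om' A.
Proof.
apply: (sa_gen (@measurable_sa _ Om')) => _ [H [B [C [mH FB NC ->]]]].
apply: measurableI; last by apply: (G_meas' (lexx 0)); exact: N_G.
apply: measurableI; first exact: tau_Ginf.
by apply: sub_sigma_algebra; exact: (F_Ginf (ltW r_gt0)).
Qed.

(** A Dynkin class argument carried out inside [{r < T}]: complements are taken relative to that
    event, because projections are available only there. *)
Lemma approx_rect_sigma A : <<s rectangles >> A -> approx \1_(A `&` Rr).
Proof.
have mR := Rr_meas; have saF := F_sa (ltW r_gt0).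
have rT : rectangles setT.
  exists setT, setT, setT; split => //; [exact: saT saF|exact: (saT (sa_g _))|].
  by apply/seteqP; split.
have aR : approx \1_Rr by have := approx_rectangle rT; rewrite setTI.
pose D := [set A | @measurable _ Om' A /\ approx \1_(A `&` Rr)].
suff : <<s rectangles >> `<=` D by move=> h /h[].
rewrite -(setI_closed_g_dynkin_g_sigma_algebra rectangles_setI).
apply: smallest_sub; last first.
  by move=> B rB; split; [apply: rectangles_meas; exact: sub_sigma_algebra|exact: approx_rectangle].
split.
- by split; [exact: measurableT|rewrite setTI].
- move=> B [mB aB]; split; first exact: measurableC.
  have := approxD (-1) aR aB; congr approx; apply/funext => w.
  rewrite mulN1r !indicE in_setI [in RHS]in_setI in_setC.
  by case: (w \in B); case: (w \in Rr); rewrite /= ?subrr ?subr0.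
move=> B tB hB; split; first by apply: bigcupT_measurable => n; case: (hB n).
pose C n := \big[setU/set0]_(i < n) B i.
have mB n : @measurable _ Om' (B n) by case: (hB n).
have mC n : @measurable _ Om' (C n) by apply: bigsetU_measurable => i _; exact: mB.
have aC n : approx \1_(C n `&` Rr).
  elim: n => [|n IH].
    by rewrite /C big_ord0 set0I indic0; exact: approx0.
  have [_ aB] := hB n; have := approxD 1 IH aB; congr approx; apply/funext => w.
  rewrite mul1r /C big_ord_recr/= -/(C n) !indicE !in_setI in_setU.
  have : ~~ ((w \in C n) && (w \in B n)).
    apply/negP => /andP[/set_mem Cw /set_mem Bw].
    move: Cw; rewrite /C -bigcup_mkord => -[i /= ni Bi].
    have iE : i = n by apply: tB => //; exists w.
    by move: ni; rewrite iE ltnn.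
  by case: (w \in C n); case: (w \in B n); case: (w \in Rr) => //= _; rewrite ?addr0 ?add0r.
have -> : (\bigcup_n B n) `&` Rr = \bigcup_n (C n `&` Rr).
  rewrite -setI_bigcupl; congr (_ `&` _); apply/seteqP; split => w [n _ h].
    by exists n.+1 => //; rewrite /C big_ord_recr; right.
  by move: h; rewrite /C -bigcup_mkord => -[i _ Bi]; exists i.
apply: approx_nondecreasing => // n; first exact: measurableI.
by apply: setSI; rewrite /C big_ord_recr; exact: subsetUl.
Qed.

Lemma approx_G_gt A : G q A -> approx \1_(A `&` Rr).
Proof.
move=> GA; apply: approx_rect_sigma; move: A GA.
have saF := F_sa (ltW r_gt0).
apply: (G_gen (sa_g _) _ qr).
- move=> A NA; apply: sub_sigma_algebra; exists setT, setT, A; split => //; first exact: saT saF.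
  by apply/seteqP; split => w /=; tauto.
- move=> A FA; apply: sub_sigma_algebra; exists setT, A, setT; split => //.
    exact: (saT (sa_g _)).
  by apply/seteqP; split => w /=; tauto.
- move=> B mB; apply: sub_sigma_algebra; exists [set x | B (Order.min x r%:E)], setT, setT.
  split; [exact: mine_preimage|exact: saT saF|exact: (saT (sa_g _))|].
  by apply/seteqP; split => w /=; tauto.
Qed.

End Level.

(** The intermediate time [r > q] is removed by letting [r] decrease to [q], since [{q < T}] is the
    increasing union of the events [{r < T}]. *)
Lemma approx_G A : G q A -> approx \1_(A `&` [set w | (q%:E < T w)%E]).
Proof.
move=> GA; have mA : @measurable _ Om' A := G_meas' q_ge0 GA.
pose r n : R := q + n.+1%:R^-1.
have qr n : q < r n by rewrite ltrDl invr_gt0.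
have -> : A `&` [set w | (q%:E < T w)%E] = \bigcup_n (A `&` [set w | ((r n)%:E < T w)%E]).
  rewrite -setI_bigcupr; congr (_ `&` _); apply/seteqP; split => w /=.
    move=> qT; suff [n hn] : exists n, ((r n)%:E < T w)%E by exists n.
    case: (T w) qT => [t| |//]; last by exists 0%N; rewrite ltry.
    by rewrite lte_fin => /ltr_add_invr[n hn]; exists n; rewrite lte_fin.
  by move=> [n _ /=]; apply: lt_trans; rewrite lte_fin.
apply: approx_nondecreasing.
- by move=> n; apply: measurableI => //; exact: Rr_meas.
- move=> n; apply: setIS => w /=; apply: le_lt_trans; rewrite lee_fin lerD2l.
  by rewrite lef_pV2 ?posrE// ler_nat.
- by move=> n; exact: approx_G_gt.
Qed.

Lemma approx_fun (eta : Om -> R) (C : R) : mf (G q) eta -> (forall w, `|eta w| <= C) ->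
  (forall w, (T w <= q%:E)%E -> eta w = 0) -> approx eta.
Proof.
move=> me hC e0; set W := [set w | (q%:E < T w)%E].
have be : bm (eta : Om' -> R) by exact: (@mf_bm _ Om' _ (G q) (G_meas' q_ge0) _ C me hC).
have eW w : eta w = eta w * \1_W w.
  rewrite indicE; case: (boolP (w \in W)) => [_|nW]; first by rewrite mulr1.
  rewrite mulr0 e0// leNgt; apply/negP => h; move/negP: nW; apply; exact: mem_set.
have sG := G_sa q.
have mW : @measurable _ Om' W.
  by apply: sub_sigma_algebra; apply: (F_Ginf q_ge0); exact: T_gt.
have aW : approx \1_W by have := approx_G (saT sG); rewrite setTI.
apply: approx_lim => // e e_gt0.
have [c|f A c||s [bs as_] hs] := @simple_approx Om R (G q)
    (fun f => bm (f : Om' -> R) /\ approx (fun w => f w * \1_W w)) eta e sG _ _ me _ e_gt0.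
- split; first exact: bm_cst.
  have := approxD c approx0 aW; congr approx; apply/funext => w; by rewrite add0r.
- move=> [bf af] GA; split.
    apply: bmD => //; apply: bmM; first exact: bm_cst.
    by apply: bm_indic; exact: (G_meas' q_ge0).
  have := approxD c af (approx_G GA); congr approx; apply/funext => w.
  by rewrite indicI/= mulrDl mulrA.
- by exists C.
exists (fun w => s w * \1_W w); split => //; rewrite -[leRHS](Ex_cst Q').
have bsW : bm (fun w : Om' => s w * \1_W w) by apply: bmM => //; exact: bm_indic.
apply: le_Ex; [by apply: bm_norm; exact: bmB|exact: bm_cst|move=> w].
rewrite {1}eW -mulrBl normrM indicE; case: (w \in W); rewrite ?normr1 ?normr0 ?mulr1 ?mulr0//.
exact: ltW.
Qed.

End Projections.

(** The section at time [t] of [(S, T)] intersected with [[tau, oo)]. The strict bound by [T] makes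
    it right-open, as the comparison of right-continuous paths requires. *)
Definition live (t : R) : set Om :=
  [set w | 0 < t /\ [/\ (S w < t%:E)%E, (t%:E < T w)%E & (tau w <= t%:E)%E]].

Lemma live_active (t : R) : live t `<=` active t.
Proof. by move=> w [_ [h1 h2 h3]]; split => //; exact: ltW. Qed.

Lemma S_lt_G (t : R) : 0 <= t -> G t [set w | (S w < t%:E)%E].
Proof.
move=> t0; have sG := G_sa t; have [S0 GS] := hS.
rewrite (_ : [set w | _] = [set w | exists u, dy R u < t /\ (S w <= (dy R u)%:E)%E]).
  apply: (sa_ex sG) => u; apply: (sa_and sG) => ut.
  by apply: (G_mono (ltW ut)); apply: GS; exact: dy_ge0.
apply/seteqP; split => w /=; last first.
  by move=> [u [ut Su]]; apply: le_lt_trans Su _; rewrite lte_fin.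
have := S0 w; case: (S w) => // s; rewrite lee_fin lte_fin => s0 st.
by have [u /andP[su ut]] := dy_dense s0 st; exists u; rewrite lee_fin (ltW su).
Qed.

Lemma live_G (t : R) : 0 <= t -> G t (live t).
Proof.
move=> t0; have sG := G_sa t; apply: (sa_and sG) => _.
rewrite (_ : (fun x => _) = [set w | (S w < t%:E)%E] `&` [set w | (t%:E < T w)%E] `&`
    (tau_le t)); last first.
  by apply/seteqP; split => w /= => [[]|[[]]].
apply: (saI sG); last exact: tau_le_G.
apply: (saI sG); first exact: S_lt_G.
by apply: (F_G t0); exact: T_gt.
Qed.

Lemma live_open w (t : R) : live t w ->
  exists2 de : R, 0 < de & forall s : R, t <= s < t + de -> live s w.
Proof.
move=> [t0 [St tT taut]].
have [de de0 hd] : exists2 de : R, 0 < de & ((t + de)%:E <= T w)%E.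
  case: (T w) tT => [r| |//]; last by exists 1 => //; rewrite leey.
  by rewrite lte_fin => tr; exists (r - t); rewrite ?subr_gt0// addrC subrK.
exists de => // s /andP[ts sd]; split; first exact: lt_le_trans ts.
split; first by apply: lt_le_trans St _; rewrite lee_fin.
  by apply: lt_le_trans hd; rewrite lte_fin.
by apply: le_trans taut _; rewrite lee_fin.
Qed.

(** * Approximating a cadlag process by projections of its next dyadic values *)

Section CadlagApproximation.
Variables (Y : R -> Om -> R) (L : R).
Hypothesis L_gt0 : 0 < L.
Hypothesis Yrc : forall w (t : R), 0 <= t -> rc_at (Y ^~ w) t.
Hypothesis Yll : forall w (t : R), 0 < t -> ll_at (Y ^~ w) t.
Hypothesis Y_mf : forall t : R, 0 <= t -> mf (G t) (Y t).
Hypothesis Y_bound : forall (t : R) w, `|Y t w| <= L.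
Hypothesis Y_T : forall (t : R) w, (T w <= t%:E)%E -> Y t w = 0.

Definition endpoint (z : nat * nat) : R := dy R (z.2.+1, z.1).

(** At level [m] there are [m * 2 ^ m] cells before time [m]; the tolerance per cell is chosen so
    that the errors of one level add up to at most [2^-m]. *)
Lemma approx_family : exists eta pm, forall z : nat * nat,
  projects (endpoint z) (eta z) (pm z) /\
  Ex Q' (fun w => `|Y (endpoint z) w - eta z w|) <=
    (2 ^+ z.1)^-1 / (z.1 * 2 ^ z.1).+1%:R.
Proof.
have h z : exists x : (Om -> R) * (\bar R -> R * Om -> R),
    projects (endpoint z) x.1 x.2 /\ Ex Q' (fun w => `|Y (endpoint z) w - x.1 w|) <=
    (2 ^+ z.1)^-1 / (z.1 * 2 ^ z.1).+1%:R.
  have z0 : 0 <= endpoint z by exact: dy_ge0.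
  have [_ a] := approx_fun z0 (Y_mf z0) (Y_bound (endpoint z)) (Y_T (t := endpoint z)).
  have e0 : 0 < (2 ^+ z.1)^-1 / (z.1 * 2 ^ z.1).+1%:R :> R.
    by rewrite divr_gt0// invr_gt0 exprn_gt0.
  by have [eta [m hm]] := a _ e0; exists (eta, m).
have [x hx] := choice h; exists (fun z => (x z).1), (fun z => (x z).2); exact: hx.
Qed.

Section WithFamily.
Variables (eta : nat * nat -> Om -> R) (pm : nat * nat -> \bar R -> R * Om -> R).
Hypothesis pm_proj : forall z, projects (endpoint z) (eta z) (pm z).
Hypothesis pm_err : forall z, Ex Q' (fun w => `|Y (endpoint z) w - eta z w|) <=
    (2 ^+ z.1)^-1 / (z.1 * 2 ^ z.1).+1%:R.

Definition cell m (t : R) := Num.trunc (t * 2 ^+ m).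

Definition level_proc m (t : R) w := pm (m, cell m t) (tau w) (t, w).

Definition err m w := \sum_(0 <= i < m * 2 ^ m) `|Y (endpoint (m, i)) w - eta (m, i) w|.

(** The additive error [nu m] of the abstract convergence argument. Summing over all cells makes it
    independent of the time at which it is used. *)
Definition err_meas m (A : set Om) := Ex Q' (fun w => err m w * \1_A w).

Let bmY (t : R) : 0 <= t -> bm (Y t : Om' -> R).
Proof. by move=> t0; exact: (@mf_bm _ Om' _ (G t) (G_meas' t0) _ L (Y_mf t0) (Y_bound t)). Qed.

Let bm_term m i : bm (fun w : Om' => `|Y (endpoint (m, i)) w - eta (m, i) w|).
Proof.
apply: bm_norm; apply: bmB; first by apply: bmY; exact: dy_ge0.
by case: (pm_proj (m, i)).
Qed.

Let bm_err m : bm (err m : Om' -> R). Proof. exact: bm_sum. Qed.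

Lemma err_ge0 m w : 0 <= err m w. Proof. exact: sumr_ge0. Qed.

Lemma err_meas_ge0 m A : 0 <= err_meas m A.
Proof.
apply: fine_ge0; apply: integral_ge0 => w _; by rewrite lee_fin mulr_ge0 ?err_ge0.
Qed.

Lemma err_measU m A B : @measurable _ Om' A -> @measurable _ Om' B ->
  A `&` B = set0 -> err_meas m (A `|` B) = err_meas m A + err_meas m B.
Proof.
move=> mA mB AB; rewrite /err_meas -ExD; [|by apply: bmM => //; exact: bm_indic..].
apply: Ex_ext => w; rewrite -mulrDr; congr (_ * _); rewrite !indicE in_setU.
have : ~~ ((w \in A) && (w \in B)).
  apply/negP => /andP[/set_mem Aw /set_mem Bw].
  by have : (A `&` B) w by []; rewrite AB.
by case: (w \in A); case: (w \in B) => //= _; rewrite ?addr0 ?add0r.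
Qed.

Lemma err_meas_le m A : @measurable _ Om' A -> err_meas m A <= (2 ^+ m)^-1.
Proof.
move=> mA; apply: (@le_trans _ _ (Ex Q' (err m))).
  apply: le_Ex => //; first by apply: bmM => //; exact: bm_indic.
  move=> w; rewrite indicE; case: (w \in A); rewrite ?mulr1 ?mulr0//; exact: err_ge0.
rewrite /err Ex_sum//.
apply: (@le_trans _ _ (\sum_(0 <= i < m * 2 ^ m) ((2 ^+ m)^-1 / (m * 2 ^ m).+1%:R))).
  by apply: ler_sum => i _; exact: (pm_err (m, i)).
rewrite sumr_const_nat subn0 -[X in X <= _]mulr_natr -mulrA ler_piMr ?invr_ge0 ?exprn_ge0//.
by rewrite mulrC ler_pdivrMr// mul1r ler_nat.
Qed.

Lemma level_endpoint m (t : R) : endpoint (m, cell m t) = qn m t. Proof. by []. Qed.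

Lemma cell_const m (s t : R) : 0 <= t -> t <= s < qn m t -> cell m s = cell m t.
Proof.
move=> t0 /andP[ts sq]; have p0 : 0 < 2 ^+ m :> R by rewrite exprn_gt0.
have tp : 0 <= t * 2 ^+ m by rewrite mulr_ge0// ltW.
apply: truncn_def; have /andP[t1 _] := truncn_itv tp; apply/andP; split.
  by rewrite (le_trans t1)// ler_pM2r.
by move: sq; rewrite /qn /dy/= ltr_pdivlMr.
Qed.

Lemma level_proc_rc m w (t : R) : live t w -> rc_at (level_proc m ^~ w) t.
Proof.
move=> [/ltW t0 _] r r0; have [_ [_ _ rc _] _] := pm_proj (m, cell m t).
have [de de0 hd] := rc (tau w) w t t0 r r0; have /andP[tq _] := qn_itv m t0.
exists (Num.min de (qn m t - t)); first by rewrite lt_min de0 subr_gt0.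
move=> s /andP[ts]; rewrite -ltrBlDl lt_min => /andP[s1 s2].
rewrite /level_proc (@cell_const m s t)//; last by rewrite ts/=; lra.
by apply: hd; rewrite ts/= -ltrBlDl.
Qed.

Lemma level_diff_mf m (t : R) : 0 <= t ->
  mf (G t) (fun w => \1_(tau_le t) w * level_proc m t w - Y t w).
Proof.
move=> t0; have sG := G_sa t; have [_ [_ _ _ h] _] := pm_proj (m, cell m t).
by apply: mfB => //; [exact: h|exact: Y_mf].
Qed.

Lemma live_tau (t : R) w : live t w -> \1_(tau_le t) w = 1 :> R.
Proof. by move=> [_ [_ _ h]]; rewrite indicE mem_set. Qed.

Lemma level_bad_G m (e t : R) : 0 <= t -> G t (bad Y live level_proc e m t).
Proof.
move=> t0; have sG := G_sa t.
(* The indicator equals 1 on [live t], and only with it is the projection known to be measurable for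
   [G t]. *)
rewrite (_ : bad _ _ _ _ _ _ = live t `&` [set w |
    e < `|\1_(tau_le t) w * level_proc m t w - Y t w|]).
  apply: (saI sG); first exact: live_G.
  apply: (@mf_lt _ _ _ (fun w => `|\1_(tau_le t) w * level_proc m t w - Y t w|)).
  by apply: (@mf_comp _ _ _ (fun x => `|x|)) => //; exact: level_diff_mf.
by apply/seteqP; split => w [lw h]; split => //; move: h => /=; rewrite live_tau// mul1r.
Qed.

Lemma cell_lt m (t : R) : 0 <= t -> t < m%:R -> (cell m t < m * 2 ^ m)%N.
Proof.
move=> t0 tm; have p0 : 0 < 2 ^+ m :> R by rewrite exprn_gt0.
have tp : 0 <= t * 2 ^+ m by rewrite mulr_ge0// ltW.
have /andP[t1 _] := truncn_itv tp; rewrite -(ltr_nat R) natrM natrX.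
by rewrite (le_lt_trans t1)// ltr_pM2r.
Qed.

Lemma level_jumpy_meas m (r t : R) : 0 <= t -> @measurable _ Om' (jumpy Y (@qn R) r m t).
Proof.
apply: (@jumpy_meas _ Om' R G) => // [u _|u v _|u|n u]; first exact: G_sa.
- exact: G_mono.
- exact: G_meas'.
- exact: qn_itv.
Qed.

(** On [A] the level process may be replaced in mean by [eta], hence by [Y (qn m t)] up to [err].
    The move from [Y t] to [Y (qn m t)] is at most [e / 3] off the jump event and at most [2 * L] on
    it. The sign [sg] selects the side of the deviation. *)
Lemma level_est_side m (e t sg : R) A : 0 < e -> sg ^+ 2 = 1 -> 0 <= t -> t < m%:R -> G t A ->
  A `<=` live t -> (forall w, A w -> e <= sg * (level_proc m t w - Y t w)) ->
  (e - e / 3) * Pr Q' A <= 2 * L * Pr Q' (A `&` jumpy Y (@qn R) (e / 3) m t) + err_meas m A.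
Proof.
move=> e0 sg1 t0 tm GA Al hA; have mA : @measurable _ Om' A := G_meas' t0 GA.
have /andP[tq _] := qn_itv m t0; have q0 : 0 <= qn m t by rewrite (le_trans t0)// ltW.
pose z := (m, cell m t); have [beta sp pE] := pm_proj z.
have sgn : `|sg| = 1.
  have : `|sg| ^+ 2 = 1 by rewrite real_normK ?num_real.
  by move=> /eqP; rewrite sqrf_eq1 => /orP[/eqP//|/eqP h]; have := normr_ge0 sg; rewrite h oppr_ge0 ler10.
have Aa : A `<=` active t by move=> w /Al/live_active.
have bA : bm (\1_A : Om' -> R) by exact: bm_indic.
have bm1 := split_proc_bm sp t0 GA Aa.
have E1 : Ex Q' (fun w => eta z w * \1_A w) = Ex Q' (fun w => level_proc m t w * \1_A w).
  by apply: pE => //; rewrite t0 level_endpoint ltW.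
set J := jumpy Y (@qn R) (e / 3) m t.
have mJ : @measurable _ Om' J by exact: level_jumpy_meas.
have mAJ : @measurable _ Om' (A `&` J) by exact: measurableI.
have bYt := bmY t0; have bYq := bmY q0.
have bYtA : bm (fun w : Om' => Y t w * \1_A w) by exact: bmM.
have bc c : bm (fun=> c : R) by exact: bm_cst.
have h1 : e * Pr Q' A <= Ex Q' (fun w => sg * (eta z w * \1_A w - Y t w * \1_A w)).
  have -> : Ex Q' (fun w => sg * (eta z w * \1_A w - Y t w * \1_A w)) =
      Ex Q' (fun w => sg * (level_proc m t w * \1_A w - Y t w * \1_A w)).
    rewrite ExZ; last by apply: bmB => //; exact: bmM.
    rewrite ExZ; last by apply: bmB.
    by rewrite ExB ?E1 -?ExB//; exact: bmM.
  rewrite -Ex_indic// -ExZ//; apply: le_Ex; [exact: bmM|by apply: bmM => //; apply: bmB|].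
  move=> w; rewrite [\1_A w]indicE; case: (boolP (w \in A)) => [/set_mem/hA h|_].
    by rewrite !mulr1.
  by rewrite !mulr0 subr0 mulr0.
have h2 : Ex Q' (fun w => sg * (eta z w * \1_A w - Y t w * \1_A w)) <=
    Ex Q' (fun w => 2 * L * \1_(A `&` J) w + e / 3 * \1_A w + err m w * \1_A w).
  apply: le_Ex.
  - by apply: bmM => //; apply: bmB => //; exact: bmM.
  - apply: bmD; last exact: bmM.
    by apply: bmD; apply: bmM => //; exact: bm_indic.
  move=> w; rewrite indic_setI [\1_A w]indicE; case: (boolP (w \in A)) => _; last first.
    by rewrite !mulr0 !mul0r subr0 !mulr0 !addr0.
  rewrite !mulr1 mul1r.
  have t1 : sg * (eta z w - Y t w) <= `|eta z w - Y t w|.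
    by rewrite (le_trans (ler_norm _))// normrM sgn mul1r.
  have t2 : `|eta z w - Y t w| <= `|Y (qn m t) w - Y t w| + `|Y (qn m t) w - eta z w|.
    rewrite (_ : eta z w - Y t w = (Y (qn m t) w - Y t w) - (Y (qn m t) w - eta z w)); last by ring.
    exact: ler_normB.
  have t3 : `|Y (qn m t) w - eta z w| <= err m w.
    rewrite /err (bigD1_seq (cell m t)) ?iota_uniq//=; last first.
      by rewrite mem_index_iota/= cell_lt.
    by rewrite lerDl sumr_ge0.
  have t4 : `|Y (qn m t) w - Y t w| <= 2 * L * \1_J w + e / 3.
    rewrite indicE; case: (boolP (w \in J)) => [_|nJ].
      rewrite mulr1 (le_trans (ler_normB _ _))//.
      have := Y_bound (qn m t) w; have := Y_bound t w; move: e0; lra.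
    rewrite mulr0 add0r leNgt; apply/negP => h; move/negP: nJ; apply; exact: mem_set.
  lra.
have h3 : Ex Q' (fun w => 2 * L * \1_(A `&` J) w + e / 3 * \1_A w + err m w * \1_A w) =
    2 * L * Pr Q' (A `&` J) + e / 3 * Pr Q' A + err_meas m A.
  have bAJ : bm (\1_(A `&` J) : Om' -> R) by exact: bm_indic.
  rewrite ExD; [|by apply: bmD; apply: bmM|exact: bmM].
  by rewrite ExD; [|exact: bmM..]; rewrite !ExZ// !Ex_indic.
by rewrite mulrBl; move: h1 h2; rewrite h3; lra.
Qed.

Lemma level_est m (e t : R) A : 0 < e -> 0 <= t -> t < m%:R -> G t A ->
  A `<=` bad Y live level_proc e m t ->
  (e - e / 3) * Pr Q' A <= 2 * L * Pr Q' (A `&` jumpy Y (@qn R) (e / 3) m t) + err_meas m A.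
Proof.
move=> e0 t0 tm GA Ab; have sG := G_sa t.
pose f w := \1_(tau_le t) w * level_proc m t w - Y t w.
have mf_f : mf (G t) f by exact: level_diff_mf.
have fE w : A w -> f w = level_proc m t w - Y t w.
  by move=> /Ab[lw _]; rewrite /f live_tau// mul1r.
pose A1 := A `&` [set w | e <= f w]; pose A2 := A `\` [set w | e <= f w].
have GA1 : G t A1 by apply: (saI sG) => //; exact: mf_le.
have GA2 : G t A2 by apply: (saD sG) => //; exact: mf_le.
have mA1 : @measurable _ Om' A1 := G_meas' t0 GA1.
have mA2 : @measurable _ Om' A2 := G_meas' t0 GA2.
have A12 : A1 `&` A2 = set0 by apply/seteqP; split => w // [[_ ?] []].
have AE : A = A1 `|` A2 by rewrite /A1 /A2 setUIDK.
have e1 : (e - e / 3) * Pr Q' A1 <=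
    2 * L * Pr Q' (A1 `&` jumpy Y (@qn R) (e / 3) m t) + err_meas m A1.
  apply: (@level_est_side m e t 1) => //; first by rewrite expr1n.
    by move=> w [/Ab[]].
  by move=> w [Aw h]; rewrite mul1r -fE.
have e2 : (e - e / 3) * Pr Q' A2 <=
    2 * L * Pr Q' (A2 `&` jumpy Y (@qn R) (e / 3) m t) + err_meas m A2.
  apply: (@level_est_side m e t (-1)) => //; first by rewrite sqrrN expr1n.
    by move=> w [/Ab[]].
  move=> w [Aw /negP]; rewrite -ltNge fE// mulN1r => h.
  by have [_] := Ab w Aw; rewrite ltr_normr => /orP[|/ltW//]; lra.
have mJ1 := level_jumpy_meas m (e / 3) t0.
rewrite {1 2}AE setIUl PrU// PrU; last first.
- by rewrite setIACA A12 set0I.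
- exact: measurableI.
- exact: measurableI.
have -> : err_meas m A = err_meas m A1 + err_meas m A2 by rewrite {1}AE err_measU.
by rewrite !mulrDr; move: e1 e2; lra.
Qed.

(** The abstract argument is run under [Q'] for each tolerance [1/(j+1)] and each horizon [K], with
    [al = e - e / 3] and [be = 2 * L]; countably many null events are discarded. *)
Lemma level_cvg : qs (fun w => forall t : R, 0 <= t -> live t w ->
  level_proc m t w @[m --> \oo] --> Y t w).
Proof.
pose e (j : nat) : R := j.+1%:R^-1.
have e0 j : 0 < e j by rewrite invr_gt0.
have G_sa' (t : R) : 0 <= t -> sigma_algebra setT (G t) by move=> _; exact: G_sa.
have G_mono' (s t : R) : 0 <= s -> s <= t -> G s `<=` G t by move=> _; exact: G_mono.
have badG j m (t : R) : 0 <= t -> G t (bad Y live level_proc (e j) m t).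
  by move=> t0; exact: level_bad_G.
have live_pos w (t : R) : live t w -> 0 <= t by move=> [/ltW].
have e3 j : 0 < e j / 3 by rewrite divr_gt0.
have al0 j : 0 < e j - e j / 3 by have := e0 j; lra.
have be0 : 0 < 2 * L by rewrite mulr_gt0.
have est j m (t : R) A := @level_est m (e j) t A (e0 j).
pose M (z : nat * nat) := [set w | forall k, past Y live level_proc (e z.1) k z.2%:R w].
have GM z : Ginf Q F tau (M z).
  apply: (G_Ginf (ler0n R z.2)); apply: (sa_all (G_sa _)) => k.
  exact: (past_meas G_sa' G_mono' (badG z.1)).
have M0 z : Q' (M z) = 0%E.
  exact: (past_null (P := Q') G_sa' G_mono' G_meas' z.2 Yrc Yll (@qn_itv R) Y_mf err_meas_ge0
    err_measU err_meas_le (e0 z.1) (e3 z.1) (al0 z.1) be0 (badG z.1) (est z.1)).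
exists [set w | exists z, M z w]; split.
  by apply: nul_ex => // z; apply: nul_of_Q'.
move=> w nM t t0 lt; apply/cvgrPdist_lt => r r0.
have [j] := ltr_add_invr r0; rewrite add0r => jr.
pose K := (Num.trunc t).+1; have tK : t < K%:R by exact: truncnS_gt.
have nK : ~ (forall k, past Y live level_proc (e j) k K%:R w).
  by move=> h; apply: nM; exists (j, K).
have nb := @bad_evanescent _ Om' R Y live level_proc (e j) K Yrc level_proc_rc live_open live_pos
  w t nK t0 tK.
have [n hn] : exists n, forall m, (n <= m)%N -> ~ bad Y live level_proc (e j) m t w.
  apply: contrapT => h; apply: nb => n; apply: contrapT => h'; apply: h; exists n => m nm bw.
  by apply: h'; exists m.
exists n => // m /= nm; rewrite distrC ltNge; apply/negP => h; apply: (hn m nm); split => //.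
exact: lt_le_trans jr h.
Qed.

Lemma cell_opt m i : opt F [set p | cell m p.1 = i].
Proof.
have sO := @opt_sa R d Om F.
suff : opt F ([set p | dy R (i, m) <= p.1 /\ setT p.2] `&` [set p | p.1 < dy R (i.+1, m)]).
  rewrite /opt/=; congr (optional_sa F _); apply/seteqP; split => -[t w] /=; rewrite /timedom/=.
    move=> [t0 [[h1 _] h2]]; split => //; apply: truncn_def.
    by move: h1 h2; rewrite /dy/= ler_pdivrMr ?exprn_gt0// ltr_pdivlMr ?exprn_gt0// => -> ->.
  move=> [t0 <-]; split => //; have tp : 0 <= t * 2 ^+ m by rewrite mulr_ge0// exprn_ge0.
  have /andP[h1 h2] := truncn_itv tp; rewrite /dy/= ltr_pdivlMr ?exprn_gt0//.
  by rewrite ler_pdivrMr ?exprn_gt0.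
apply: (saI sO); last exact: opt_time_lt.
apply: opt_ge => //; first exact: dy_ge0.
apply: saT; exact/F_sa/dy_ge0.
Qed.

(** The limsup of the level processes as functions on the product space is split-measurable wherever
    it is evaluated; freezing it at [tau] gives [Y] on the live set by [level_cvg]. *)
Lemma good_level (c : R) :
  good (at_tau) [set p | live p.1 p.2] [set p | c < Y p.1 p.2].
Proof.
have sO := @osplit_sa R d Om F.
pose f m (x : \bar R * (R * Om)) : R := pm (m, cell m x.2.1) x.1 x.2.
have mff m : mf (osplit F) (f m).
  move=> B mB; rewrite (_ : f m @^-1` B = [set x | exists i, cell m x.2.1 = i /\
      B (pm (m, i) x.1 x.2)]).
    apply: (sa_ex sO) => i; apply: (saI sO).
      exact: (osplit_opt (cell_opt m i)).
    by have [_ [h _ _ _] _] := pm_proj (m, i); exact: h.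
  by apply/seteqP; split => x /=; [move=> h; eexists|move=> [i [<-]]].
pose g x := limn_esup (fun m => (f m x)%:E).
have mg : measurable_fun (setT : set (g_sigma_algebraType (osplit F))) g.
  apply: measurable_fun_limn_esup => m; apply/measurable_EFinP.
  by apply/mfP.
have oC : osplit F [set x | (c%:E < g x)%E].
  have := mg measurableT `]c%:E, +oo[%classic (emeasurable_itv _).
  rewrite setTI /measurable/= sigma_algebra_id//; congr (osplit F _).
  by apply/seteqP; split => x /=; rewrite in_itv/= andbT.
exists [set p | (c%:E < g (tau p.2, p))%E]; split; first by eexists; [exact: oC|].
apply: qs_sub level_cvg => w h t t0 lt /=.
have cv : (level_proc m t w)%:E @[m --> \oo] --> (Y t w)%:E.
  by apply: cvg_EFin; [exact: nearW|exact: h].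
have -> : g (tau w, (t, w)) = (Y t w)%:E.
  rewrite /g is_cvg_limn_esupE; first exact/cvg_lim.
  by apply/cvg_ex; exists (Y t w)%:E.
by rewrite lte_fin.
Qed.

End WithFamily.
End CadlagApproximation.

(** [X] is clipped to a bounded range and set to zero from [T] on. Neither operation alters the
    level set [{c < X}] on the live set, where [t < T], and both preserve the cadlag property. *)
Lemma good_live (X : R -> Om -> R) (c : R) : cadlag X ->
  (forall t : R, 0 <= t -> mf (G t) (X t)) ->
  good (at_tau) [set p | live p.1 p.2] [set p | c < X p.1 p.2].
Proof.
move=> /cadlagP[Xrc Xll] aX.
(* Strictly larger than [|c|], so that clipping at [-L] and [L] does not change which values exceed
   [c]. *)
pose L : R := (Num.trunc `|c|).+1%:R.
have cL : `|c| < L by exact: truncnS_gt.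
have L0 : 0 < L by exact: le_lt_trans cL.
pose clip (y : R) : R := Num.max (- L) (Num.min y L).
have clip_bound y : `|clip y| <= L.
  rewrite /clip ler_norml; apply/andP; split; first by rewrite le_max lexx.
  by rewrite ge_max; apply/andP; split; [lra|rewrite ge_min lexx orbT].
have clip_lip y y' : `|clip y - clip y'| <= `|y - y'|.
  have lip a b : a <= b -> 0 <= clip b - clip a <= b - a.
    move: L0; rewrite /clip /Num.max /Num.min => L0 ab.
    by case: (ltP a L) => ?; case: (ltP b L) => ?; case: (ltP (- L) a) => ?;
      case: (ltP (- L) b) => ?; case: (ltP (- L) L) => ?; lra.
  have [/lip|/ltW/lip] := leP y y'; rewrite ?(distrC y) ?(distrC (clip y)) => /andP[h1 h2].
    by rewrite ger0_norm// (le_trans h2)// ler_norm.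
  by rewrite distrC ger0_norm// distrC (le_trans h2)// ler_norm.
have clip_lt y : (c < clip y) <-> (c < y).
  move: cL; rewrite ltr_norml => /andP[c1 c2].
  rewrite /clip lt_max lt_min c2 andbT (_ : c < - L = false) //=; lra.
have mclip : measurable_fun setT clip.
  by apply: measurable_maxr; [exact: measurable_cst|apply: measurable_minr => //; exact: measurable_cst].
pose Y (t : R) w := if (t%:E < T w)%E then clip (X t w) else 0.
have Y_bound (t : R) w : `|Y t w| <= L.
  by rewrite /Y; case: ifP => _ //; rewrite normr0 ltW.
have Y_T (t : R) w : (T w <= t%:E)%E -> Y t w = 0 by rewrite /Y ltNge => ->.
have Y_mf (t : R) : 0 <= t -> mf (G t) (Y t).
  move=> t0; have sG := G_sa t.
  rewrite (_ : Y t = fun w => if w \in [set w | (t%:E < T w)%E] then clip (X t w) else 0).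
    apply: mf_if => //; first by apply: (F_G t0); exact: T_gt.
      by apply: mf_comp => //; exact: aX.
    exact: mf_cst.
  apply/funext => w; rewrite /Y; congr (if _ then _ else _).
  by apply/idP/idP => [h|/set_mem//]; exact: mem_set.
have Yrc w (t : R) : 0 <= t -> rc_at (Y ^~ w) t.
  move=> t0 r r0; have [tT|Tt] := ltP t%:E (T w); last first.
    exists 1 => // s /andP[ts _]; rewrite !Y_T ?subrr ?normr0//.
    by apply: le_trans Tt _; rewrite lee_fin.
  have [d1 d10 hd1] : exists2 de : R, 0 < de & ((t + de)%:E <= T w)%E.
    case: (T w) tT => [u| |//]; last by exists 1 => //; rewrite leey.
    by rewrite lte_fin => tr; exists (u - t); rewrite ?subr_gt0// addrC subrK.
  have [d2 d20 hd2] := Xrc w t t0 r r0; exists (Num.min d1 d2); first by rewrite lt_min d10.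
  move=> s /andP[ts]; rewrite -ltrBlDl lt_min => /andP[s1 s2].
  have sT : (s%:E < T w)%E by apply: lt_le_trans hd1; rewrite lte_fin -ltrBlDl.
  rewrite /Y tT sT (le_lt_trans (clip_lip _ _))//; apply: hd2.
  by rewrite ts/= -ltrBlDl.
have Yll w (t : R) : 0 < t -> ll_at (Y ^~ w) t.
  move=> t0; have [tT|Tt] := leP t%:E (T w); last first.
    have [u uT ut] : exists2 u : R, (T w <= u%:E)%E & u < t.
      have [T0 _] := hT; have := T0 w; case: (T w) Tt => // u; rewrite lte_fin => ut _.
      by exists u.
    exists 0 => r r0; exists (t - u); first by rewrite subr_gt0.
    move=> s /andP[s1 s2]; rewrite Y_T ?subrr ?normr0//.
    by apply: le_trans uT _; rewrite lee_fin; lra.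
  have [l hl] := Xll w t t0; exists (clip l) => r r0; have [de de0 hd] := hl r r0.
  exists de => // s hs; have /andP[_ st] := hs.
  have sT : (s%:E < T w)%E by apply: lt_le_trans tT; rewrite lte_fin.
  by rewrite /Y sT (le_lt_trans (clip_lip _ _))//; exact: hd.
have [eta [pm hpm]] := approx_family Y_mf Y_bound Y_T.
have [D [VD h]] := good_level L0 Yrc Yll Y_mf Y_bound
  (fun z => (hpm z).1) (fun z => (hpm z).2) c.
exists D; split => //; apply: qs_sub h => w h t t0 lt; have := h t t0 lt; rewrite /= /Y; have [_ [_ -> _]] := lt.
by have := clip_lt (X t w); tauto.
Qed.

End SplittingMeasure.

(** * The splitting formula *)

Lemma good_levels V E (Y : R -> Om -> R) :
  (forall B, optional_sa G B -> good V E B) -> optional_proc G Y ->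
  exists D : rat -> set (R * Om), (forall q, V (D q)) /\ qs (fun w => forall t : R,
    0 <= t -> E (t, w) -> forall q, D q (t, w) <-> ratr q < Y t w).
Proof.
move=> gE oY.
have /choice[D hD] (q : rat) : good V E [set p | ratr q < Y p.1 p.2].
  have [D [VD h]] := gE _ (oY `](ratr q), +oo[%classic (measurable_itv _)).
  exists D; split => //; apply: qs_sub h => w h t t0 Et.
  by have := h t t0 Et; rewrite /timedom/= in_itv/= andbT; tauto.
exists D; split; first by move=> q; case: (hD q).
apply: (qs_sub _ (qs_all (fun q => (hD q).2))) => w h t t0 Et q.
by apply: iff_sym; exact: h.
Qed.

(** The rational level sets of [Y] have representatives on each side of [tau]; [lift_levels] turns
    them into [Y'] and [Y''], and one null set serves all rationals. *)
Lemma splitting_of_good (A : set (R * Om)) (Y : R -> Om -> R) : optional_proc G Y ->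
  (forall B, optional_sa G B -> good (opt F) (A `&` before_tau) B) ->
  (forall B, optional_sa G B ->
    good (at_tau) (A `&` [set p | (tau p.2 <= p.1%:E)%E]) B) ->
  splitting Q F tau Y A.
Proof.
move=> oY g1 g2.
have [D1 [VD1 h1]] := good_levels g1 oY.
have [D2 [VD2 h2]] := good_levels g2 oY.
have [f1 [mf1 e1]] := lift_levels R (@opt_sa R d Om F) VD1.
have /choice[C hC] : forall q, exists C, osplit F C /\ D2 q = [set p | C (tau p.2, p)].
  by move=> q; have [C oC E] := VD2 q; exists C.
have [f2 [mf2 e2]] := lift_levels R (@osplit_sa R d Om F) (fun q => (hC q).1).
exists (fun t w => f1 (t, w)); split.
  move=> B mB; have := mf1 B mB; rewrite /opt/=; congr (optional_sa F (_ `&` _)).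
  by apply/seteqP; split => -[].
exists (fun x t w => f2 (x, (t, w))); split.
  move=> B mB; have := mf2 B mB; rewrite /osplit/=; congr (split_sa F (_ `&` _)).
  by apply/seteqP; split => -[x []].
have [M [[NM QM] hM]] := qs_and h1 h2; exists M; split => // w /hM[{}h1 {}h2] t t0.
have [At|nAt] := boolP ((t, w) \in A); last by rewrite !indicE (negbTE nAt) !mulr0.
rewrite ![\1_A _]indicE At !mulr1 !indicE; have [tt|tt] := ltP t%:E (tau w).
  rewrite mem_set// memNset/=; last by rewrite leNgt tt.
  rewrite mulr1 mulr0 addr0; apply/esym/e1 => q; apply: h1 => //.
  by split => //; exact: set_mem.
rewrite memNset/=; last by rewrite ltNge tt.
rewrite mem_set// mulr1 mulr0 add0r; apply/esym/e2 => q.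
have [_ E] := hC q; rewrite (_ : C q _ = D2 q (t, w)); last by rewrite E.
apply: h2 => //; by split => //; exact: set_mem.
Qed.

(** The open interval is the union over [n] of the right-closed sets [{tau <= t - 1/(n+1)}], each
    increasing in time and adapted. *)
Lemma after_optional : optional_sa G (after tau).
Proof.
have sG (t : R) : 0 <= t -> sigma_algebra setT (G t) by move=> _; exact: G_sa.
have : opt G [set p | exists n, (tau p.2 <= (p.1 - n.+1%:R^-1)%:E)%E].
  apply: (sa_ex (@opt_sa R d Om G)) => n.
  apply: (opt_upset sG (Z := fun t w => (tau w <= (t - n.+1%:R^-1)%:E)%E)).
  - move=> t t0; apply: (@G_mono (t - n.+1%:R^-1)); last exact: tau_le_G.
    by rewrite gerBl.
  - by move=> s t w st h; apply: le_trans h _; rewrite lee_fin lerD2r.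
  - move=> t w h; apply/lee_addgt0Pr => e e0.
    have : (tau w <= (t + e - n.+1%:R^-1)%:E)%E by apply: h; rewrite ltrDl.
    by rewrite -EFinD addrAC.
rewrite /opt/=; congr (optional_sa G _); apply/seteqP; split => -[t w] /=; rewrite /after/timedom/=.
  move=> [t0 [n h]]; split => //; apply: le_lt_trans h _.
  by rewrite lte_fin ltrBlDr ltrDl invr_gt0.
move=> [t0 h]; split => //; have := tau_ge0 w; case: (tau w) h => // r.
rewrite lte_fin => /ltr_add_invr[n hn] _; exists n.
by rewrite lee_fin lerBrDr ltW.
Qed.

Lemma timedom_optional : optional_sa G timedom.
Proof. by have := saT (@opt_sa R d Om G); rewrite /opt/= setIT. Qed.

Lemma opt_lt_stopping (T : Om -> \bar R) : stopping_time F T ->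
  opt F [set p | (p.1%:E < T p.2)%E].
Proof.
move=> [T0 hT]; have sO := @opt_sa R d Om F.
rewrite (_ : [set p | _] = ~` [set p | (T p.2 <= p.1%:E)%E]).
  apply: (saC sO); apply: (opt_upset F_sa (Z := fun t w => (T w <= t%:E)%E)) => //.
  - by move=> s t w st h; apply: le_trans h _; rewrite lee_fin.
  - move=> t w h; apply/lee_addgt0Pr => e e0.
    by rewrite -EFinD; apply: h; rewrite ltrDl.
by apply/seteqP; split => -[t w] /=; rewrite ltNge => /negP.
Qed.

Lemma good_sint_oo E (S T : Om -> \bar R) : stopping_time G S -> stopping_time F T ->
  good (at_tau) E (sint_oo S T).
Proof.
move=> hS hT; have saV := good_sa E at_tau_sa.
have [D [VD h]] : good (at_tau) E
    ([set p | (S p.2 < p.1%:E)%E] `&` [set p | (p.1%:E < T p.2)%E]).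
  apply: (saI saV); first exact: good_stopping_gt.
  by apply: good_V; apply: at_tau_opt; exact: opt_lt_stopping.
exists D; split => //; apply: qs_sub h => w h t t0 Et.
by have := h t t0 Et; rewrite /sint_oo/=; tauto.
Qed.

(** * Gluing over the countable cover *)

Section Cover.
Variables (S T : nat -> Om -> \bar R).
Variable Qj : nat -> probability (g_sigma_algebraType (Ginf Q F tau)) R.
Hypothesis hS : forall j, stopping_time G (S j).
Hypothesis hT : forall j, stopping_time F (T j).
Hypothesis hQj : forall j, sH_measure (Qj j) (S j) (T j).

Lemma good_cell E j (X : R -> Om -> R) (c : R) : E `<=` from_pos tau -> cadlag X ->
  (forall t : R, 0 <= t -> mf (G t) (X t)) ->
  good (at_tau) (E `&` sint_oo (S j) (T j)) [set p | c < X p.1 p.2].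
Proof.
move=> Ep cX aX.
have g := good_live (hS j) (hT j) (hQj j) c cX aX.
by apply: good_sub g => -[t w] [/Ep[/= t0 h] [_ [h1 h2]]].
Qed.

Lemma splitting_after Y : after tau `<=` \bigcup_j sint_oo (S j) (T j) ->
  optional_proc G Y -> splitting Q F tau Y (after tau).
Proof.
move=> cov oY; apply: splitting_of_good => // B oB.
  apply: (good_sub (E := set0)).
    move=> [t w] [[_ /= h1]]; rewrite /before_tau/= => h2.
    by have := lt_trans h1 h2; rewrite ltxx.
  by exists set0; split; [exact: sa0 (@opt_sa R d Om F)|exact: qsT].
apply: (good_sub (E := after tau)); first by move=> p [].
apply: (good_optional at_tau_sa) oB => X cX aX c.
apply: (good_glue at_tau_sa cov) => j; first exact: good_sint_oo.
apply: good_cell => // -[t w] [/= t0 h]; split; last exact: ltW.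
by rewrite -lte_fin /=; apply: le_lt_trans h; exact: tau_ge0.
Qed.

Lemma splitting_timedom Y : from_pos tau `<=` \bigcup_j sint_oo (S j) (T j) ->
  optional_proc G Y -> splitting Q F tau Y timedom.
Proof.
move=> cov oY; apply: splitting_of_good => // B oB.
  apply: (good_sub (E := before_tau)); first by move=> p [].
  by apply: (good_optional (@opt_sa R d Om F)) oB => X cX aX c; exact: good_before.
apply: (good_optional at_tau_sa) oB => X cX aX c.
(* Time [0] is never in an open interval [(S j, T j)], so it is added as a piece of its own and
   handled by [good_zero]. *)
pose Ej j := if j is i.+1 then sint_oo (S i) (T i) else [set p : R * Om | p.1 = 0 /\ setT p.2].
apply: (good_glue (Ej := Ej) at_tau_sa) => [[t w] [/= t0 h]|[|j]|[|j]].
- move: t0; rewrite /timedom/= le_eqVlt => /predU1P[<-|t0]; first by exists 0%N.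
  by have [|j _ hj] := cov (t, w); [|exists j.+1].
- apply: good_V; apply: at_tau_opt; apply: opt_time0 => //; exact: saT (F_sa (lexx 0)).
- exact: good_sint_oo.
- have g := good_zero c aX.
  by apply: good_sub g => -[t w] [[_ h] [/= t0 _]].
- apply: (good_sub (E := from_pos tau `&` sint_oo (S j) (T j))); last exact: good_cell.
  move=> [t w] [[_ /= h] [t0 [h1 h2]]]; split => //; split => //=.
  by rewrite -lte_fin; apply: le_lt_trans h1; have [h0 _] := hS j; exact: h0.
Qed.

End Cover.
End Enlargement.

Theorem mainTheorem13
  (R : realType) (d : measure_display) (Om : measurableType d)
  (Q : probability Om R) (F : R -> set (set Om))
  (hF_sa : forall t : R, 0 <= t -> sigma_algebra setT (F t))
  (hF_A : forall t : R, 0 <= t -> F t `<=` measurable)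
  (hF_incr : forall s t : R, 0 <= s -> s <= t -> F s `<=` F t)
  (hF_rc : forall t : R, 0 <= t ->
     F t = \bigcap_(s in [set s : R | t < s]) F s)
  (hF_null : nullsa Q (sa_inf F) `<=` F 0)
  (tau : Om -> \bar R)
  (htau_meas : measurable_fun setT tau)
  (htau_pos : forall w, (0 <= tau w)%E)
  (hN_A : Ncal Q F tau `<=` measurable)
  (S T : nat -> Om -> \bar R)
  (hS : forall j, stopping_time (Gfilt Q F tau) (S j))
  (hT : forall j, stopping_time (Gfilt Q F tau) (T j))
  (hT_F : forall j, stopping_time F (T j))
  (Qj : nat -> probability (g_sigma_algebraType (Ginf Q F tau)) R)
  (hQj : forall j, sH_measure (Qj j) (S j) (T j)) :
  (after tau `<=` \bigcup_(j in [set: nat]) sint_oo (S j) (T j) ->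
     Lo Q F tau (after tau)) /\
  (from_pos tau `<=` \bigcup_(j in [set: nat]) sint_oo (S j) (T j) ->
     Lo Q F tau timedom).
Proof.
split=> cov; split.
- exact: after_optional.
- by move=> Y oY; exact: (splitting_after hF_sa hF_A hF_incr hF_rc hF_null htau_meas htau_pos
    hN_A hS hT_F hQj cov oY).
- exact: timedom_optional.
- by move=> Y oY; exact: (splitting_timedom hF_sa hF_A hF_incr hF_rc hF_null htau_meas htau_pos
    hN_A hS hT_F hQj cov oY).
Qed.
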